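(* Let $(D_n)_{n\ge1}$ be connected regular domains of the family $\mathcal D$ such that $x_0\in D_1$, $D_n\Subset D_{n+1}$ for all $n$, and $D=\bigcup_{n\ge1}D_n$, and suppose that for every $n$ the relative kernel $K_{D_n}$ has a jointly continuous version on $D_n\times\partial D_n$. Let $\mathcal H_+(D)$ be the cone of nonnegative harmonic functions on $D$. Then every $u\in\mathcal H_+(D)\setminus\{0\}$ satisfies $u(x)>0$ for all $x\in D$. The vector space $\mathcal V(D):=\mathcal H_+(D)-\mathcal H_+(D)$, ordered by the cone $\mathcal H_+(D)$, is a vector lattice: every pair of elements has a least upper bound and a greatest lower bound within $\mathcal V(D)$. Consequently the compact normalized base $\mathcal H_1(D)$ is a Choquet simplex, meaning that for every $h\in\mathcal H_1(D)$ there is a unique Borel measure $\mu$ on $\mathcal H_1(D)$ carried by the set $\mathcal E(D)$ of extreme points with $\mu(\mathcal E(D))=1$ and $h(x)=\int_{\mathcal E(D)}g(x)\,d\mu(g)$ for all $x\in D$.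
   Context: Let $X$ be a metric space. A domain is a nonempty connected open set; $V\Subset U$ means that $\overline V$ is compact and contained in $U$. Measures are positive Borel measures (completed when integrable functions are considered). A harmonic measure on a domain $U$ with $\partial U\ne\varnothing$ is a family $\{\omega_x^U:x\in U\}$ of measures on $\partial U$ with $\omega_x^U(\partial U)=1$ and $\omega_x^U\ll\omega_y^U$ for all $x,y\in U$; write $\omega_x^U(f)=\int_{\partial U}f\,d\omega_x^U$. It is continuous if $x\mapsto\omega_x^U(f)$ is continuous on $U$ for every $f\in\bigcap_{x\in U}L^1(\partial U,\omega_x^U)$, and Radon if every $\omega_x^U$ is Radon. The domain $U$ is regular if for every $\zeta\in\partial U$ and every bounded Borel $f$ on $\partial U$ continuous at $\zeta$ one has $\omega_x^U(f)\to f(\zeta)$ as $U\ni x\to\zeta$. Standing framework: $\mathcal D$ is a family of domains of $X$, each with nonempty boundary and equipped with a continuous Radon harmonic measure, such that (i) every $U\in\mathcal D$ is the union of an increasing sequence of regular domains of $\mathcal D$ whose closures are compact and contained in $U$; (ii) for $V\Subset U$ in $\mathcal D$ with $V$ regular, $\omega_x^U(f)=\int_{\partial V}\omega_y^U(f)\,d\omega_x^V(y)$ for all $x\in V$ and all bounded Borel $f$ on $\partial U$. $D\subseteq X$ is a domain and $x_0\in D$ is fixed. A function $u:W\to\mathbb R$ on an open set $W$ is harmonic if it is continuous and $u(x)=\int_{\partial V}u\,d\omega_x^V$ for every regular $V\in\mathcal D$ with $V\Subset W$ and every $x\in V$. $\mathcal H_1(D)$ is the set of strictly positive harmonic functions $h$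 on $D$ with $h(x_0)=1$, with the topology of locally uniform convergence (compact and metrizable under the stated hypotheses), and $\mathcal E(D)$ is its set of extreme points. For regular $U\in\mathcal D$ with $U\Subset D$, $x_0\in U$, the relative kernel is $K_U(x,y)=\frac{d\omega_x^U}{d\omega_{x_0}^U}(y)$. *)

(* Defs.v *)
From HB Require Import structures.
From mathcomp Require Import all_boot all_order all_algebra.
From mathcomp Require Import all_classical all_reals all_analysis.

Set Implicit Arguments.
Unset Strict Implicit.
Unset Printing Implicit Defensive.

Import Order.TTheory GRing.Theory Num.Theory.
Import numFieldNormedType.Exports.

Local Open Scope classical_set_scope.
Local Open Scope ring_scope.
Local Open Scope charge_scope.

(* Measurable types of the library carry a base point; [pointed_at x] is T with
   x as base point, so that [borel x] is T with its Borel sigma-algebra.  The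
   sigma-algebra does not depend on x. *)
Definition pointed_at (T : topologicalType) (x : T) : Type := T.

HB.instance Definition _ (T : topologicalType) (x : T) :=
  Topological.copy (pointed_at x) T.
HB.instance Definition _ (T : topologicalType) (x : T) :=
  isPointed.Build (pointed_at x) x.

Definition borel (T : topologicalType) (x : T) :=
  g_sigma_algebraType (@open (pointed_at x)).

Section domains.
Context {X : topologicalType}.
Implicit Types U V : set X.

Definition is_domain U := [/\ U !=set0, connected U & open U].

Definition bd U : set X := closure U `\` interior U.

Definition rel_compact V U := compact (closure V) /\ closure V `<=` U.

End domains.

Section completion.
Context {d : measure_display} {T : measurableType d} {R : realType}.
Variable mu : {measure set T -> \bar R}.

Definition completed_measurable (A : set T) :=
  exists B C : set T, [/\ measurable B, measurable C,
    B `<=` A, A `<=` C & mu (C `\` B) = 0%E].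

(* [integral] is defined for arbitrary functions, through the suprema of the
   integrals of the simple measurable functions below the positive and negative
   parts; on functions measurable for the completion of mu it is the integral
   with respect to that completion. *)
Definition completed_L1 (B : set T) (f : T -> R) :=
  (forall Y : set R, measurable Y -> completed_measurable (B `&` f @^-1` Y)) /\
  (\int[mu]_(y in B) `|f y|%:E < +oo)%E.

End completion.

Section harmonic_measure.
Context {R : realType} {X : metricType R} {x0 : X}.

(* [om U x] is the harmonic measure of the domain U at the point x of U; a
   measure on the closed set bd U is seen as a measure on X which does not
   charge the complement of bd U.  The values of [om U x] for x outside U, or
   for U outside the family of domains, are irrelevant. *)
Variable om : set X -> X -> probability (borel x0) R.

Definition mean (U : set X) (f : X -> R) (x : X) : R :=
  \int[om U x]_(y in bd U) f y.

Definition harmonic_measure (U : set X) :=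
  (forall x, U x -> om U x (bd U) = 1%E) /\
  (forall x y, U x -> U y -> om U x `<< om U y).

Definition continuous_hm (U : set X) := forall f : X -> R,
  (forall x, U x -> completed_L1 (om U x) (bd U) f) ->
  {within U, continuous (mean U f)}.

(* Local finiteness is automatic for probability measures. *)
Definition radon_hm (U : set X) := forall x, U x ->
  forall A : set (borel x0), measurable A -> A `<=` bd U ->
  om U x A = ereal_sup
    [set om U x K | K in [set K : set X | compact K /\ K `<=` A]].

Definition bounded_borel (B : set X) (f : X -> R) :=
  measurable_fun (B : set (borel x0)) (f : borel x0 -> R) /\
  exists M : R, forall y, B y -> `|f y| <= M.

Definition regular (U : set X) := forall z, bd U z ->
  forall f : X -> R, bounded_borel (bd U) f ->
  f y @[y --> within (bd U) (nbhs z)] --> f z ->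
  mean U f x @[x --> within U (nbhs z)] --> f z.

Record harmonic_framework (Dom : set (set X)) : Prop := {
  hf_domain : forall U, Dom U -> is_domain U;
  hf_bd : forall U, Dom U -> bd U !=set0;
  hf_measure : forall U, Dom U -> harmonic_measure U;
  hf_continuous : forall U, Dom U -> continuous_hm U;
  hf_radon : forall U, Dom U -> radon_hm U;
  hf_exhaustion : forall U, Dom U -> exists W : nat -> set X,
    [/\ forall n, [/\ Dom (W n), regular (W n) & rel_compact (W n) U],
        forall n, W n `<=` W n.+1 & U = \bigcup_n W n];
  hf_consistent : forall U V, Dom U -> Dom V -> rel_compact V U -> regular V ->
    forall (f : X -> R), bounded_borel (bd U) f ->
    forall x, V x -> mean U f x = mean V (mean U f) x }.

Definition relative_kernel (U : set X) (x y : X) : \bar R :=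
  ('d (charge_of_finite_measure (om U x)) '/d (om U x0)) y.

Definition continuous_kernel (U : set X) := exists k : X * X -> R,
  {within U `*` bd U, continuous k} /\
  forall x, U x ->
    {ae om U x0, forall y, bd U y -> relative_kernel U x y = (k (x, y))%:E}.

Section harmonic_functions.
Variable Dom : set (set X).

(* Functions on W are functions on the subtype of X attached to W (with the
   induced topology); ['valL_0 u] is the extension of u to X by 0. *)
Definition is_harmonic (W : set X) (u : W -> R) :=
  continuous u /\
  forall V : set X, Dom V -> regular V -> rel_compact V W ->
  forall x : W, V (set_val x) -> u x = mean V ('valL_0 u) (set_val x).

Variable D : set X.

Definition harmonic_nonneg : set (D -> R) :=
  [set u | is_harmonic u /\ forall x, 0 <= u x].

(* [{family compact, D -> R}] carries the topology of uniform convergence on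
   the compact subsets of D; it is that of locally uniform convergence, as D is
   locally compact. *)
Definition harmonic_one : set {family compact, D -> R} :=
  [set h : D -> R | [/\ is_harmonic h, forall x, 0 < h x & 'valL_0 h x0 = 1]].

End harmonic_functions.
End harmonic_measure.

Section cones.
Context {R : realType} {T : Type}.
Implicit Types (C W : set (T -> R)) (u v w : T -> R).

Definition cone_space C : set (T -> R) :=
  [set w | exists u v, [/\ C u, C v & w = u \- v]].

Definition cone_le C u v := C (v \- u).

Definition is_lub_in C W u v s := [/\ W s, cone_le C u s, cone_le C v s &
  forall w, W w -> cone_le C u w -> cone_le C v w -> cone_le C s w].

Definition is_glb_in C W u v s := [/\ W s, cone_le C s u, cone_le C s v &
  forall w, W w -> cone_le C w u -> cone_le C w v -> cone_le C w s].

Definition convex_cone C := [/\ C (cst 0),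
  forall u v, C u -> C v -> C (u \+ v) &
  forall (a : R) u, 0 <= a -> C u -> C (fun x => a * u x)].

Definition linear_subspace W := W (cst 0) /\
  forall (a : R) u v, W u -> W v -> W (fun x => a * u x + v x).

Definition vector_lattice C (W := cone_space C) :=
  [/\ linear_subspace W,
      convex_cone C,
      forall u v, W u -> W v -> cone_le C u v -> cone_le C v u -> u = v,
      forall u v, W u -> W v -> exists s, is_lub_in C W u v s &
      forall u v, W u -> W v -> exists s, is_glb_in C W u v s].

End cones.

Section simplex.
Context {R : realType} {T : topologicalType}.
Variable S : set {family compact, T -> R}.

Definition extreme_points : set S :=
  [set h : S | forall (f g : S) (t : R), 0 < t < 1 ->
    (forall x, set_val h x = t * set_val f x + (1 - t) * set_val g x) ->
    f = h /\ g = h].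

Definition represents (h : S) (mu : {measure set (borel h) -> \bar R}) :=
  [/\ measurable (extreme_points : set (borel h)),
      mu (~` extreme_points) = 0%E,
      mu extreme_points = 1%E &
      forall x : T, (set_val h x)%:E =
        (\int[mu]_(g in extreme_points) (set_val (g : S) x)%:E)%E].

(* Library measures are functions on all sets, measurable or not, so the
   equality of two measures is that of their values on measurable sets. *)
Definition choquet_simplex :=
  compact S /\
  forall h : S, exists mu : {measure set (borel h) -> \bar R},
    represents mu /\
    forall nu : {measure set (borel h) -> \bar R}, represents nu ->
    forall A : set (borel h), measurable A -> nu A = mu A.

End simplex.

(* Main.v *)
Require Import Defs.
From mathcomp Require Import all_boot all_order all_algebra.
From mathcomp Require Import all_classical all_reals all_analysis.
From mathcomp Require Import measurable_realfun ring lra.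

Set Implicit Arguments.
Unset Strict Implicit.
Unset Printing Implicit Defensive.

Import Order.TTheory GRing.Theory Num.Theory.
Import numFieldNormedType.Exports.

Local Open Scope classical_set_scope.
Local Open Scope ring_scope.

(** The means over the boundaries of the D_n carry the whole argument.

    Positivity.  A nonnegative harmonic function that vanishes at a point of D_n
    vanishes almost everywhere for the harmonic measure of D_n at that point,
    hence for all harmonic measures of D_n, hence on D_n ([harm_eq0]).

    Lattice.  If u and v are harmonic with a common harmonic majorant, the means
    of max(u, v) over the boundaries of the D_n increase with n, because u and v
    reproduce themselves and max(u, v) is subharmonic.  Their limit inherits the
    mean value property, continuity comes for free, and the limit lies below
    every harmonic majorant: it is the least upper bound ([harm_lub]).

    Compactness.  Write u(x) as the integral of u times k(x, .) against the
    harmonic measure at x0, k being the continuous kernel.  Bounding k and its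
    variation in x gives a Harnack inequality and an equicontinuity estimate,
    both linear in u(x0) ([harm_harnack], [harm_equicontinuous]).  Pointwise
    limits of positive harmonic functions are therefore locally uniform and
    harmonic ([nonneg_closed], [compact_harmonic_one]).

    Simplex.  Only the following is then used of the cone C of nonnegative
    harmonic functions: it is closed for pointwise convergence, it satisfies a
    Harnack inequality, it has the Riesz decomposition property, and countably
    many points separate it.  For a sublinear p on C let hat p (h) be the
    supremum of the sums p(u_1) + ... + p(u_n) over the finite decompositions
    h = u_1 + ... + u_n in C.  Riesz decomposition makes hat p additive ([hatD]),
    compactness makes it upper semicontinuous ([hat_usc]), and together they
    give the barycentre formula ([hat_barycenter]): hat p of a barycentre is the
    integral of hat p.

    Uniqueness.  At an extreme point hat p = p, so every representing measure nu
    of h carried by the extreme points satisfies nu(p) = hat p (h).  Maxima of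
    linear forms are admissible p, and they determine a measure
    ([measure_halfspaces_eq]).

    Existence.  Decompose h again and again, each decomposition refining the
    previous one and nearly attaining hat p (h) for the first few of the
    functions p(u) = u(x_k)^2 / u(o).  Laying the pieces side by side on [0, 1[
    with lengths u(o) gives a martingale of step functions with values in the
    base of C; its quadratic increments are bounded by the defect of the sums,
    so it converges almost everywhere.  The law mu of the limit represents h and
    satisfies mu(p) = hat p (h) = mu(hat p); thus p = hat p almost everywhere
    for each square p, and as the squares are strictly convex this forces mu to
    be carried by the extreme points ([near_optimal_limit],
    [represents_exists]). *)

(** * Bounded measurable functions *)

Section bounded_functions.
Context {d} {T : measurableType d} {R : realType}.
Implicit Types (A : set T) (f g : T -> R) (mu : {measure set T -> \bar R}).

Definition bounded_measurable A f :=
  measurable_fun A f /\ exists M : R, forall x, A x -> `|f x| <= M.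

Lemma bounded_measurableS A B f : measurable A -> A `<=` B ->
  bounded_measurable B f -> measurable B -> bounded_measurable A f.
Proof.
move=> mA AB [mf [M fM]] mB; split; first exact: measurable_funS mf.
by exists M => x /AB; exact: fM.
Qed.

Lemma bounded_measurable_cst A (r : R) : bounded_measurable A (cst r).
Proof. by split; [exact: measurable_cst|exists `|r|]. Qed.

Lemma bounded_measurableD A f g : bounded_measurable A f ->
  bounded_measurable A g -> bounded_measurable A (fun x => f x + g x).
Proof.
move=> [mf [M fM]] [mg [N gN]]; split; first exact: measurable_funD.
exists (M + N) => x Ax; apply: le_trans (ler_normD _ _) _.
by apply: lerD; [exact: fM|exact: gN].
Qed.

Lemma bounded_measurableM A f g : bounded_measurable A f ->
  bounded_measurable A g -> bounded_measurable A (fun x => f x * g x).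
Proof.
move=> [mf [M fM]] [mg [N gN]]; split; first exact: measurable_funM.
exists (M * N) => x Ax; rewrite normrM.
by apply: ler_pM => //; [exact: fM|exact: gN].
Qed.

Lemma bounded_measurableZ A (r : R) f : bounded_measurable A f ->
  bounded_measurable A (fun x => r * f x).
Proof. by move=> fb; apply: bounded_measurableM => //; exact: bounded_measurable_cst. Qed.

Lemma bounded_measurableB A f g : bounded_measurable A f ->
  bounded_measurable A g -> bounded_measurable A (fun x => f x - g x).
Proof.
move=> fb gb; under eq_fun do rewrite -mulN1r.
by apply: bounded_measurableD => //; exact: bounded_measurableZ.
Qed.

Variable mu : {measure set T -> \bar R}.

Lemma bounded_measurable_integrable A f : measurable A -> (mu A < +oo)%E ->
  bounded_measurable A f -> mu.-integrable A (EFin \o f).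
Proof.
move=> mA Aoo [mf [M fM]]; apply: measurable_bounded_integrable => //.
by exists M; split; [exact: num_real|move=> r Mr x /fM/le_trans; apply; exact: ltW].
Qed.

Lemma bounded_convergence A (f_ : nat -> T -> R) f (M : R) : measurable A ->
  (mu A < +oo)%E -> (forall n, measurable_fun A (f_ n)) ->
  (forall n x, A x -> `|f_ n x| <= M) ->
  (forall x, A x -> f_ ^~ x @ \oo --> f x) ->
  bounded_measurable A f /\
  (fun n => \int[mu]_(x in A) f_ n x) @ \oo --> \int[mu]_(x in A) f x.
Proof.
move=> mA Aoo mf fM ff.
have fb : bounded_measurable A f.
  split; first exact: (measurable_fun_cvg mf ff).
  exists M => x Ax; apply: (cvgr_to_le (cvg_norm (ff x Ax))) _.
  by apply: nearW => n; exact: fM.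
split=> //; have fi := bounded_measurable_integrable mA Aoo fb.
have [_ _ H] : [/\ mu.-integrable A (EFin \o f),
  [sequence \int[mu]_(x in A) (`|(f_ n x)%:E - (f x)%:E|)]_n @ \oo --> 0%E &
  [sequence \int[mu]_(x in A) ((f_ n x)%:E)]_n @ \oo -->
    \int[mu]_(x in A) (f x)%:E ]%E.
  apply: (@dominated_convergence _ _ _ mu A mA (fun n => EFin \o f_ n) _ (cst M%:E)).
  - by move=> n; exact/measurable_EFinP.
  - by apply/measurable_EFinP; exact: fb.1.
  - by apply: aeW => x Ax; apply: cvg_EFin; [exact: nearW|exact: ff].
  - apply: bounded_measurable_integrable => //; exact: bounded_measurable_cst.
  - by apply: aeW => x n Ax; rewrite /= lee_fin; exact: fM.
apply: fine_cvg; rewrite fineK//; exact: integrable_fin_num.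
Qed.

Lemma Rintegral_partition (I : finType) (c : T -> I) A f : measurable A ->
  (mu A < +oo)%E -> (forall i, measurable (c @^-1` [set i])) ->
  bounded_measurable A f ->
  \int[mu]_(x in A) f x = \sum_i \int[mu]_(x in A `&` c @^-1` [set i]) f x.
Proof.
move=> mA Aoo mc fb; have fi := bounded_measurable_integrable mA Aoo fb.
have mAc i : measurable (A `&` c @^-1` [set i]) by exact: measurableI.
have AE : A = \big[setU/set0]_(i : I) (A `&` c @^-1` [set i]).
  rewrite -bigcup_seq; apply/seteqP; split=> [x Ax|x [i _ []//]].
  by exists (c x); rewrite //= mem_index_enum.
rewrite /Rintegral {1}AE integral_bigsetU_EFin//=.
- rewrite sum_fine// => i _; apply: integrable_fin_num => //.
  exact: integrableS fi.
- exact: index_enum_uniq.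
- by move=> i j _ _ [x [[_ <-] [_ <-]]].
- by rewrite -AE; have [] := integrableP _ _ _ fi.
Qed.

Lemma Rintegral_bounds A f (a b : R) : measurable A -> (mu A < +oo)%E ->
  bounded_measurable A f -> (forall x, A x -> a <= f x <= b) ->
  a * fine (mu A) <= \int[mu]_(x in A) f x <= b * fine (mu A).
Proof.
move=> mA Aoo fb fab; have fi := bounded_measurable_integrable mA Aoo fb.
have ci r := bounded_measurable_integrable mA Aoo (bounded_measurable_cst A r).
rewrite -!Rintegral_cst//; apply/andP; split; apply: le_Rintegral => //.
- exact: ci.
- by move=> x /fab /andP[].
- exact: ci.
- by move=> x /fab /andP[].
Qed.

End bounded_functions.

Lemma measurable_finite_preimage {d} {T : measurableType d} (I : finType)
    (rT : Type) (c : T -> I) (G : I -> rT) (Z : set rT) :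
  (forall i, measurable (c @^-1` [set i])) -> measurable ((G \o c) @^-1` Z).
Proof.
move=> mc; have -> : (G \o c) @^-1` Z =
    \bigcup_(i in G @^-1` Z) (c @^-1` [set i]).
  by apply/seteqP; split=> [x Zx|x [i + ci]]; [by exists (c x)|by rewrite /= -ci].
by apply: fin_bigcup_measurable => [|i _]; [exact: finite_finset|exact: mc].
Qed.

(** * Cones of positive functions and upper envelopes *)

Section cone.
Context {R : realType} {T : choiceType}.
Implicit Types (u v w : T -> R) (s : seq (T -> R)) (Y : seq T)
  (C Q : set (T -> R)).

(** This is adherence for the topology of pointwise convergence, in a form that
    a finite approximation argument produces directly. *)
Definition pointwise_adherent Q w := forall Y (e : R), 0 < e ->
  exists2 v, Q v & forall y, y \in Y -> `|v y - w y| <= e.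

Definition pointwise_closed Q := forall w, pointwise_adherent Q w -> Q w.

Definition riesz_decomposition C := forall a b u r,
  C a -> C b -> C u -> C r -> a + b = u + r ->
  exists v w, [/\ C v, C w, u = v + w, C (a - v) & C (b - w)].

(** What the integral representation needs to know about the positive harmonic
    functions; o plays the role of the base point of the normalisation. *)
Record based_cone C (o : T) : Prop := {
  bc_cone : convex_cone C;
  bc_ge0 : forall u, C u -> forall x, 0 <= u x;
  bc_harnack : forall x, exists M : R, forall u, C u -> u x <= M * u o;
  bc_closed : pointwise_closed C;
  bc_riesz : riesz_decomposition C }.

(** Continuous sublinear functions, in a form stable under all the operations
    below: Lipschitz continuity in finitely many coordinates gives at once
    continuity for pointwise convergence and, through the Harnack inequality, a
    bound by a multiple of u(o). *)
Record test C (p : (T -> R) -> R) : Prop := {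
  test_ge0 : forall u, C u -> 0 <= p u;
  testD : forall u v, C u -> C v -> p (u + v) <= p u + p v;
  testZ : forall (c : R) u, 0 <= c -> C u -> p (c *: u) = c * p u;
  test_lip : exists Y, exists2 L : R, 0 <= L & forall u v, C u -> C v ->
    `|p u - p v| <= L * \sum_(y <- Y) `|u y - v y| }.

(** The first part of the decomposition of u is the meet of u and a: as
    u - b lies below both u and a, it lies below the meet, which leaves at most
    b for the second part. *)
Lemma lattice_riesz C : (forall u, C u -> forall x, 0 <= u x) ->
  vector_lattice C -> riesz_decomposition C.
Proof.
move=> C_ge0 [_ [C0 CD CZ] _ _ glb] a b u r Ca Cb Cu Cr abur.
have CW c : C c -> cone_space C c.
  move=> Cc; exists c, (cst 0); split=> //.
  by apply/funext => x; rewrite /= subr0.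
have [g [_ gu ga gmax]] := glb u a (CW _ Cu) (CW _ Ca).
have Cg : C g.
  have := gmax (cst 0) (CW _ C0); rewrite /cone_le.
  have sub0 (v : T -> R) : v \- cst 0 = v by apply/funext => x; rewrite /= subr0.
  by rewrite !sub0; apply.
exists g, (u - g); split=> //; first by rewrite addrC subrK.
have -> : b - (u - g) = g \- (u \- b) by apply/funext => x; rewrite !fctE /=; lra.
apply: gmax.
- by exists u, b.
- by rewrite /cone_le; have -> : u \- (u \- b) = b by apply/funext => x /=; lra.
- rewrite /cone_le; have -> // : a \- (u \- b) = r.
  apply/funext => x; have := congr1 (fun f : T -> R => f x) abur.
  by rewrite /= !fctE; lra.
Qed.

Section hat.
Variables (C : set (T -> R)) (o : T).
Hypothesis bC : based_cone C o.

Lemma cone0 : C 0. Proof. by case: (bc_cone bC). Qed.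

Lemma coneD u v : C u -> C v -> C (u + v).
Proof. by case: (bc_cone bC) => _ + _; apply. Qed.

Lemma coneZ (c : R) u : 0 <= c -> C u -> C (c *: u).
Proof. by case: (bc_cone bC) => _ _; apply. Qed.

Lemma cone_sum (I : eqType) (r : seq I) (P : pred I) (f : I -> T -> R) :
  (forall i, i \in r -> P i -> C (f i)) -> C (\sum_(i <- r | P i) f i).
Proof.
move=> Cf; rewrite big_seq_cond.
apply: big_rec => [|i u /andP[ir Pi] Cu]; first exact: cone0.
by apply: coneD => //; exact: Cf.
Qed.

Lemma harnack : exists2 M : T -> R, forall x, 0 <= M x &
  forall u, C u -> forall x, u x <= M x * u o.
Proof.
have /choice[M HM] := bc_harnack bC.
exists (fun x => `|M x|) => // u Cu x.
apply: le_trans (HM _ _ Cu) _.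
by rewrite ler_wpM2r ?ler_norm// (bc_ge0 bC).
Qed.

Lemma cone_eq0 u : C u -> u o = 0 -> u = 0.
Proof.
move=> Cu u0; have [M _ HM] := harnack; apply/funext => x.
apply/eqP; rewrite eq_le (bc_ge0 bC) // andbT.
by have := HM _ Cu x; rewrite u0 mulr0.
Qed.

Definition decomposition h s :=
  (forall u, u \in s -> C u) /\ \sum_(u <- s) u = h.

Lemma decomposition1 h : C h -> decomposition h [:: h].
Proof. by move=> Ch; split=> [u|]; rewrite ?big_seq1// inE => /eqP->. Qed.

Lemma decomposition_cone h s : decomposition h s -> C h.
Proof. by move=> [Cs <-]; apply: cone_sum => u us _; exact: Cs. Qed.

Lemma decomposition_cat a b s t :
  decomposition a s -> decomposition b t -> decomposition (a + b) (s ++ t).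
Proof.
move=> [Cs sa] [Ct tb]; split=> [u|]; last by rewrite big_cat/= sa tb.
by rewrite mem_cat => /orP[/Cs|/Ct].
Qed.

Lemma decomposition_at h s x : decomposition h s -> h x = \sum_(u <- s) u x.
Proof. by move=> [_ <-]; rewrite sumrfctE. Qed.

Lemma decomposition_flatten (d : (T -> R) -> seq (T -> R)) h s :
  (forall u, C u -> decomposition u (d u)) -> decomposition h s ->
  decomposition h (flatten (map d s)).
Proof.
move=> dP; elim: s h => [|u s IH] h [Cs sh]; first by split.
rewrite -sh big_cons /=; apply: decomposition_cat.
  by apply: dP; apply: Cs; rewrite inE eqxx.
by apply: IH; split => // v vs; apply: Cs; rewrite inE vs orbT.
Qed.

(** The Riesz decomposition property, iterated along a list. *)
Lemma decomposition_split a b s : C a -> C b -> decomposition (a + b) s ->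
  exists z : seq ((T -> R) * (T -> R)),
  [/\ decomposition a (unzip1 z), decomposition b (unzip2 z) &
      s = [seq q.1 + q.2 | q <- z]].
Proof.
elim: s a b => [|u s IH] a b Ca Cb [Cs sh].
  move: sh; rewrite big_nil => /esym ab0.
  have abx x : a x = 0 /\ b x = 0.
    have : a x + b x = 0 := congr1 (fun f : T -> R => f x) ab0.
    by have := bc_ge0 bC Ca x; have := bc_ge0 bC Cb x; split; lra.
  exists [::]; split=> //; split=> //; rewrite big_nil; apply/funext => x;
    by case: (abx x).
have Cu : C u by apply: Cs; rewrite inE eqxx.
have Cs' v : v \in s -> C v by move=> vs; apply: Cs; rewrite inE vs orbT.
have Cr : C (\sum_(v <- s) v) by apply: cone_sum => v vs _; exact: Cs'.
have ab : a + b = u + \sum_(v <- s) v by rewrite -sh big_cons.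
have [v [w [Cv Cw uvw Cav Cbw]]] := bc_riesz bC Ca Cb Cu Cr ab.
have ds : decomposition ((a - v) + (b - w)) s.
  split=> //; apply: (addrI u); rewrite -ab uvw.
  by rewrite addrACA [v + (a - v)]addrC [w + (b - w)]addrC !subrK.
have [z [[Cz1 z1] [Cz2 z2] ->]] := IH _ _ Cav Cbw ds.
exists ((v, w) :: z); split; rewrite /= -?uvw//; split.
- by move=> y; rewrite inE => /orP[/eqP->//|/Cz1].
- by rewrite big_cons z1 addrC subrK.
- by move=> y; rewrite inE => /orP[/eqP->//|/Cz2].
- by rewrite big_cons z2 addrC subrK.
Qed.

Section one_test.
Variable p : (T -> R) -> R.
Hypothesis tp : test C p.

Lemma test0 : p 0 = 0.
Proof. by have := testZ tp (lexx 0) cone0; rewrite mul0r scale0r. Qed.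

Lemma test_bound : exists2 M : R, 0 <= M & forall u, C u -> p u <= M * u o.
Proof.
have [M M0 HM] := harnack; have [Y [L L0 HL]] := test_lip tp.
exists (L * \sum_(y <- Y) M y); first by rewrite mulr_ge0// sumr_ge0.
move=> u Cu; apply: le_trans (ler_norm _) _.
have := HL _ _ Cu cone0; rewrite test0 subr0 => /le_trans; apply.
rewrite -mulrA ler_wpM2l// mulr_suml ler_sum// => y _.
by rewrite subr0 ger0_norm ?(bc_ge0 bC)// HM.
Qed.

Lemma test_sum (I : eqType) (r : seq I) (P : pred I) (f : I -> T -> R) :
  (forall i, i \in r -> P i -> C (f i)) ->
  p (\sum_(i <- r | P i) f i) <= \sum_(i <- r | P i) p (f i).
Proof.
move=> Cf.
suff [] : C (\sum_(i <- r | P i) f i) /\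
    p (\sum_(i <- r | P i) f i) <= \sum_(i <- r | P i) p (f i) by [].
rewrite big_seq_cond [X in _ <= X]big_seq_cond.
apply: (big_rec2 (fun u c => C u /\ p u <= c)) => [|i u c /andP[ir Pi] [Cu uc]].
  by rewrite test0; split=> //; exact: cone0.
have Ci := Cf _ ir Pi; split; first exact: coneD.
by apply: le_trans (testD tp Ci Cu) _; rewrite lerD2l.
Qed.

(** The upper envelope of p: for continuous convex p it is the least concave
    upper semicontinuous function above p. *)
Definition hat h :=
  sup [set \sum_(u <- s) p u | s in decomposition h].

Lemma hat_has_sup h : C h ->
  has_sup [set \sum_(u <- s) p u | s in decomposition h].
Proof.
move=> Ch; split.
  by exists (\sum_(u <- [:: h]) p u), [:: h] => //; exact: decomposition1.
have [M _ HM] := test_bound; exists (M * h o) => _ [s ds <-].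
rewrite (decomposition_at o ds) mulr_sumr big_seq [leRHS]big_seq ler_sum// => u us.
by apply: HM; exact: (ds.1 _ us).
Qed.

Lemma le_hat h s : decomposition h s -> \sum_(u <- s) p u <= hat h.
Proof.
move=> ds; apply: ub_le_sup; last by exists s.
by have [] := hat_has_sup (decomposition_cone ds).
Qed.

Lemma hat_le h c : C h ->
  (forall s, decomposition h s -> \sum_(u <- s) p u <= c) -> hat h <= c.
Proof.
move=> Ch Hc; apply: ge_sup; first by have [] := hat_has_sup Ch.
by move=> _ [s ds <-]; exact: Hc.
Qed.

Lemma hat_approx h e : C h -> 0 < e ->
  exists2 s, decomposition h s & hat h - e < \sum_(u <- s) p u.
Proof.
move=> Ch e0; have [_ [s ds <-] H] := sup_adherent e0 (hat_has_sup Ch).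
by exists s.
Qed.

Lemma test_le_hat h : C h -> p h <= hat h.
Proof. by move=> /decomposition1/le_hat; rewrite big_seq1. Qed.

Lemma hat_ge0 h : C h -> 0 <= hat h.
Proof. by move=> Ch; apply: le_trans (test_le_hat Ch); exact: (test_ge0 tp). Qed.

Lemma hat_bound : exists2 M : R, 0 <= M & forall u, C u -> hat u <= M * u o.
Proof.
have [M M0 HM] := test_bound; exists M => // h Ch; apply: hat_le => // s ds.
rewrite (decomposition_at o ds) mulr_sumr big_seq [leRHS]big_seq ler_sum// => u us.
by apply: HM; exact: (ds.1 _ us).
Qed.

Lemma hat0 : hat 0 = 0.
Proof.
have [M _ /(_ _ cone0)] := hat_bound; rewrite mulr0 => h0.
by apply/eqP; rewrite eq_le h0 hat_ge0//; exact: cone0.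
Qed.

(** Splitting a decomposition of a + b into one of a and one of b, piece by
    piece, only increases the sums because p is subadditive; this is where the
    lattice property enters. *)
Lemma hatD a b : C a -> C b -> hat (a + b) = hat a + hat b.
Proof.
move=> Ca Cb; apply/eqP; rewrite eq_le; apply/andP; split.
  apply: hat_le => [|s /(decomposition_split Ca Cb)]; first exact: coneD.
  move=> [z [da db ->]].
  apply: (@le_trans _ _ (\sum_(u <- unzip1 z) p u + \sum_(u <- unzip2 z) p u)).
    rewrite !big_map -big_split/= big_seq [leRHS]big_seq ler_sum// => q qz.
    by apply: (testD tp); [apply: (da.1 _)|apply: (db.1 _)]; apply/mapP; exists q.
  by apply: lerD; exact: le_hat.
apply/ler_addgt0Pr => e e0.
have e20 : 0 < e / 2 by rewrite divr_gt0.
have [s ds hs] := hat_approx Ca e20; have [t dt ht] := hat_approx Cb e20.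
have := le_hat (decomposition_cat ds dt); rewrite big_cat /=.
by move: hs ht; lra.
Qed.

Lemma hat_sum (I : eqType) (r : seq I) (P : pred I) (f : I -> T -> R) :
  (forall i, i \in r -> P i -> C (f i)) ->
  hat (\sum_(i <- r | P i) f i) = \sum_(i <- r | P i) hat (f i).
Proof.
move=> Cf.
suff [] : C (\sum_(i <- r | P i) f i) /\
    hat (\sum_(i <- r | P i) f i) = \sum_(i <- r | P i) hat (f i) by [].
rewrite big_seq_cond [X in _ = X]big_seq_cond.
apply: (big_rec2 (fun u c => C u /\ hat u = c)) => [|i u c /andP[ir Pi] [Cu uc]].
  by split; [exact: cone0|exact: hat0].
by have Ci := Cf _ ir Pi; split; [exact: coneD|rewrite hatD// uc].
Qed.

Lemma hatZ c h : 0 <= c -> C h -> hat (c *: h) = c * hat h.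
Proof.
rewrite le_eqVlt => /predU1P[<-|c0] Ch; first by rewrite scale0r mul0r hat0.
have half d g : 0 < d -> C g -> d * hat g <= hat (d *: g).
  move=> d0 Cg; rewrite mulrC -ler_pdivlMr//; apply: hat_le => // s ds.
  rewrite ler_pdivlMr//.
  apply: (@le_trans _ _ (\sum_(u <- [seq d *: u | u <- s]) p u)).
    rewrite big_map mulr_suml big_seq [leRHS]big_seq ler_sum// => u us.
    by rewrite mulrC (testZ tp) ?(ltW d0)//; exact: (ds.1 _ us).
  apply: le_hat; split; last by rewrite big_map -scaler_sumr ds.2.
  by move=> _ /mapP[u us ->]; apply: coneZ; rewrite ?(ltW d0)//; exact: (ds.1 _ us).
apply/eqP; rewrite eq_le half// andbT.
have Cch : C (c *: h) by apply: coneZ => //; exact: ltW.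
have := half c^-1 (c *: h); rewrite invr_gt0 => /(_ c0 Cch).
by rewrite scalerA mulVf ?gt_eqF// scale1r mulrC ler_pdivrMr// mulrC.
Qed.

End one_test.
End hat.
End cone.

(** * Pointwise limits and upper semicontinuity of the envelopes *)

Section filters.
Context {R : realType}.

Lemma ultra_fmap (I J : Type) (F : set_system I) (f : I -> J) :
  UltraFilter F -> UltraFilter (f @ F).
Proof.
move=> UF; have PF : ProperFilter F := ultra_proper; split; first exact: fmap_proper_filter.
move=> G PG FG; apply/seteqP; split=> // A GA.
have [//|FAc] := in_ultra_setVsetC (f @^-1` A) UF.
have GAc : G (~` A) by apply: FG.
have : G (A `&` ~` A) by apply: filterI.
by rewrite setICr => /filter_not_empty.
Qed.

Lemma ultra_bounded_cvg (I : Type) (F : set_system I) (a : I -> R) (B : R) :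
  UltraFilter F -> F [set i | `|a i| <= B] -> exists l : R, a @ F --> l.
Proof.
move=> UF FB; have := @segment_compact R (- B) B; rewrite compact_ultra.
have Fa : F (a @^-1` `[- B, B]%classic).
  by apply: filterS FB => i; rewrite /= in_itv/= -ler_norml.
by move=> /(_ _ (ultra_fmap a UF) Fa) [l [_ al]]; exists l.
Qed.

Lemma ler_lim (I : Type) (F : set_system I) (f g : I -> R) (l m : R) :
  ProperFilter F -> f @ F --> l -> g @ F --> m ->
  F [set i | f i <= g i] -> l <= m.
Proof.
move=> PF fl gm fg; rewrite -subr_ge0; apply: (cvgr_to_ge (cvgB gm fl)).
by apply: filterS fg => i /= fgi; rewrite subr_ge0.
Qed.

Lemma cvg_bigD (I J : Type) (F : set_system I) (r : seq J) (P : pred J)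
    (f : J -> I -> R) (l : J -> R) : Filter F ->
  (forall j, P j -> f j @ F --> l j) ->
  (fun i => \sum_(j <- r | P j) f j i) @ F --> \sum_(j <- r | P j) l j.
Proof. by move=> FF; apply: cvg_big; exact: add_continuous. Qed.

End filters.

Section adherence.
Context {R : realType} {T : choiceType}.
Implicit Types (Q C : set (T -> R)) (w : T -> R) (Y : seq T).

Lemma pointwise_adherent_filter Q w : pointwise_adherent Q w ->
  exists F : set_system (T -> R),
  [/\ UltraFilter F, F Q & forall x, (fun v => v x) @ F --> w x].
Proof.
move=> Qw.
pose B (Ye : seq T * R) :=
  [set v | Q v /\ forall y, y \in Ye.1 -> `|v y - w y| <= Ye.2].
pose F := filter_from [set Ye | 0 < Ye.2] B.
have PF : ProperFilter F.
  apply: filter_from_proper; last first.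
    by move=> [Y e] /= e0; have [v Qv Hv] := Qw Y e e0; exists v.
  apply: filter_from_filter; first by exists ([::], 1); rewrite /= ltr01.
  move=> [Y e] [Z d] /= e0 d0; exists (Y ++ Z, Num.min e d).
    by rewrite /= lt_min e0 d0.
  move=> v [Qv Hv]; split; split=> // y yY; have := Hv y;
    rewrite mem_cat yY ?orbT /= => /(_ isT); rewrite le_min => /andP[] //.
have [G [UG FG]] := ultraFilterLemma PF.
exists G; split=> //.
  by apply: FG; exists ([::], 1); rewrite /= ?ltr01// => v [].
move=> x; have PG : ProperFilter G := ultra_proper; apply/cvgrPdist_le => e e0; apply: FG.
exists ([:: x], e) => //= v [_ /(_ x)].
by rewrite inE eqxx => /(_ isT); rewrite /= distrC.
Qed.

Lemma filter_pointwise_adherent Q w (I : Type) (F : set_system I)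
    (f : I -> T -> R) : ProperFilter F -> F (f @^-1` Q) ->
  (forall x, f^~ x @ F --> w x) -> pointwise_adherent Q w.
Proof.
move=> PF FQ Fw Y e e0.
suff /filter_ex[i [Qi Hi]] : F [set i | Q (f i) /\
    forall y, y \in Y -> `|f i y - w y| <= e] by exists (f i).
have FY : F [set i | forall y, y \in Y -> `|f i y - w y| <= e].
  elim: Y => [|y Y IH]; first by apply: filterE.
  have /cvgrPdist_le/(_ _ e0) Fy := Fw y.
  apply: filterS2 IH Fy => i /= IH Fy z; rewrite inE => /predU1P[->|/IH//].
  by rewrite distrC.
exact: filterI FQ FY.
Qed.

Variables (C : set (T -> R)) (o : T).
Hypothesis bC : based_cone C o.

(** Compactness of the truncated cone: along an ultrafilter no subsequence has
    to be extracted. *)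
Lemma ultra_cone_cvg (I : Type) (F : set_system I) (f : I -> T -> R) (B : R) :
  UltraFilter F -> F [set i | C (f i) /\ f i o <= B] ->
  exists2 w, C w & forall x, f^~ x @ F --> w x.
Proof.
move=> UF FB; have [M M0 HM] := harnack bC; have PF : ProperFilter F := @ultra_proper _ _ UF.
have /choice[w Hw] x : exists l : R, f^~ x @ F --> l.
  apply: (@ultra_bounded_cvg _ _ _ _ (M x * B)) => //.
  apply: filterS FB => i [Ci oi] /=; rewrite ger0_norm ?(bc_ge0 bC)//.
  by apply: le_trans (HM _ Ci x) _; rewrite ler_wpM2l.
exists w => //; apply: (bc_closed bC).
by apply: filter_pointwise_adherent Hw; apply: filterS FB => i [].
Qed.

Lemma test_cvg p (I : Type) (F : set_system I) (f : I -> T -> R) w :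
  test C p -> Filter F -> F (f @^-1` C) -> C w ->
  (forall x, f^~ x @ F --> w x) -> (fun i => p (f i)) @ F --> p w.
Proof.
move=> tp FF FC Cw fw; have [Y [L L0 HL]] := test_lip tp.
have : (fun i => L * \sum_(y <- Y) `|f i y - w y|) @ F -->
    L * \sum_(y <- Y) (0 : R).
  apply: cvgMr; apply: cvg_bigD => y _.
  by rewrite -(@normr0 _ R); apply: cvg_norm; apply/subr_cvg0.
rewrite [X in _ * X]big1// mulr0 => S0.
have N0 : (fun i => `|p (f i) - p w|) @ F --> (0 : R).
  apply: (squeeze_cvgr _ (cvg_cst 0) S0).
  by apply: filterS FC => i Ci; rewrite normr_ge0/= HL.
by apply/subr_cvg0; apply: norm_cvg0.
Qed.

Section cells.
Variables (Y : seq T) (d : R).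
Hypothesis d0 : 0 < d.

(** Sorting the elements of the cone by the rounded values of u(y) / u(o), for y
    in Y, takes finitely many cells because of the Harnack inequality.  The
    inequalities are written homogeneously so that each cell is a convex cone;
    the equivalence is what makes the cells measurable. *)
Lemma cone_cells : exists (I : finType) (cell : (T -> R) -> I)
    (lo : I -> seq_sub Y -> R), forall u i, C u -> 0 < u o ->
  cell u = i <-> forall y : seq_sub Y,
    lo i y * u o <= u (val y) < (lo i y + d) * u o.
Proof.
have [M M0 HM] := harnack bC.
pose K := \max_(y : seq_sub Y) Num.truncn (M (val y) / d).
pose k (u : T -> R) (y : seq_sub Y) := Num.truncn (u (val y) / u o / d).
exists ({ffun seq_sub Y -> 'I_K.+1}), (fun u => [ffun y => inord (k u y)]).
exists (fun (i : {ffun seq_sub Y -> 'I_K.+1}) y => d * (i y)%:R) => u i Cu uo.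
have kK y : (k u y < K.+1)%N.
  rewrite ltnS; apply: leq_trans (leq_bigmax y); apply: le_truncn.
  by rewrite ler_pM2r ?invr_gt0// ler_pdivrMr// HM.
have kE y (n : nat) : k u y = n <->
    d * n%:R * u o <= u (val y) < (d * n%:R + d) * u o.
  have -> : d * n%:R + d = n.+1%:R * d by rewrite -natr1 mulrDl mul1r mulrC.
  rewrite [d * _]mulrC.
  rewrite -[X in X && _]ler_pdivlMr// -[X in _ && X]ltr_pdivrMr//.
  rewrite -[X in X && _]ler_pdivlMr// -[X in _ && X]ltr_pdivrMr//.
  split=> [<-|]; last exact: truncn_def.
  apply: truncn_itv; apply: divr_ge0 (ltW d0).
  by apply: divr_ge0; exact: (bc_ge0 bC).
split=> [<- y|Hi]; first by apply/kE; rewrite ffunE inordK.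
apply/ffunP => y; rewrite ffunE; apply: val_inj; rewrite /= inordK//.
exact/kE.
Qed.

End cells.

Section usc.
Variable p : (T -> R) -> R.
Hypothesis tp : test C p.

(** Adding up the pieces that fall in a common cell costs little, as p is almost
    linear there.  So the envelope is nearly attained by decompositions whose
    number of pieces depends on the precision only, and such decompositions
    have limits. *)
Lemma hat_merge (e : R) : 0 < e -> exists I : finType, forall h, C h ->
  exists f : I -> T -> R, [/\ forall i, C (f i), \sum_i f i = h &
    hat C p h - e * (h o + 1) <= \sum_i p (f i)].
Proof.
move=> e0; have [Y [L L0 HL]] := test_lip tp.
(* the width of the cells: each of the size Y coordinates of a piece u moves
   by at most d u(o), so p moves by at most e u(o) *)
pose d := e / (L * (size Y)%:R + 1).
have m0 : 0 < L * (size Y)%:R + 1 by rewrite ltr_wpDl// mulr_ge0.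
have d0 : 0 < d by rewrite divr_gt0.
have de : L * (size Y)%:R * d <= e.
  rewrite /d mulrA ler_pdivrMr// mulrC ler_wpM2l ?(ltW e0)//.
  by rewrite lerDl.
clearbody d.
have [I [cell [lo Hlo]]] := cone_cells Y d0.
exists I => h Ch; have [s ds hs] := hat_approx bC tp Ch e0.
have Cs := ds.1.
pose f i := \sum_(u <- s | cell u == i) u.
have Cf i : C (f i) by apply: (cone_sum bC) => u us _; exact: Cs.
have fE i x : f i x = \sum_(u <- s | cell u == i) u x by rewrite /f fct_sumE.
have sumE (F : (T -> R) -> R) :
    \sum_(u <- s) F u = \sum_i \sum_(u <- s | cell u == i) F u.
  by rewrite (partition_big cell xpredT).
exists f; split=> //.
  by rewrite -ds.2 /f (partition_big cell xpredT).
have cellP u (y : seq_sub Y) : u \in s ->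
    lo (cell u) y * u o <= u (val y) <= (lo (cell u) y + d) * u o.
  move=> us; have := bc_ge0 bC (Cs _ us) o; rewrite le_eqVlt => /predU1P[uo|uo].
    by rewrite (cone_eq0 bC (Cs _ us)) -?uo//= !mulr0 lexx.
  have [/(_ erefl)/(_ y)] := Hlo u (cell u) (Cs _ us) uo.
  by move=> /andP[-> /ltW->].
have fP i (y : seq_sub Y) : lo i y * f i o <= f i (val y) <= (lo i y + d) * f i o.
  rewrite !fE !mulr_sumr; apply/andP; split; rewrite big_seq_cond [leRHS]big_seq_cond;
  by apply: ler_sum => u /andP[us /eqP<-]; have /andP[] := cellP u y us.
have pP i u : u \in s -> cell u == i -> p u <= u o / f i o * p (f i) + e * u o.
  move=> us ui; have := bc_ge0 bC (Cs _ us) o; rewrite le_eqVlt => /predU1P[uo|uo].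
    by rewrite -uo (cone_eq0 bC (Cs _ us)) -?uo// (test0 bC tp) mul0r mul0r mulr0 addr0.
  have fi0 : 0 < f i o.
    rewrite fE (big_rem u)//= ui; apply: ltr_wpDr => //; rewrite big_seq_cond.
    by apply: sumr_ge0 => v /andP[/mem_rem/Cs Cv _]; exact: (bc_ge0 bC).
  have l0 : 0 <= u o / f i o by rewrite divr_ge0 ?ltW.
  rewrite -(testZ tp)// -lerBlDl; apply: le_trans (ler_norm _) _.
  apply: le_trans (HL _ _ (Cs _ us) (coneZ bC l0 (Cf i))) _.
  apply: (@le_trans _ _ (L * \sum_(y <- Y) (d * u o))).
    rewrite ler_wpM2l// big_seq [leRHS]big_seq; apply: ler_sum => y yY.
    have := cellP u (SeqSub yY) us; have := fP i (SeqSub yY).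
    rewrite (eqP ui) /= => /andP[f1 f2] /andP[u1 u2].
    have uf : u o / f i o * f i o = u o by rewrite divfK ?gt_eqF.
    have g1 := ler_wpM2l l0 f1; have g2 := ler_wpM2l l0 f2.
    rewrite mulrCA uf in g1; rewrite mulrCA uf in g2.
    rewrite ler_distl -[(_ *: f i) y]/(u o / f i o * f i y).
    by apply/andP; split; lra.
  rewrite big_const_seq count_predT iter_addr_0 -mulr_natl !mulrA.
  by apply: ler_wpM2r de; exact: (bc_ge0 bC (Cs _ us)).
have pf i : \sum_(u <- s | cell u == i) p u <= p (f i) + e * f i o.
  apply: (@le_trans _ _ (\sum_(u <- s | cell u == i)
      (u o / f i o * p (f i) + e * u o))).
    rewrite big_seq_cond [leRHS]big_seq_cond.
    by apply: ler_sum => u /andP[us ui]; exact: pP.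
  rewrite big_split/= -mulr_sumr -!mulr_suml -fE lerD2r.
  have [->|fi0] := eqVneq (f i o) 0.
    by rewrite !mul0r (test_ge0 tp).
  by rewrite divff// mul1r.
have : \sum_(u <- s) p u <= \sum_i p (f i) + e * h o.
  rewrite sumE (decomposition_at o ds) (sumE (fun u => u o)) mulr_sumr -big_split/=.
  by apply: ler_sum => i _; rewrite -fE; exact: pf.
by move: hs; lra.
Qed.

(** A limit of functions v with hat p (v) >= c v(o) inherits, along an
    ultrafilter, a limit of their nearly optimal decompositions into a fixed
    number of pieces. *)
Lemma hat_usc (c : R) : pointwise_closed [set v | C v /\ c * v o <= hat C p v].
Proof.
move=> w Qw; have [F [UF FQ Fw]] := pointwise_adherent_filter Qw.
have PF : ProperFilter F := @ultra_proper _ _ UF.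
have FC : F C by apply: filterS FQ => v [].
have Cw : C w.
  by apply: (bc_closed bC); apply: (@filter_pointwise_adherent _ _ _ F id).
split=> //; apply/ler_addgt0Pr => e e0.
have wo0 := bc_ge0 bC Cw o.
have w1 : 0 < w o + 1 by rewrite ltr_wpDl.
pose d := e / (w o + 1).
have d0 : 0 < d by rewrite divr_gt0.
have [I HI] := hat_merge d0.
have /choice[f Hf] : forall h, exists f : I -> T -> R, C h ->
    [/\ forall i, C (f i), \sum_i f i = h &
    hat C p h - d * (h o + 1) <= \sum_i p (f i)].
  move=> h; have [Ch|nCh] := pselect (C h); last by exists (fun=> 0).
  by have [f Hf] := HI h Ch; exists f.
have Fo : F [set v | v o <= w o + 1].
  have /cvgrPdist_le/(_ 1 ltr01) := Fw o; apply: filterS => v /=.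
  by rewrite distrC ler_distl => /andP[].
have /choice[l Hl] i :
    exists l, C l /\ forall x, (fun v => f v i x) @ F --> l x.
  suff [l] : exists2 l, C l & forall x, (fun v => f v i x) @ F --> l x by exists l.
  apply: (ultra_cone_cvg (B := w o + 1)).
  apply: filterS2 FC Fo => v Cv vo; have [Cf fv _] := Hf v Cv.
  split=> //; apply: le_trans vo; rewrite -[in leRHS]fv fct_sumE (bigD1 i)//=.
  by rewrite lerDl; apply: sumr_ge0 => j _; exact: (bc_ge0 bC).
have Cl i : C (l i) by have [] := Hl i.
have lx i x : (fun v => f v i x) @ F --> l i x by have [_ +] := Hl i; exact.
have lw : \sum_i l i = w.
  apply/funext => x; rewrite fct_sumE.
  have lxs : (fun v => \sum_i f v i x) @ F --> \sum_i l i x.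
    by apply: cvg_bigD => i _; exact: lx.
  suff /cvg_unique/(_ (Fw x)) : (fun v : T -> R => v x) @ F --> \sum_i l i x.
    by apply; exact: Rhausdorff.
  apply: cvg_trans lxs; apply: near_eq_cvg; apply: filterS FC => v Cv.
  by have [_ fv _] := Hf v Cv; rewrite /= -[in RHS]fv fct_sumE.
have pl : (fun v => \sum_i p (f v i)) @ F --> \sum_i p (l i).
  apply: cvg_bigD => i _; apply: (test_cvg (F := F) tp) => //.
  by apply: filterS FC => v Cv; have [+ _ _] := Hf v Cv; apply.
have : c * w o - d * (w o + 1) <= \sum_i p (l i).
  have fl : (fun v : T -> R => c * v o - d * (v o + 1)) @ F -->
      c * w o - d * (w o + 1).
    apply: (@cvgB R R); first by apply: cvgMr; exact: Fw.
    apply: cvgMr; apply: (@cvgD R R); [exact: Fw|exact: cvg_cst].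
  apply: ler_lim fl pl _; apply: filterS2 FC FQ => v Cv [_ cv]; have [_ _] := Hf v Cv.
  by apply: le_trans; rewrite lerD2r.
rewrite divfK ?gt_eqF// lerBlDr => /le_trans; apply; rewrite lerD2r.
rewrite -(big_map l xpredT p); apply: (le_hat bC tp); split; last by rewrite big_map.
by move=> _ /mapP[i _ ->].
Qed.

End usc.
End adherence.

(** * Barycentres *)

Section random_element.
Context {R : realType} {T : choiceType} (C : set (T -> R)) (o : T).
Hypothesis bC : based_cone C o.
Context {d} {Om : measurableType d} (X : Om -> T -> R).
Hypothesis XC : forall a, C (X a).
Hypothesis Xo : forall a, X a o = 1.
Hypothesis mX : forall x, measurable_fun setT (X ^~ x).

Lemma random_bounded x B : measurable B -> bounded_measurable B (X ^~ x).
Proof.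
move=> mB; have [M M0 HM] := harnack bC; split; first exact: measurable_funTS.
exists (M x) => a _; rewrite ger0_norm ?(bc_ge0 bC)//.
by apply: le_trans (HM _ (XC a) x) _; rewrite Xo mulr1.
Qed.

(** From here on a measure on the base of the cone appears as a measure on a
    space Om together with a family X of normalised elements of the cone.  In
    this way the same results serve for measures on the base itself and for
    step functions on an interval. *)
Lemma random_cells (Y : seq T) (e : R) : 0 < e ->
  exists (I : finType) (cell : Om -> I) (lo : I -> seq_sub Y -> R),
  (forall i, measurable (cell @^-1` [set i])) /\
  forall a (y : seq_sub Y), lo (cell a) y <= X a (val y) <= lo (cell a) y + e.
Proof.
move=> e0; have [I [cell [lo Hlo]]] := cone_cells bC Y e0.
have H i a : cell (X a) = i <->
    forall y : seq_sub Y, lo i y <= X a (val y) < lo i y + e.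
  have := Hlo (X a) i (XC a); rewrite Xo => /(_ ltr01) ->.
  by split=> + y => /(_ y); rewrite !mulr1.
exists I, (cell \o X), lo; split=> [i|a y]; last first.
  by have /H/(_ y) : cell (X a) = cell (X a) by []; case/andP=> -> /ltW.
have -> : (cell \o X) @^-1` [set i] = \bigcap_(y : seq_sub Y)
    (X ^~ (val y) @^-1` `[lo i y, lo i y + e[%classic).
  apply/seteqP; split=> a.
    by move=> /H Ha y _; rewrite /= in_itv; exact: Ha.
  by move=> Ha; apply/H => y; have := Ha y Logic.I; rewrite /= in_itv.
apply: fin_bigcap_measurable => [|y _]; first exact: finite_finset.
by rewrite -[X in measurable X]setTI; apply: mX => //; exact: measurable_itv.
Qed.

Section barycenter.
Variable mu : {measure set Om -> \bar R}.
Hypothesis mu_fin : (mu setT < +oo)%E.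

Definition barycenter B : T -> R := fun x => \int[mu]_(a in B) X a x.

Lemma mu_lty B : measurable B -> (mu B < +oo)%E.
Proof.
by move=> mB; apply: le_lt_trans mu_fin; apply: le_measure; rewrite ?inE.
Qed.

Lemma barycenter_o B : measurable B -> barycenter B o = fine (mu B).
Proof.
move=> mB; rewrite -[RHS]mul1r -Rintegral_cst//.
by apply: eq_Rintegral => a _; rewrite Xo.
Qed.

Lemma fine_partition (I : finType) (c : Om -> I) B : measurable B ->
  (forall i, measurable (c @^-1` [set i])) ->
  fine (mu B) = \sum_i fine (mu (B `&` c @^-1` [set i])).
Proof.
move=> mB mc; rewrite -[LHS]mul1r -Rintegral_cst//.
rewrite (Rintegral_partition mB (mu_lty mB) mc); last exact: bounded_measurable_cst.
apply: eq_bigr => i _; rewrite Rintegral_cst ?mul1r//.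
exact: measurableI.
Qed.

Lemma barycenter_partition (I : finType) (c : Om -> I) B : measurable B ->
  (forall i, measurable (c @^-1` [set i])) ->
  barycenter B = \sum_i barycenter (B `&` c @^-1` [set i]).
Proof.
move=> mB mc; apply/funext => x; rewrite fct_sumE /barycenter.
by apply: Rintegral_partition => //; [exact: mu_lty|exact: random_bounded].
Qed.

(** Choosing one value of X in each of finitely many small cells approximates
    the barycentre by positive combinations of elements of Q. *)
Lemma barycenter_in (Q : set (T -> R)) B : measurable B ->
  pointwise_closed Q -> Q 0 -> (forall u v, Q u -> Q v -> Q (u + v)) ->
  (forall (c : R) u, 0 <= c -> Q u -> Q (c *: u)) ->
  (forall a, B a -> Q (X a)) -> Q (barycenter B).
Proof.
move=> mB Qcl Q0 QD QZ BQ; apply: Qcl => Y e e0.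
have m0 : 0 <= fine (mu B) by rewrite fine_ge0.
have m1 : 0 < fine (mu B) + 1 by rewrite ltr_wpDl.
pose f := e / (fine (mu B) + 1).
have f0 : 0 < f by rewrite divr_gt0.
have fm : f * fine (mu B) <= e.
  rewrite /f mulrAC ler_pdivrMr// ler_wpM2l ?(ltW e0)//.
  by rewrite lerDl.
clearbody f.
have [I [cell [lo [mc Hlo]]]] := random_cells Y f0.
pose A i := B `&` cell @^-1` [set i].
have mA i : measurable (A i) by exact: measurableI.
have /choice[r Hr] i : exists v : T -> R, Q v /\ (A i !=set0 -> exists2 a, A i a & v = X a).
  have [[a Aa]|nA] := pselect (A i !=set0); last by exists 0.
  by exists (X a); split=> [|_]; [apply: BQ; case: Aa|exists a].
exists (\sum_i fine (mu (A i)) *: r i).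
  apply: (big_ind Q) => // i _; apply: QZ; first by rewrite fine_ge0.
  by have [] := Hr i.
move=> y yY; rewrite fct_sumE.
rewrite [barycenter B](barycenter_partition mB mc) fct_sumE -sumrB.
apply: le_trans (ler_norm_sum _ _ _) _; apply: le_trans fm.
rewrite (fine_partition mB mc) mulr_sumr; apply: ler_sum => i _.
rewrite -/(A i) distrC /barycenter -[(_ *: r i) y]/(fine (mu (A i)) * r i y).
have [An0|A0] := pselect (A i !=set0); last first.
  have -> : A i = set0 by apply/seteqP; split=> // a Aa; case: A0; exists a.
  by rewrite Rintegral_set0 measure0/= mul0r subrr normr0 mulr0.
have [_ /(_ An0)[b Ab rb]] := Hr i; rewrite rb.
have Xab a : A i a -> X b y - f <= X a y <= X b y + f.
  move=> Aa; have := Hlo a (SeqSub yY); have := Hlo b (SeqSub yY).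
  by case: Aa => _ ->; case: Ab => _ -> /=; lra.
have /andP[] := Rintegral_bounds (mA i) (mu_lty (mA i)) (random_bounded y (mA i)) Xab.
by rewrite ler_distl; lra.
Qed.

Lemma barycenter_cone B : measurable B -> C (barycenter B).
Proof.
move=> mB; apply: barycenter_in => //.
- exact: (bc_closed bC).
- exact: (cone0 bC).
- exact: (coneD bC).
- exact: (coneZ bC).
Qed.

End barycenter.
End random_element.

Section random_hat.
Context {R : realType} {T : choiceType} (C : set (T -> R)) (o : T).
Hypothesis bC : based_cone C o.
Variable xs : nat -> T.
Hypothesis xs_sep : forall u v, C u -> C v ->
  (forall k, u (xs k) = v (xs k)) -> u = v.
Context {d} {Om : measurableType d} (X : Om -> T -> R).
Hypothesis XC : forall a, C (X a).
Hypothesis Xo : forall a, X a o = 1.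
Hypothesis mX : forall x, measurable_fun setT (X ^~ x).
Variable p : (T -> R) -> R.
Hypothesis tp : test C p.
Local Notation hatp := (hat C p).
Local Notation bary mu := (barycenter X mu).

(** The function h is the supremum of hat p over the closed box that bounds the
    cell of X.  The barycentre of a cell lies in its box, and additivity of hat p
    over the cells gives the integral inequality. *)
Lemma hat_random_step (Y : seq T) (e : R) : 0 < e -> exists h : Om -> R,
  [/\ bounded_measurable setT h,
      forall a, hatp (X a) <= h a,
      forall a (c : R), c < h a -> exists v, [/\ C v, v o = 1, c <= hatp v &
        forall y, y \in Y -> `|v y - X a y| <= e] &
      forall mu : {measure set Om -> \bar R}, (mu setT < +oo)%E ->
        hatp (bary mu setT) <= \int[mu]_a h a].
Proof.
move=> e0; have [I [cell [lo [mc Hlo]]]] := random_cells bC XC Xo mX Y e0.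
have [M M0 HM] := hat_bound bC tp.
pose box i := [set v | [/\ C v, v o = 1 & forall y : seq_sub Y,
  lo i y <= v (val y) <= lo i y + e]].
pose G i := sup (hatp @` box i).
have boxX a : box (cell a) (X a) by split=> //; exact: Hlo.
have box_ub i : has_ubound (hatp @` box i).
  by exists M => _ [v [Cv v1 _] <-]; have := HM _ Cv; rewrite v1 mulr1.
have hatG i v : box i v -> hatp v <= G i.
  by move=> bv; apply: ub_le_sup; [exact: box_ub|exists v].
have hatGX a : hatp (X a) <= G (cell a) by exact: hatG.
have mh : measurable_fun setT (G \o cell).
  by move=> _ Z _; rewrite setTI; exact: measurable_finite_preimage.
have Gb : bounded_measurable setT (G \o cell).
  split=> //; exists M => a _; rewrite ger0_norm /=.
    apply: ge_sup; first by exists (hatp (X a)), (X a).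
    by move=> _ [v [Cv v1 _] <-]; have := HM _ Cv; rewrite v1 mulr1.
  by apply: le_trans (hatGX a); exact: (hat_ge0 bC tp).
exists (G \o cell); split=> // [a c cG|mu mu_fin].
  have Xs : has_sup (hatp @` box (cell a)).
    by split=> //; exists (hatp (X a)), (X a).
  have cG0 : 0 < G (cell a) - c by rewrite subr_gt0.
  have [_ [v [Cv v1 vb] <-]] := sup_adherent cG0 Xs.
  rewrite -/(G _) opprB addrC subrK => /ltW cv.
  exists v; split=> // y yY; have := vb (SeqSub yY); have := Hlo a (SeqSub yY).
  by rewrite ler_distl /=; lra.
have mA i : measurable (setT `&` cell @^-1` [set i]) by exact: measurableI.
have Cb i := barycenter_cone bC XC Xo mX mu_fin (mA i).
rewrite (barycenter_partition bC XC Xo mX mu_fin measurableT mc).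
rewrite (hat_sum bC tp)//.
rewrite (Rintegral_partition measurableT mu_fin mc Gb).
apply: ler_sum => i _; set A := _ `&` _.
have -> : \int[mu]_(a in A) (G \o cell) a = G i * fine (mu A).
  rewrite -Rintegral_cst; last exact: mA.
  by apply: eq_Rintegral => a /set_mem [_ /= ->].
have bo := barycenter_o Xo mu (mA i); rewrite -/A in bo.
have : 0 <= fine (mu A) by rewrite fine_ge0.
rewrite le_eqVlt => /predU1P[m0|m0].
  rewrite -m0 mulr0 (cone_eq0 bC (Cb i)); last by rewrite bo.
  by rewrite (hat0 bC tp).
have mV0 : 0 <= (fine (mu A))^-1 by rewrite invr_ge0 ltW.
rewrite mulrC -ler_pdivrMl// -(hatZ bC tp mV0 (Cb i)).
apply: hatG; split.
- exact: (coneZ bC mV0 (Cb i)).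
- by rewrite -[LHS]/(_ * _) bo mulVf// gt_eqF.
- move=> y; rewrite -[(_ *: _) _]/((fine (mu A))^-1 * bary mu A (val y)).
  rewrite ler_pdivlMl// ler_pdivrMl// ![fine _ * _]mulrC.
  apply: (Rintegral_bounds (mA i) (mu_lty mu_fin (mA i))).
    exact: (random_bounded bC XC Xo mX).
  by move=> a [_ <-]; exact: Hlo.
Qed.

(** Refining the boxes makes the suprema decrease to hat p, by upper
    semicontinuity: near-maximisers over shrinking boxes around X a converge
    along an ultrafilter to an element that agrees with X a at all the points
    xs k, hence to X a. *)
Lemma hat_random_approx : exists h : nat -> Om -> R,
  [/\ forall n, bounded_measurable setT (h n),
      exists M : R, forall n a, `|h n a| <= M,
      forall a, h ^~ a @ \oo --> hatp (X a) &
      forall n (mu : {measure set Om -> \bar R}), (mu setT < +oo)%E ->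
        hatp (bary mu setT) <= \int[mu]_a h n a].
Proof.
have e0 n : 0 < n.+1%:R^-1 :> R by rewrite invr_gt0.
have /choice[h Hh] n := hat_random_step [seq xs k | k <- iota 0 n] (e0 n).
have [M M0 HM] := hat_bound bC tp.
exists h; split=> [n|||n].
- by have [] := Hh n.
- exists M => n a; have [_ hX hs _] := Hh n.
  rewrite ger0_norm; last by apply: le_trans (hX a); exact: (hat_ge0 bC tp).
  rewrite leNgt; apply/negP => Mh.
  have [v [Cv v1 + _]] := hs a ((M + h n a) / 2) (midf_lt Mh).2.
  by have := HM _ Cv; rewrite v1; lra.
- move=> a; apply/cvgrPdist_le => e e1.
  apply: contrapT => bad.
  have e2 : 0 < e / 2 by rewrite divr_gt0.
  pose B := [set n | e < h n a - hatp (X a)].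
  pose c := hatp (X a) + e / 2.
  have PB : ProperFilter (within B \oo).
    apply: Build_ProperFilter_ex => N BN; apply: contrapT => NN; apply: bad.
    have BN' : \forall n \near \oo, B n -> N n := BN.
    apply: filterS BN' => n Bn; have [_ hX _ _] := Hh n.
    rewrite distrC ger0_norm ?subr_ge0//= leNgt; apply/negP => nB.
    by apply: NN; exists n; exact: Bn.
  have [U [UU BU]] := ultraFilterLemma PB.
  have PU : ProperFilter U := @ultra_proper _ _ UU.
  have UB : U B by apply: BU; exact: withinT.
  have U_ev n : U [set m | (n <= m)%N].
    by apply: BU; exists n => // m nm _; exact: nm.
  have /choice[v Hv] n : exists v, B n ->
      [/\ C v, v o = 1, c <= hatp v & forall k, (k < n)%N ->
      `|v (xs k) - X a (xs k)| <= n.+1%:R^-1].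
    have [Bn|nB] := pselect (B n); last by exists 0.
    have ch : c < h n a by move: Bn; rewrite /B /c /=; lra.
    have [_ _ /(_ a c ch)[v [Cv v1 cv Yv]] _] := Hh n.
    exists v => _; split=> // k kn; apply: Yv; apply/mapP; exists k => //.
    by rewrite mem_iota.
  have UC : U (v @^-1` [set w | C w /\ c * w o <= hatp w]).
    by apply: filterS UB => n /Hv[Cv v1 cv _]; rewrite /= v1 mulr1.
  have [w Cw vw] : exists2 w, C w & forall x, (fun n => v n x) @ U --> w x.
    apply: (ultra_cone_cvg bC (B := 1)).
    by apply: filterS UB => n /Hv[Cv v1 cv _]; rewrite /= v1.
  have wX : w = X a.
    apply: xs_sep => // k; apply/eqP; rewrite -subr_eq0 -normr_le0.
    apply/ler_addgt0Pr => f f0; rewrite add0r.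
    apply: (cvgr_to_le (cvg_norm (cvgB (vw (xs k)) (cvg_cst (X a (xs k)))))).
    have [n nf] := ltr_add_invr f0.
    apply: filterS2 UB (U_ev (maxn n k.+1)) => m Bm /=.
    rewrite geq_max => /andP[nm km]; have [_ _ _ /(_ k km)] := Hv m Bm.
    move/le_trans; apply; apply: le_trans (ltW nf); rewrite add0r.
    by rewrite lef_pV2 ?posrE// ler_nat ltnS.
  have [_] : [set w | C w /\ c * w o <= hatp w] (X a).
    apply: (hat_usc bC tp); rewrite -wX.
    exact: filter_pointwise_adherent UC vw.
  by rewrite Xo mulr1 /c; lra.
- by have [_ _ _] := Hh n; exact.
Qed.

Lemma hat_random_bounded : bounded_measurable setT (hatp \o X).
Proof.
have [h [hb [M hM] hlim _]] := hat_random_approx.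
split.
  apply: (measurable_fun_cvg (h := h)) => [n|a _]; first by have [] := hb n.
  exact: hlim.
exists M => a _; apply: (cvgr_to_le (cvg_norm (hlim a))).
by apply: nearW => n; exact: hM.
Qed.

Variable mu : {measure set Om -> \bar R}.
Hypothesis mu_fin : (mu setT < +oo)%E.

Lemma hat_barycenter_le : hatp (bary mu setT) <= \int[mu]_a hatp (X a).
Proof.
have [h [hb [M hM] hlim hle]] := hat_random_approx.
have mh n : measurable_fun setT (h n) by have [] := hb n.
have [_ H] := bounded_convergence measurableT mu_fin mh (fun n a _ => hM n a)
  (fun a _ => hlim a).
apply: (cvgr_to_ge H); apply: nearW => n; exact: hle.
Qed.

(** The sets hat p (v) >= c v(o) are closed convex cones, hence contain the
    barycentres of the level sets of hat p. *)
Lemma hat_barycenter_ge : \int[mu]_a hatp (X a) <= hatp (bary mu setT).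
Proof.
have [mhat [M HM]] := hat_random_bounded; have hb := hat_random_bounded.
have m1 : 0 < fine (mu setT) + 1 by rewrite ltr_wpDl// fine_ge0.
apply/ler_addgt0Pr => e e0; pose f := e / (fine (mu setT) + 1).
have f0 : 0 < f by rewrite divr_gt0.
have fm : f * fine (mu setT) <= e.
  rewrite /f mulrAC ler_pdivrMr// ler_wpM2l ?(ltW e0)//.
  by rewrite lerDl.
clearbody f.
pose K := Num.truncn (M / f).
pose lev a := Num.truncn (hatp (X a) / f).
have hatX0 a : 0 <= hatp (X a) by exact: (hat_ge0 bC tp).
have levK a : (lev a < K.+1)%N.
  rewrite ltnS; apply: le_truncn; rewrite ler_pM2r ?invr_gt0//.
  by apply: le_trans (HM a Logic.I); exact: ler_norm.
have levP a (n : nat) : lev a = n <-> n%:R * f <= hatp (X a) < n.+1%:R * f.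
  rewrite -ler_pdivlMr// -ltr_pdivrMr//; split=> [<-|]; last exact: truncn_def.
  by apply: truncn_itv; rewrite divr_ge0// ltW.
pose c a : 'I_K.+1 := inord (lev a).
have cP i a : c a = i <-> i%:R * f <= hatp (X a) < i.+1%:R * f.
  rewrite -levP; split=> [<-|li]; first by rewrite inordK.
  by apply: val_inj; rewrite /= inordK.
have mc i : measurable (c @^-1` [set i]).
  have -> : c @^-1` [set i] = (hatp \o X) @^-1` `[i%:R * f, i.+1%:R * f[%classic.
    by apply/seteqP; split=> a; rewrite /= in_itv/= => /cP.
  by rewrite -[X in measurable X]setTI; apply: mhat => //; exact: measurable_itv.
have mA i : measurable (setT `&` c @^-1` [set i]) by exact: measurableI.
have Cb i := barycenter_cone bC XC Xo mX mu_fin (mA i).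
rewrite (barycenter_partition bC XC Xo mX mu_fin measurableT mc).
rewrite (hat_sum bC tp)//; apply: le_trans (lerD (lexx _) fm).
rewrite (fine_partition mu_fin measurableT mc) mulr_sumr -big_split/=.
rewrite (Rintegral_partition measurableT mu_fin mc hb).
apply: ler_sum => i _; set A := _ `&` _.
have /andP[_ H1] : i%:R * f * fine (mu A) <= \int[mu]_(a in A) (hatp \o X) a <=
    i.+1%:R * f * fine (mu A).
  apply: (Rintegral_bounds (mA i) (mu_lty mu_fin (mA i))).
    by apply: bounded_measurableS hb _ => //; exact: mA.
  by move=> a [_ /cP/andP[-> /ltW]].
have [_] : [set v | C v /\ i%:R * f * v o <= hatp v] (bary mu A).
  apply: (barycenter_in bC XC Xo mX mu_fin (mA i)) => /=.
  - exact: (hat_usc bC tp).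
  - by rewrite (hat0 bC tp) mulr0; split=> //; exact: (cone0 bC).
  - move=> u v [Cu hu] [Cv hv]; split; first exact: (coneD bC).
    by rewrite (hatD bC tp)// mulrDr lerD.
  - move=> r u r0 [Cu hu]; split; first exact: (coneZ bC).
    by rewrite (hatZ bC tp)// -[(r *: u) o]/(r * u o) mulrCA ler_wpM2l.
  - by move=> a [_ /cP/andP[+ _]]; rewrite Xo mulr1.
rewrite (barycenter_o Xo mu (mA i)) -/A => H2; apply: le_trans H1 _.
by rewrite -natr1 mulrDl mul1r mulrDl lerD2r.
Qed.

Lemma hat_barycenter : hatp (bary mu setT) = \int[mu]_a hatp (X a).
Proof.
by apply/eqP; rewrite eq_le hat_barycenter_le hat_barycenter_ge.
Qed.

End random_hat.

(** * Extreme points and test functions *)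

Section extremal.
Context {R : realType} {T : choiceType} (C : set (T -> R)) (o : T).
Hypothesis bC : based_cone C o.

(** Extreme points of the base u(o) = 1 of the cone. *)
Definition extremal (e : T -> R) := forall f g (t : R),
  C f -> C g -> f o = 1 -> g o = 1 -> 0 < t < 1 ->
  e = t *: f + (1 - t) *: g -> f = e /\ g = e.

(** Where neither part vanishes at o, the equation exhibits e as a convex
    combination of the normalised parts. *)
Lemma extremal_part e u v : extremal e -> e o = 1 -> C u -> C v ->
  e = u + v -> u = u o *: e.
Proof.
move=> ee e1 Cu Cv euv.
have uv1 : u o + v o = 1.
  by rewrite -e1 euv.
have := bc_ge0 bC Cu o; rewrite le_eqVlt => /predU1P[u0|u0].
  by rewrite -u0 scale0r; exact: (cone_eq0 bC Cu).
have := bc_ge0 bC Cv o; rewrite le_eqVlt => /predU1P[v0|v0].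
  have -> : u o = 1 by rewrite -uv1 -v0 addr0.
  by rewrite scale1r euv (cone_eq0 bC Cv)// addr0.
have nrm w : 0 < w o -> C w -> C ((w o)^-1 *: w) /\ ((w o)^-1 *: w) o = 1.
  move=> w0 Cw; split; first by apply: (coneZ bC) => //; rewrite invr_ge0 ltW.
  by rewrite -[LHS]/(_ * _) mulVf ?gt_eqF.
have [Cu' u1] := nrm u u0 Cu; have [Cv' v1] := nrm v v0 Cv.
have [|//|<- _] := ee _ _ (u o) Cu' Cv' u1 v1; first by apply/andP; split; lra.
  have -> : 1 - u o = v o by lra.
  by rewrite !scalerA !divff ?gt_eqF// !scale1r.
by rewrite scalerA divff ?gt_eqF// scale1r.
Qed.

(** All the pieces of a decomposition of an extreme point are multiples of it. *)
Lemma hat_extremal p e : test C p -> C e -> e o = 1 -> extremal e ->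
  hat C p e = p e.
Proof.
move=> tp Ce e1 ee; apply/eqP; rewrite eq_le (test_le_hat bC tp)// andbT.
apply: (hat_le bC tp) => // s ds.
apply: (@le_trans _ _ (\sum_(u <- s) u o * p e)); last first.
  by rewrite -mulr_suml -(decomposition_at o ds) e1 mul1r.
rewrite big_seq [leRHS]big_seq; apply: ler_sum => u us.
rewrite -(testZ tp)//; last exact: (bc_ge0 bC (ds.1 _ us)).
rewrite -(@extremal_part e u (\sum_(v <- rem u s) v))//.
- exact: (ds.1 _ us).
- by apply: (cone_sum bC) => v /mem_rem vs _; exact: (ds.1 _ vs).
- by rewrite -ds.2 (big_rem u).
Qed.

(** The positively homogeneous function that equals u(x)^2 on the base. *)
Definition square_test (x : T) (u : T -> R) : R := u x ^+ 2 / u o.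

(** With r = u(x) / u(o), which is at most the Harnack constant, the function is
    r^2 u(o); both subadditivity and the Lipschitz bound are read off from this. *)
Lemma square_testP x : test C (square_test x).
Proof.
have [M M0 HM] := harnack bC.
have ratio u : C u -> exists2 r, 0 <= r <= M x & u x = r * u o.
  move=> Cu; have := bc_ge0 bC Cu o; rewrite le_eqVlt => /predU1P[u0|u0].
    by exists 0; rewrite ?lexx ?M0// (cone_eq0 bC Cu)// mul0r.
  exists (u x / u o); last by rewrite divfK// gt_eqF.
  by rewrite divr_ge0 ?(bc_ge0 bC)//= ler_pdivrMr// HM.
have sqE u r : C u -> u x = r * u o -> square_test x u = r ^+ 2 * u o.
  move=> Cu ur; rewrite /square_test ur.
  have [->|u0] := eqVneq (u o) 0; first by rewrite !mulr0 expr0n mul0r.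
  by rewrite exprMn expr2 [u o ^+ 2]expr2 mulrA mulfK.
split.
- by move=> u Cu; rewrite divr_ge0 ?sqr_ge0// (bc_ge0 bC).
- move=> u v Cu Cv; have [r _ ur] := ratio u Cu; have [q _ vq] := ratio v Cv.
  rewrite (sqE u r)// (sqE v q)// /square_test.
  have u0 := bc_ge0 bC Cu o; have v0 := bc_ge0 bC Cv o.
  rewrite -[(u + v) x]/(u x + v x) -[(u + v) o]/(u o + v o) ur vq.
  have := addr_ge0 u0 v0; rewrite le_eqVlt => /predU1P[s0|s0].
    by rewrite -s0 invr0 mulr0 addr_ge0// mulr_ge0// sqr_ge0.
  rewrite ler_pdivrMr// -subr_ge0.
  have -> : (r ^+ 2 * u o + q ^+ 2 * v o) * (u o + v o) -
    (r * u o + q * v o) ^+ 2 = (u o * v o) * (r - q) ^+ 2 by ring.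
  by apply: mulr_ge0; [exact: mulr_ge0|exact: sqr_ge0].
- move=> c u c0 Cu; rewrite /square_test.
  rewrite -[(c *: u) x]/(c * u x) -[(c *: u) o]/(c * u o).
  have [->|cn0] := eqVneq c 0; first by rewrite !mul0r expr0n mul0r.
  by rewrite exprMn invfM mulrACA [c ^+ 2]expr2 mulfK.
- exists [:: x; o], (2 * M x + M x ^+ 2); first by rewrite addr_ge0 ?mulr_ge0 ?sqr_ge0.
  move=> u v Cu Cv; have [r /andP[r0 rM] ur] := ratio u Cu.
  have [q /andP[q0 qM] vq] := ratio v Cv.
  rewrite (sqE u r)// (sqE v q)// !big_cons big_nil addr0.
  have -> : r ^+ 2 * u o - q ^+ 2 * v o =
      (r + q) * (u x - v x) - r * q * (u o - v o) by rewrite ur vq; ring.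
  apply: le_trans (ler_normB _ _) _; rewrite !normrM.
  rewrite (ger0_norm (addr_ge0 r0 q0)) (ger0_norm r0) (ger0_norm q0).
  have H1 : (r + q) * `|u x - v x| <= 2 * M x * `|u x - v x|.
    by rewrite ler_wpM2r//; lra.
  have H2 : r * q * `|u o - v o| <= M x ^+ 2 * `|u o - v o|.
    by rewrite ler_wpM2r// expr2 ler_pM.
  have H3 : 0 <= 2 * M x * `|u o - v o| by rewrite !mulr_ge0.
  have H4 : 0 <= M x ^+ 2 * `|u x - v x| by rewrite mulr_ge0 ?sqr_ge0.
  by lra.
Qed.

(** If e = t f + (1 - t) g, the envelope of the square at x exceeds its value at
    e by at least t (1 - t) (f(x) - g(x))^2. *)
Lemma square_extremal (xs : nat -> T) e :
  (forall u v, C u -> C v -> (forall k, u (xs k) = v (xs k)) -> u = v) ->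
  C e -> e o = 1 ->
  (forall k, hat C (square_test (xs k)) e <= square_test (xs k) e) ->
  extremal e.
Proof.
move=> sep Ce e1 He f g t Cf Cg f1 g1 /andP[t0 t1] efg.
have t1' : 0 < 1 - t by rewrite subr_gt0.
suff fg : f = g.
  by rewrite efg -fg -scalerDl addrC subrK scale1r.
apply: sep => // k; apply/eqP; rewrite -subr_eq0 -sqrf_eq0.
have tsq := square_testP (xs k).
have Ctf := coneZ bC (ltW t0) Cf; have Ctg := coneZ bC (ltW t1') Cg.
have : t * square_test (xs k) f + (1 - t) * square_test (xs k) g <=
    square_test (xs k) e.
  apply: le_trans _ (He k); rewrite efg (hatD bC tsq)//.
  rewrite (hatZ bC tsq (ltW t0) Cf) (hatZ bC tsq (ltW t1') Cg).
  by apply: lerD; rewrite ler_pM2l//; exact: (test_le_hat bC tsq).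
rewrite /square_test f1 g1 e1 !divr1 efg.
rewrite -[(_ + _) (xs k)]/(t * f (xs k) + (1 - t) * g (xs k)).
set a := f _; set b := g _ => H.
have : t * (1 - t) * (a - b) ^+ 2 <= 0 by lra.
rewrite pmulr_rle0 ?mulr_gt0// => ab; apply/eqP/le_anti.
by rewrite ab sqr_ge0.
Qed.

(** On the base u(o) = 1 this is an affine function of the value of u at one
    point. *)
Definition affine_value (l : T * R * R) (u : T -> R) : R :=
  l.1.2 * u l.1.1 + l.2 * u o.

Definition maxlin (ls : seq (T * R * R)) (u : T -> R) : R :=
  foldr (fun l m => Num.max (affine_value l u) m) 0 ls.

Lemma maxlin_ge0 ls u : 0 <= maxlin ls u.
Proof. by elim: ls => //= l ls IH; rewrite le_max IH orbT. Qed.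

Lemma le_maxlin ls u l : l \in ls -> affine_value l u <= maxlin ls u.
Proof.
elim: ls => //= m ls IH; rewrite inE le_max => /predU1P[->|/IH->].
  by rewrite lexx.
by rewrite orbT.
Qed.

Lemma maxlin_le ls u c : 0 <= c ->
  (forall l, l \in ls -> affine_value l u <= c) -> maxlin ls u <= c.
Proof.
move=> c0; elim: ls => //= l ls IH Hl; rewrite ge_max Hl ?mem_head//=.
by apply: IH => m ml; apply: Hl; rewrite inE ml orbT.
Qed.

Lemma maxlinP ls : test C (maxlin ls).
Proof.
elim: ls => [|[[x a] b] ls IH].
  split=> [u _|u v _ _|c u _ _|]; rewrite /= ?addr0 ?mulr0//.
  by exists [::], 0 => // u v _ _; rewrite subrr normr0 big_nil mulr0.
split.
- by move=> u _; exact: maxlin_ge0.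
- move=> u v Cu Cv; rewrite /= ge_max; apply/andP; split.
    apply: le_trans (lerD (le_maxlin u (mem_head (x, a, b) ls))
      (le_maxlin v (mem_head (x, a, b) ls))).
    rewrite /affine_value /= -[(u + v) x]/(u x + v x) -[(u + v) o]/(u o + v o).
    by lra.
  apply: le_trans (testD IH Cu Cv) _.
  by rewrite lerD// le_max lexx orbT.
- move=> c u c0 Cu /=; rewrite maxr_pMr// (testZ IH)//; congr (Num.max _ _).
  by rewrite /affine_value /= -[(c *: u) x]/(c * u x) -[(c *: u) o]/(c * u o); ring.
- have [Y [L L0 HL]] := test_lip IH.
  exists [:: x, o & Y], (`|a| + `|b| + L); first by rewrite !addr_ge0.
  move=> u v Cu Cv; rewrite !big_cons /=.
  have HS := HL u v Cu Cv; set S := \sum_(y <- Y) _ in HS *.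
  have S0 : 0 <= S by exact: sumr_ge0.
  set P := `|u x - v x|; set Q := `|u o - v o|.
  have P0 : 0 <= P := normr_ge0 _.
  have Q0 : 0 <= Q := normr_ge0 _.
  have aff : `|affine_value (x, a, b) u - affine_value (x, a, b) v| <=
      `|a| * P + `|b| * Q.
    rewrite /affine_value /= -!normrM; apply: le_trans (ler_normD _ _).
    by rewrite le_eqVlt; apply/orP; left; apply/eqP; congr `|_|; ring.
  have LS : L * S <= (`|a| + `|b| + L) * (P + (Q + S)).
    rewrite [leRHS]mulrDl [X in _ + X]mulrDr [X in _ + (_ + X)]mulrDr.
    have := mulr_ge0 (addr_ge0 (normr_ge0 a) (normr_ge0 b)) (addr_ge0 P0 (addr_ge0 Q0 S0)).
    by have := mulr_ge0 L0 P0; have := mulr_ge0 L0 Q0; lra.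
  have AB : `|a| * P + `|b| * Q <= (`|a| + `|b| + L) * (P + (Q + S)).
    have := mulr_ge0 L0 (addr_ge0 P0 (addr_ge0 Q0 S0)).
    have := mulr_ge0 (normr_ge0 a) (addr_ge0 Q0 S0).
    by have := mulr_ge0 (normr_ge0 b) (addr_ge0 P0 S0); lra.
  have := le_trans aff AB; have := le_trans HS LS.
  set B := (_ + _ + _) * _; rewrite !ler_distl => /andP[m1 m2] /andP[a1 a2].
  apply/andP; split.
    by rewrite lerBlDr ge_max -!lerBlDr !le_max a1 m1 orbT.
  by rewrite ge_max -!lerBlDr !le_max !lerBlDr a2 m2 orbT.
Qed.

End extremal.


(** * Uniqueness of the representing measure *)

Definition halfspaces {R : realType} {T : choiceType} {Om : Type} (o : T)
    (X : Om -> T -> R) (ls : seq (T * R * R)) : set Om :=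
  [set a | forall l, l \in ls -> 0 < affine_value o l (X a)].

Lemma affine_random_measurable {R : realType} {T : choiceType} {d}
    {Om : measurableType d} (o : T) (X : Om -> T -> R) (l : T * R * R) :
  measurable_fun setT (X ^~ o) -> measurable_fun setT (X ^~ l.1.1) ->
  measurable_fun setT (affine_value o l \o X).
Proof.
move=> mo ml.
by apply: measurable_funD; exact: (measurable_funM (measurable_cst _)).
Qed.

Lemma measurable_halfspaces {R : realType} {T : choiceType} {d}
    {Om : measurableType d} (o : T) (X : Om -> T -> R) (ls : seq (T * R * R)) :
  measurable_fun setT (X ^~ o) ->
  (forall l, l \in ls -> measurable_fun setT (X ^~ l.1.1)) ->
  measurable (halfspaces o X ls).
Proof.
move=> mo; elim: ls => [_|l ls IH ml].
  by have -> : halfspaces o X [::] = setT by apply/seteqP; split.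
have -> : halfspaces o X (l :: ls) =
    (affine_value o l \o X) @^-1` `]0, +oo[%classic `&` halfspaces o X ls.
  apply/seteqP; split=> a.
    move=> Ha; split; first by rewrite /= in_itv/= andbT; apply: Ha; exact: mem_head.
    by move=> m mls; apply: Ha; rewrite inE mls orbT.
  move=> [/= + Ha] m; rewrite in_itv/= andbT => la.
  by rewrite inE => /predU1P[->//|]; exact: Ha.
apply: measurableI; last by apply: IH => m mls; apply: ml; rewrite inE mls orbT.
rewrite -[X in measurable X]setTI; apply: affine_random_measurable => //.
by apply: ml; exact: mem_head.
Qed.

Section uniqueness.
Context {R : realType} {T : choiceType} (C : set (T -> R)) (o : T).
Hypothesis bC : based_cone C o.
Variable xs : nat -> T.
Hypothesis xs_sep : forall u v, C u -> C v ->
  (forall k, u (xs k) = v (xs k)) -> u = v.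
Context {d} {Om : measurableType d} (X : Om -> T -> R).
Hypothesis XC : forall a, C (X a).
Hypothesis Xo : forall a, X a o = 1.
Hypothesis mX : forall x, measurable_fun setT (X ^~ x).

(** A measure carried by extreme points integrates p and its envelope alike. *)
Lemma integral_test_extremal (mu : {measure set Om -> \bar R}) N p :
  (mu setT < +oo)%E -> measurable N -> mu N = 0 ->
  (forall a, ~ N a -> extremal C o (X a)) ->
  test C p -> measurable_fun setT (p \o X) ->
  \int[mu]_a p (X a) = hat C p (barycenter X mu setT).
Proof.
move=> mu_fin mN N0 NE tp mp; rewrite (hat_barycenter bC xs_sep XC Xo mX tp mu_fin).
have [mhat _] := hat_random_bounded bC xs_sep XC Xo mX tp.
congr fine; apply: ae_eq_integral => //; try exact/measurable_EFinP.
exists N; split=> // a /= /not_implyP[_ ne]; apply: contrapT => Na.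
by apply: ne; rewrite (hat_extremal bC tp) //; exact: NE.
Qed.

Lemma maxlin_random_measurable ls : measurable_fun setT (maxlin o ls \o X).
Proof.
elim: ls => [|l ls IH]; first exact: measurable_cst.
by apply: measurable_maxr IH; exact: affine_random_measurable.
Qed.

(** If M is the maximum of the opposites of the affine functions of ls, the two
    lists [scaled n 0 ls] and [scaled n 1 ls] give max(n M, 0) and
    max(1 + n M, 0).  The function 1 + max(n M, 0) - max(1 + n M, 0) vanishes
    where M >= 0 and equals 1 where n M <= -1. *)
Let scaled (n : nat) (c : R) (ls : seq (T * R * R)) :=
  [seq (l.1.1, - (n%:R * l.1.2), c - n%:R * l.2) | l <- ls].

Let ramp ls n a :=
  1 + maxlin o (scaled n 0 ls) (X a) - maxlin o (scaled n 1 ls) (X a).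

Let scaled_value n c ls a m : m \in scaled n c ls -> exists2 l, l \in ls &
  affine_value o m (X a) = c - n%:R * affine_value o l (X a).
Proof.
by move=> /mapP[l ll ->]; exists l => //; rewrite /affine_value /= Xo; ring.
Qed.

Let scaled_le n c ls a l : l \in ls ->
  c - n%:R * affine_value o l (X a) <= maxlin o (scaled n c ls) (X a).
Proof.
move=> ll; have -> : c - n%:R * affine_value o l (X a) =
    affine_value o (l.1.1, - (n%:R * l.1.2), c - n%:R * l.2) (X a).
  by rewrite /affine_value /= Xo; ring.
by apply: le_maxlin; apply/mapP; exists l.
Qed.

Let ramp_bound ls n a : 0 <= ramp ls n a <= 1.
Proof.
rewrite /ramp; apply/andP; split.
  rewrite subr_ge0; apply: maxlin_le; first by rewrite addr_ge0 ?maxlin_ge0.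
  move=> m /(scaled_value a)[l ll ->]; have := scaled_le n 0 a ll; lra.
rewrite lerBlDr lerD2l; apply: maxlin_le; first exact: maxlin_ge0.
by move=> m /(scaled_value a)[l ll ->]; have := scaled_le n 1 a ll; lra.
Qed.

Let ramp_out ls n a l : l \in ls -> affine_value o l (X a) <= 0 ->
  ramp ls n a = 0.
Proof.
move=> ll l0; apply/le_anti; have /andP[-> _] := ramp_bound ls n a; rewrite andbT.
have nl : n%:R * affine_value o l (X a) <= 0 by rewrite mulr_ge0_le0.
rewrite /ramp subr_le0 addrC -lerBrDr; apply: maxlin_le.
  by have := scaled_le n 1 a ll; lra.
by move=> m /(scaled_value a)[q ql ->]; have := scaled_le n 1 a ql; lra.
Qed.

Let ramp_in ls a : halfspaces o X ls a -> \forall n \near \oo, ramp ls n a = 1.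
Proof.
move=> Ha.
have : \forall n \near \oo, forall l, l \in ls ->
    1 <= n%:R * affine_value o l (X a).
  elim: ls Ha => [|l ls IH] Ha; first exact: nearW.
  have l0 : 0 < affine_value o l (X a) by apply: Ha; exact: mem_head.
  have {}IH := IH (fun m ml => Ha m (mem_behead (s := l :: ls) ml)).
  have [N lN] := ltr_add_invr l0.
  have Nn : \forall n \near \oo, (N.+1 <= n)%N by exists N.+1.
  apply: filterS2 IH Nn => n IH Nn m; rewrite inE => /predU1P[->|/IH//].
  rewrite mulrC -ler_pdivrMr ?ltr0n ?(leq_trans _ Nn)// div1r.
  apply: le_trans (ltW lN); rewrite add0r lef_pV2 ?posrE ?ltr0n ?(leq_trans _ Nn)//.
  by rewrite ler_nat.
apply: filterS => n Hn; rewrite /ramp.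
have z c : c <= 1 -> maxlin o (scaled n c ls) (X a) = 0.
  move=> c1; apply/le_anti; rewrite maxlin_ge0 andbT; apply: maxlin_le => // m.
  by move=> /(scaled_value a)[l /Hn ll ->]; lra.
by rewrite !z// addr0 subr0.
Qed.

(** The ramps are differences of test functions and tend boundedly to the
    indicator function of an intersection of open half-spaces. *)
Lemma measure_halfspaces_eq (mu nu : {measure set Om -> \bar R}) ls :
  (mu setT < +oo)%E -> mu setT = nu setT ->
  (forall ms, \int[mu]_a maxlin o ms (X a) = \int[nu]_a maxlin o ms (X a)) ->
  mu (halfspaces o X ls) = nu (halfspaces o X ls).
Proof.
move=> mufin munu eqi; have nufin : (nu setT < +oo)%E by rewrite -munu.
have mh := measurable_halfspaces (ls := ls) (mX o) (fun l _ => mX l.1.1).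
have hfin (la : {measure set Om -> \bar R}) : (la setT < +oo)%E ->
    la (halfspaces o X ls) \is a fin_num.
  move=> lafin; rewrite ge0_fin_numE//; apply: le_lt_trans lafin.
  by apply: le_measure; rewrite ?inE.
have lb ms : bounded_measurable setT (maxlin o ms \o X).
  split; first exact: maxlin_random_measurable.
  have [M _ HM] := test_bound bC (maxlinP C o ms).
  exists M => a _; rewrite ger0_norm/= ?maxlin_ge0//.
  by have := HM _ (XC a); rewrite Xo mulr1.
have mr n : measurable_fun setT (ramp ls n).
  apply: measurable_funB; last exact: maxlin_random_measurable.
  by apply: measurable_funD => //; exact: maxlin_random_measurable.
have cv (la : {measure set Om -> \bar R}) : (la setT < +oo)%E ->
    (fun n => \int[la]_a ramp ls n a) @ \oo --> fine (la (halfspaces o X ls)).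
  move=> lafin.
  have -> : fine (la (halfspaces o X ls)) = \int[la]_a \1_(halfspaces o X ls) a.
    by rewrite /Rintegral integral_indic// setIT.
  have [||//] := bounded_convergence (M := 1) (f := \1_(halfspaces o X ls))
    measurableT lafin mr.
    by move=> n a _; have /andP[r0 r1] := ramp_bound ls n a; rewrite ger0_norm.
  move=> a _; have [Ha|nHa] := pselect (halfspaces o X ls a).
    rewrite indicE mem_set//; apply: cvg_near_cst; exact: ramp_in.
  rewrite indicE memNset//; apply: cvg_near_cst; apply: nearW => n.
  move/existsNP: nHa => [l /not_implyP[ll /negP]]; rewrite -leNgt.
  exact: ramp_out.
have eqr n : \int[mu]_a ramp ls n a = \int[nu]_a ramp ls n a.
  have E (la : {measure set Om -> \bar R}) : (la setT < +oo)%E ->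
      \int[la]_a ramp ls n a = fine (la setT) +
      \int[la]_a maxlin o (scaled n 0 ls) (X a) -
      \int[la]_a maxlin o (scaled n 1 ls) (X a).
    move=> lafin; have bi f := @bounded_measurable_integrable _ _ R la setT f measurableT lafin.
    have b1 := bounded_measurable_cst (setT : set Om) (1 : R).
    rewrite RintegralB//; last exact: bi (lb _).
      rewrite RintegralD//; last exact: bi (lb _).
        by rewrite Rintegral_cst// mul1r.
      exact: bi b1.
    exact: bi (bounded_measurableD b1 (lb _)).
  by rewrite (E _ mufin) (E _ nufin) munu !eqi.
rewrite -(fineK (hfin _ mufin)) -(fineK (hfin _ nufin)); congr (_%:E).
have cvnu := cv _ nufin.
have eqf : (fun n => \int[mu]_a ramp ls n a) = (fun n => \int[nu]_a ramp ls n a).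
  by apply/funext => n; exact: eqr.
rewrite -eqf in cvnu.
by apply: cvg_unique (cv _ mufin) cvnu; exact: Rhausdorff.
Qed.

End uniqueness.

(** * Existence: refining decompositions laid out on the unit interval *)

Section interval_integral.
Context {R : realType}.
Local Notation leb := (@lebesgue_measure R).
Implicit Types (f g : R -> R) (a b c v w : R).

Definition has_integral f a c v :=
  bounded_measurable (`[a, c[%classic : set R) f /\
  \int[leb]_(t in `[a, c[) f t = v.

Lemma lebesgue_co a c : a <= c -> leb `[a, c[%classic = (c - a)%:E.
Proof.
move=> ac; rewrite lebesgue_measure_itv /= lte_fin.
have [ac'|ca] := ltP a c; first by rewrite EFinB.
by have /eqP -> : a == c; rewrite ?subrr// eq_le ac ca.
Qed.

Lemma lebesgue_co_lty a c : (leb `[a, c[%classic < +oo)%E.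
Proof.
by rewrite lebesgue_measure_itv/=; case: ifP => _; rewrite -?EFinB ltry.
Qed.

Lemma eq_has_integral f g a c v : (forall t, a <= t < c -> f t = g t) ->
  has_integral f a c v -> has_integral g a c v.
Proof.
move=> fg [[mf [M fM]] fv].
have fg' : {in `[a, c[%classic : set R, f =1 g}.
  by move=> t; rewrite inE /= in_itv/= => /fg.
split; last by rewrite -fv; apply/esym; exact: eq_Rintegral.
split; first exact: eq_measurable_fun mf.
by exists M => t It; rewrite -fg' ?inE//; exact: fM.
Qed.

Lemma has_integral_cst a c v : a <= c -> has_integral (cst v) a c (v * (c - a)).
Proof.
move=> ac; split; first exact: bounded_measurable_cst.
rewrite Rintegral_cst//.
exact: (congr1 (fun z => v * fine z) (lebesgue_co ac)).
Qed.

Lemma has_integral_cat f a b c v w : a <= b -> b <= c ->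
  has_integral f a b v -> has_integral f b c w -> has_integral f a c (v + w).
Proof.
move=> ab bc [[mf [M fM]] fv] [[mg [N gN]] gw].
have E : `[a, c[%classic = `[a, b[%classic `|` `[b, c[%classic :> set R.
  apply/seteqP; split=> t; rewrite /= !in_itv/=.
    by move=> /andP[h1 h2]; have [tb|bt] := ltP t b; [left|right];
      rewrite ?h1 ?h2.
  by case=> /andP[h1 h2]; rewrite ?h1 ?h2 ?(le_trans ab h1) ?(lt_le_trans h2 bc).
have fb : bounded_measurable (`[a, c[%classic : set R) f.
  rewrite E; split; first by apply/measurable_funU.
  exists (Num.max M N) => t [It|It]; rewrite le_max.
    by rewrite fM.
  by rewrite gN// orbT.
split=> //; rewrite E Rintegral_setU//.
- by rewrite fv gw.
- by rewrite -E; apply: bounded_measurable_integrable => //; exact: lebesgue_co_lty.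
- apply/disj_setPS => t [/=]; rewrite !in_itv/= => /andP[_ tb] /andP[bt _]; lra.
Qed.

End interval_integral.

Section decompositions.
Context {R : realType} {T : choiceType} (C : set (T -> R)) (o : T).
Hypothesis bC : based_cone C o.
Implicit Types (u v : T -> R) (s : seq (T -> R)).

(** Refining a decomposition never decreases the sum of a test function, so the
    tests can be treated one after the other. *)
Lemma hat_approx_seq (p : nat -> (T -> R) -> R) n u (e : R) :
  (forall k, test C (p k)) -> C u -> 0 < e -> exists2 s, decomposition C u s &
  forall k, (k < n)%N -> hat C (p k) u - e <= \sum_(v <- s) p k v.
Proof.
move=> tp Cu e0; elim: n => [|n [s ds sn]].
  by exists [:: u] => //; exact: decomposition1.
pose f := e / (size s).+1%:R.
have f0 : 0 < f by rewrite divr_gt0.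
have /choice[d Hd] v : exists t, C v -> decomposition C v t /\
    hat C (p n) v - f <= \sum_(w <- t) p n w.
  have [Cv|nCv] := pselect (C v); last by exists [::].
  have [t dt ht] := hat_approx bC (tp n) Cv f0.
  by exists t => _; split=> //; exact: ltW.
exists (flatten (map d s)).
  by apply: decomposition_flatten ds => v /Hd[].
have sumE (q : (T -> R) -> R) : \sum_(w <- flatten (map d s)) q w =
    \sum_(v <- s) \sum_(w <- d v) q w by rewrite big_flatten big_map.
move=> k; rewrite ltnS leq_eqVlt sumE => /predU1P[->|kn].
  apply: (@le_trans _ _ (\sum_(v <- s) (hat C (p n) v - f))).
    rewrite sumrB -(hat_sum bC (tp n)); last by move=> v vs _; exact: ds.1.
    rewrite ds.2 lerD2l lerN2 big_const_seq count_predT iter_addr_0.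
    rewrite -[_ *+ size s]mulr_natr /f mulrAC ler_pdivrMr ?ltr0n//.
    by rewrite ler_wpM2l ?(ltW e0)// ler_nat.
  by rewrite big_seq [leRHS]big_seq; apply: ler_sum => v vs; have [] := Hd v (ds.1 _ vs).
apply: le_trans (sn k kn) _.
rewrite big_seq [leRHS]big_seq; apply: ler_sum => v vs.
have [[Cd dv] _] := Hd v (ds.1 _ vs).
by rewrite -{1}dv; apply: (test_sum bC (tp k)) => w wd _; exact: Cd.
Qed.

(** The pieces of s occupy consecutive intervals [b, b + u(o)[ from a on; the
    value is the piece whose interval contains t, with the left end b of that
    interval. *)
Fixpoint lookup s (a t : R) : (T -> R) * R :=
  if s is u :: s' then if t < a + u o then (u, a) else lookup s' (a + u o) t
  else (0, a).

Lemma lookup_cone s a t : (forall u, u \in s -> C u) -> C (lookup s a t).1.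
Proof.
elim: s a => [|u s IH] a Cs /=; first exact: (cone0 bC).
case: ifP => _; first by apply: Cs; exact: mem_head.
by apply: IH => v vs; apply: Cs; rewrite inE vs orbT.
Qed.

Lemma lookup_integral s a (H : (T -> R) -> R -> R -> R) (J : (T -> R) -> R) :
  (forall v, v \in s -> C v) ->
  (forall v b, v \in s -> has_integral (H v b) b (b + v o) (J v)) ->
  has_integral (fun t => H (lookup s a t).1 (lookup s a t).2 t)
    a (a + \sum_(v <- s) v o) (\sum_(v <- s) J v).
Proof.
move=> + HJ; elim: s a HJ => [|u s IH] a HJ Cs.
  rewrite !big_nil addr0; have := has_integral_cst 0 (lexx a).
  by rewrite mul0r; apply: eq_has_integral => t; lra.
have Cu : C u by apply: Cs; exact: mem_head.
have Cs' v : v \in s -> C v by move=> vs; apply: Cs; rewrite inE vs orbT.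
have u0 := bc_ge0 bC Cu o.
have s0 : 0 <= \sum_(v <- s) v o.
  by rewrite big_seq; apply: sumr_ge0 => v /Cs' Cv; exact: (bc_ge0 bC).
rewrite !big_cons; apply: (@has_integral_cat _ _ _ (a + u o)).
- by rewrite lerDl.
- by rewrite lerD2l lerDl.
- apply: eq_has_integral (HJ u a (mem_head _ _)) => t /andP[_ tu] /=.
  by rewrite tu.
- rewrite addrA; apply: eq_has_integral (IH (a + u o) _ Cs') => [t /andP[ut _] /=|].
    by rewrite ltNge ut.
  by move=> v b vs; apply: HJ; rewrite inE vs orbT.
Qed.

Variables (h : T -> R) (dec : nat -> (T -> R) -> seq (T -> R)).
Hypothesis Ch : C h.
Hypothesis h1 : h o = 1.
Hypothesis decP : forall n u, C u -> decomposition C u (dec n u).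

(** The n-th refinement of h; [piece n t] below is its element that occupies the
    point t of [0, 1[. *)
Fixpoint parts n := if n is m.+1 then flatten (map (dec m) (parts m)) else [:: h].

Fixpoint piece n (t : R) : (T -> R) * R :=
  if n is m.+1 then lookup (dec m (piece m t).1) (piece m t).2 t else (h, 0).

Lemma partsP n : decomposition C h (parts n).
Proof.
elim: n => [|n IH]; first exact: decomposition1.
by apply: decomposition_flatten IH => u; exact: decP.
Qed.

Lemma piece_cone n t : C (piece n t).1.
Proof.
elim: n => //= n IH; apply: lookup_cone => u; exact: (decP n IH).1.
Qed.

(** The integrand may depend on t itself, which lets the induction on n pass
    from H to its composition with one more lookup. *)
Lemma piece_integral n (H : (T -> R) -> R -> R -> R) (J : (T -> R) -> R) :
  (forall v b, C v -> has_integral (H v b) b (b + v o) (J v)) ->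
  has_integral (fun t => H (piece n t).1 (piece n t).2 t) 0 1
    (\sum_(v <- parts n) J v).
Proof.
elim: n H J => [|n IH] H J HJ.
  by have := HJ h 0 Ch; rewrite add0r h1 big_seq1.
rewrite /= big_flatten big_map.
apply: (IH (fun u a t => H (lookup (dec n u) a t).1 (lookup (dec n u) a t).2 t)).
move=> u a Cu; have du := decP n Cu; rewrite (decomposition_at o du).
apply: lookup_integral => [v|v b vd]; first exact: du.1.
by apply: HJ; exact: du.1.
Qed.

(** The fallback h only matters for v = 0. *)
Definition normalize v : T -> R := if v o == 0 then h else (v o)^-1 *: v.

Lemma normalize_cone v : C v -> C (normalize v).
Proof.
move=> Cv; rewrite /normalize; case: ifP => // _.
by apply: (coneZ bC) => //; rewrite invr_ge0 (bc_ge0 bC).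
Qed.

Lemma normalize_o v : normalize v o = 1.
Proof.
rewrite /normalize; case: ifP => [//|/negbT v0].
by rewrite -[LHS]/(_ * _) mulVf.
Qed.

Lemma normalizeK v : C v -> v o *: normalize v = v.
Proof.
move=> Cv; rewrite /normalize; have [v0|v0] := eqVneq (v o) 0.
  by rewrite v0 scale0r (cone_eq0 bC Cv).
by rewrite scalerA divff// scale1r.
Qed.

Lemma piece_integral_cst n (G : (T -> R) -> R) :
  has_integral (fun t => G (piece n t).1) 0 1 (\sum_(v <- parts n) G v * v o).
Proof.
apply: (piece_integral n (H := fun v _ _ => G v)) => v b Cv.
have := @has_integral_cst _ b (b + v o) (G v); rewrite lerDl => /(_ (bc_ge0 bC Cv o)).
by rewrite addrAC subrr add0r.
Qed.

Lemma piece_integral_at n x :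
  has_integral (fun t => normalize (piece n t).1 x) 0 1 (h x).
Proof.
have := piece_integral_cst n (fun v => normalize v x).
rewrite (decomposition_at x (partsP n)).
suff -> : \sum_(v <- parts n) normalize v x * v o = \sum_(v <- parts n) v x by [].
rewrite big_seq [RHS]big_seq; apply: eq_bigr => v /(partsP n).1 Cv.
by rewrite -[in RHS](normalizeK Cv) mulrC.
Qed.

Lemma piece_integral_test n p : test C p ->
  has_integral (fun t => p (normalize (piece n t).1)) 0 1
    (\sum_(v <- parts n) p v).
Proof.
move=> tp; have := piece_integral_cst n (fun v => p (normalize v)).
suff -> : \sum_(v <- parts n) p (normalize v) * v o = \sum_(v <- parts n) p v by [].
rewrite big_seq [RHS]big_seq; apply: eq_bigr => v /(partsP n).1 Cv.
have := testZ tp (bc_ge0 bC Cv o) (normalize_cone Cv).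
by rewrite (normalizeK Cv) mulrC => ->.
Qed.

Definition jump n x t : R :=
  `|normalize (piece n.+1 t).1 x - normalize (piece n t).1 x|.

(** The quadratic increment of the martingale is the increment of the sum of the
    square at x, and |z| <= (l z^2 + 1 / l) / 2 turns it into a bound for the
    integral of the absolute increment. *)
Lemma jump_integral n x (l : R) : 0 < l -> exists2 c,
  has_integral (jump n x) 0 1 c &
  c <= (l * (\sum_(v <- parts n.+1) square_test o x v -
             \sum_(v <- parts n) square_test o x v) + l^-1) / 2.
Proof.
move=> l0; pose J u := \sum_(v <- dec n u) `|normalize v x - normalize u x| * v o.
exists (\sum_(u <- parts n) J u).
  apply: (piece_integral n
    (H := fun u a t => `|normalize (lookup (dec n u) a t).1 x - normalize u x|)).
  move=> u a Cu; have du := decP n Cu; rewrite (decomposition_at o du).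
  apply: (@lookup_integral _ a (fun v _ _ => `|normalize v x - normalize u x|)).
    by move=> v; exact: du.1.
  move=> v b vd; have := @has_integral_cst _ b (b + v o) (`|normalize v x - normalize u x|).
  rewrite lerDl => /(_ (bc_ge0 bC (du.1 _ vd) o)).
  by rewrite addrAC subrr add0r.
have sqE v : C v -> square_test o x v = normalize v x ^+ 2 * v o.
  move=> Cv; have := testZ (square_testP bC x) (bc_ge0 bC Cv o) (normalize_cone Cv).
  by rewrite (normalizeK Cv) => ->; rewrite /square_test normalize_o divr1 mulrC.
have atE v : C v -> v x = normalize v x * v o.
  by move=> Cv; rewrite -{1}(normalizeK Cv) mulrC.
have JE u : C u -> J u <= (l * (\sum_(v <- dec n u) square_test o x v -
    square_test o x u) + l^-1 * u o) / 2.
  move=> Cu; have du := decP n Cu.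
  apply: (@le_trans _ _ (\sum_(v <- dec n u)
      (l / 2 * square_test o x v - l * normalize u x * v x +
       (l / 2 * normalize u x ^+ 2 + l^-1 / 2) * v o))).
    rewrite /J big_seq [leRHS]big_seq; apply: ler_sum => v vd.
    have Cv := du.1 _ vd; have v0 := bc_ge0 bC Cv o.
    rewrite (sqE v Cv) (atE v Cv); set a := normalize v x; set b := normalize u x.
    have : `|a - b| <= l / 2 * (a - b) ^+ 2 + l^-1 / 2.
      rewrite -[(a - b) ^+ 2]real_normK ?num_real//; set z := `|a - b|.
      have : 0 <= l^-1 * (l * z - 1) ^+ 2 by rewrite mulr_ge0 ?sqr_ge0// invr_ge0 ltW.
      have -> : l^-1 * (l * z - 1) ^+ 2 = l * z ^+ 2 - 2 * z + l^-1.
        by field; rewrite gt_eqF.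
      by lra.
    move=> /(ler_wpM2r v0)/le_trans; apply.
    rewrite le_eqVlt; apply/orP; left; apply/eqP; field.
    by rewrite gt_eqF.
  rewrite big_split/= sumrB -!mulr_sumr.
  rewrite -(decomposition_at x du) -(decomposition_at o du).
  rewrite (sqE u Cu) (atE u Cu); set S := \sum_(v <- _) _.
  by rewrite le_eqVlt; apply/orP; left; apply/eqP; field; rewrite gt_eqF.
have SP : \sum_(v <- parts n.+1) square_test o x v =
    \sum_(u <- parts n) \sum_(v <- dec n u) square_test o x v.
  by rewrite /= big_flatten big_map.
apply: (@le_trans _ _ (\sum_(u <- parts n) (l * (\sum_(v <- dec n u)
    square_test o x v - square_test o x u) + l^-1 * u o) / 2)).
  by rewrite big_seq [leRHS]big_seq; apply: ler_sum => u /(partsP n).1; exact: JE.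
rewrite -mulr_suml big_split/= -!mulr_sumr sumrB -SP.
by rewrite -(decomposition_at o (partsP n)) h1 mulr1.
Qed.

End decompositions.

Section existence.
Context {R : realType} {T : choiceType} (C : set (T -> R)) (o : T).
Hypothesis bC : based_cone C o.
Variable xs : nat -> T.
Local Notation leb := (@lebesgue_measure R).
Local Notation sq k := (square_test o (xs k)).

(** The step n aims at the precision eps n ^ 2 = 4^(-n), and l = 2^n in
    [jump_integral] then bounds the mean absolute increments by 2^(-n). *)
Let eps (n : nat) : R := ((2 ^ n)%:R)^-1.

Let eps_gt0 n : 0 < eps n.
Proof. by rewrite /eps invr_gt0 ltr0n expn_gt0. Qed.

Let eps_le n : eps n ^+ 2 <= n.+1%:R^-1.
Proof.
have H : eps n <= n.+1%:R^-1.
  by rewrite /eps lef_pV2 ?posrE ?ltr0n ?expn_gt0// ler_nat ltn_expl.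
apply: le_trans H; rewrite expr2 -[leRHS]mul1r ler_wpM2r ?(ltW (eps_gt0 n))//.
by rewrite /eps invf_le1 ?ltr0n ?expn_gt0// ler1n expn_gt0.
Qed.

Lemma near_optimal_decompositions : exists dec : nat -> (T -> R) -> seq (T -> R),
  forall n u, C u -> decomposition C u (dec n u) /\
  forall k, (k <= n)%N -> hat C (sq k) u - eps n ^+ 2 * u o <=
    \sum_(v <- dec n u) sq k v.
Proof.
suff /choice[d Hd] (nu : nat * (T -> R)) : exists s, C nu.2 ->
    decomposition C nu.2 s /\ forall k, (k <= nu.1)%N ->
    hat C (sq k) nu.2 - eps nu.1 ^+ 2 * nu.2 o <= \sum_(v <- s) sq k v.
  by exists (fun n u => d (n, u)) => n u; exact: (Hd (n, u)).
case: nu => n u /=.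
have [Cu|nCu] := pselect (C u); last by exists [::].
have := bc_ge0 bC Cu o; rewrite le_eqVlt => /predU1P[u0|u0].
  exists [:: u] => _; split; first exact: decomposition1.
  move=> k _; rewrite big_seq1 -u0 mulr0 subr0 (cone_eq0 bC Cu)//.
  by rewrite (hat0 bC (square_testP bC _)) (test0 bC (square_testP bC _)).
have [s ds Hs] := hat_approx_seq bC n.+1 (fun k => square_testP bC (xs k)) Cu
  (mulr_gt0 (exprn_gt0 2 (eps_gt0 n)) u0).
by exists s.
Qed.

(** Summable mean increments force convergence at almost every t.  At such a t
    the limit along an ultrafilter, which always exists in the cone, agrees with
    the ordinary limit at the points xs k. *)
Theorem near_optimal_limit h : C h -> h o = 1 -> exists Phi : R -> T -> R,
  [/\ forall t, C (Phi t) /\ Phi t o = 1,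
      forall k, measurable_fun setT (fun t : R => Phi t (xs k)),
      forall k, \int[leb]_(t in `[0, 1]) Phi t (xs k) = h (xs k) &
      forall k, \int[leb]_(t in `[0, 1]) sq k (Phi t) = hat C (sq k) h].
Proof.
move=> Ch h1; have [dec Hdec] := near_optimal_decompositions.
have decP n u (Cu : C u) : decomposition C u (dec n u) := (Hdec n u Cu).1.
have tsq k := square_testP bC (xs k).
pose P n := parts h dec n.
have dP n : decomposition C h (P n) := partsP Ch decP n.
pose phi n t := normalize o h (piece o h dec n t).1.
have phiC n t : C (phi n t) by apply: (normalize_cone bC Ch); exact: (piece_cone bC Ch decP).
have phi1 n t : phi n t o = 1 by exact: normalize_o.
have [M M0 HM] := harnack bC.
have phiM n t x : 0 <= phi n t x <= M x.
  by rewrite (bc_ge0 bC)//=; have := HM _ (phiC n t) x; rewrite phi1 mulr1.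
have le_opt k n : \sum_(v <- P n) sq k v <= hat C (sq k) h.
  exact: (le_hat bC (tsq k)).
have opt k n : (k <= n)%N ->
    hat C (sq k) h - eps n ^+ 2 <= \sum_(v <- P n.+1) sq k v.
  move=> kn; rewrite /P /= big_flatten big_map -/(P n).
  apply: (@le_trans _ _ (\sum_(u <- P n) (hat C (sq k) u - eps n ^+ 2 * u o))).
    rewrite sumrB -(hat_sum bC (tsq k)); last by move=> v vs _; exact: ((dP n).1).
    by rewrite (dP n).2 -mulr_sumr -(decomposition_at o (dP n)) h1 mulr1.
  rewrite big_seq [leRHS]big_seq; apply: ler_sum => u /(dP n).1 Cu.
  by have [_] := Hdec n u Cu; apply.
pose I0 : set R := `[0, 1[%classic.
have mI0 : measurable I0 by exact: measurable_itv.
have I0fin : (leb I0 < +oo)%E by exact: lebesgue_co_lty.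
(* The step n + 1 is accurate at xs k as soon as k <= n, whence the shift
   of the index by k + 1. *)
pose D k j t := jump o h dec (k + j).+1 (xs k) t.
have D0 k j t : 0 <= D k j t by exact: normr_ge0.
have Dint k j : bounded_measurable I0 (D k j) /\
    \int[leb]_(t in I0) D k j t <= eps j.
  have l0 : 0 < (eps (k + j))^-1 by rewrite invr_gt0.
  have [c [bD <-] cle] := jump_integral bC Ch h1 decP (k + j).+1 (xs k) l0.
  split=> //; apply: le_trans cle _.
  have := opt k _ (leq_addr j k); have := le_opt k (k + j).+2.
  set S1 := \sum_(v <- P _.+2) _; set S2 := \sum_(v <- P _.+1) _ => H1 H2.
  have e0 := eps_gt0 (k + j); set e := eps (k + j) in H2 e0 l0 *.
  have H3 : e^-1 * (S1 - S2) <= e.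
    rewrite ler_pdivrMl// -expr2; lra.
  apply: (@le_trans _ _ e); first by rewrite invrK -/(P _) -/S1 -/S2; lra.
  rewrite /e /eps lef_pV2 ?posrE ?ltr0n ?expn_gt0// ler_nat leq_exp2l//.
  exact: leq_addl.
pose S k t := (\sum_(0 <= j <oo) (D k j t)%:E)%E.
have mD k j : measurable_fun I0 (EFin \o D k j).
  by apply/measurable_EFinP; exact: (Dint k j).1.1.
have mS k : measurable_fun I0 (S k).
  by apply: ge0_emeasurable_sum => [j t _ _|j _]; [rewrite lee_fin|exact: mD].
have Sint k : leb.-integrable I0 (S k).
  apply/integrableP; split; first exact: mS.
  apply: (@le_lt_trans _ _ (\int[leb]_(t in I0) S k t)%E).
    rewrite le_eqVlt; apply/orP; left; apply/eqP; apply: eq_integral => t _.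
    by rewrite gee0_abs//; apply: nneseries_ge0 => j _ _; rewrite lee_fin.
  rewrite (integral_nneseries leb mI0 (mD k)); last by move=> j t _; rewrite lee_fin.
  apply: (@le_lt_trans _ _ (2%:E : \bar R)); last exact: ltry.
  have half := @cvg_geometric_eseries_half R 2 0.
  apply: (@le_trans _ _ (\sum_(0 <= j <oo) (2 / (2 ^ (j + 1))%:R)%:E)%E).
    apply: lee_nneseries => [j _ _|j _]; first by apply: integral_ge0 => t _; rewrite lee_fin.
    have [bD Dle] := Dint k j.
    rewrite -[leLHS]fineK; last first.
      by apply: integrable_fin_num => //; exact: bounded_measurable_integrable.
    rewrite lee_fin; apply: le_trans Dle _.
    by rewrite addn1 expnS natrM invfM mulrA divff// mul1r.
  by rewrite (cvg_lim _ half)// expr0 divr1.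
pose G : set R := I0 `&` [set t | forall k, (S k t < +oo)%E].
have GI : G `<=` I0 by move=> t [].
have mG : measurable G.
  have -> : G = I0 `&` \bigcap_k (I0 `&` [set t | (S k t < +oo)%E]).
    apply/seteqP; split=> t [It Ht].
      by split; [exact: It|move=> k _; split; [exact: It|exact: Ht]].
    by split; [exact: It|move=> k; have [] := Ht k Logic.I].
  apply: measurableI => //; apply: bigcapT_measurable => k.
  exact: emeasurable_fun_infty_o.
have N0 : leb (I0 `\` G) = 0.
  apply/negligibleP; first exact: measurableD.
  have : leb.-negligible (\bigcup_k [set t | ~ (I0 t -> S k t \is a fin_num)]).
    apply: negligible_bigcup => k.
    by have [N [mN N0 sN]] := @integrable_ae _ _ R leb I0 (measurable_itv _) _ (Sint k); exists N.
  apply: negligibleS => t [It nGt].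
  have /existsNP[k Hk] : ~ forall k, (S k t < +oo)%E by move=> H; apply: nGt.
  exists k => //= /(_ It); rewrite ge0_fin_numE//.
  by apply: nneseries_ge0 => j _ _; rewrite lee_fin.
have intG f : bounded_measurable I0 f -> \int[leb]_(t in I0) f t = \int[leb]_(t in G) f t.
  move=> bf; congr fine; rewrite (@negligible_integral _ _ R leb I0 (I0 `\` G) _ _ _ _ N0).
  - by rewrite setDD setIidr.
  - exact: measurableD.
  - exact: mI0.
  - exact: bounded_measurable_integrable.
have Gcvg k t : G t -> cvgn (fun n => phi n t (xs k)).
  move=> [It /(_ k) St].
  pose v j := phi (j + k.+1)%N t (xs k).
  have cn : cvgn (series (telescope v)).
    apply: normed_cvg.
    have -> : [normed series (telescope v)] = series (D k ^~ t).
      apply/funext => n; rewrite /series /=; apply: eq_bigr => j _.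
      by rewrite /telescope /v /D /jump /= addSn addnS [(k + j)%N]addnC.
    exact: nnseries_is_cvg.
  have : cvgn v.
    have -> : v = (fun n => v 0%N + series (telescope v) n).
      by apply/funext => n; exact: eq_sum_telescope.
    by apply: is_cvgD => //; exact: is_cvg_cst.
  by move=> /cvg_ex[l vl]; apply/cvg_ex; exists l; rewrite -(cvg_shiftn k.+1).
have Gfin : (leb G < +oo)%E.
  by apply: le_lt_trans I0fin; apply: le_measure; rewrite ?inE.
have [U [UU UF]] := ultraFilterLemma (@eventually_filter).
have PU : ProperFilter U := @ultra_proper _ _ UU.
have /choice[Phi HPhi] t : exists w, [/\ C w, w o = 1,
    G t -> forall k, (fun n => phi n t (xs k)) @ \oo --> w (xs k) & ~ G t -> w = h].
  have [Gt|nGt] := pselect (G t); last by exists h.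
  have [w Cw phw] : exists2 w, C w & forall x, (fun n => phi n t x) @ U --> w x.
    apply: (ultra_cone_cvg bC (B := 1)); apply: filterE => n.
    by split; [exact: phiC|rewrite phi1].
  have cU x (l : R) : (fun n => phi n t x) @ \oo --> l -> w x = l.
    move=> cl; apply: cvg_unique (phw x) _ => //.
    by move=> A /cl; exact: UF.
  exists w; split=> //.
    by apply: cU; under eq_fun do rewrite phi1; exact: cvg_cst.
  move=> _ k; have /cvg_ex[l pl] := Gcvg k t Gt.
  by rewrite (cU _ _ pl).
have PhiC t : C (Phi t) by have [] := HPhi t.
have Phi1 t : Phi t o = 1 by have [] := HPhi t.
have PhiG k t : G t -> (fun n => phi n t (xs k)) @ \oo --> Phi t (xs k).
  by have [_ _ + _] := HPhi t => /[apply]; exact.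
have PhiM t x : `|Phi t x| <= M x.
  rewrite ger0_norm ?(bc_ge0 bC)//; have := HM _ (PhiC t) x.
  by rewrite Phi1 mulr1.
have phib n x : has_integral (fun t => phi n t x) 0 1 (h x).
  exact: (piece_integral_at bC Ch h1 decP).
have phiG n x : measurable_fun G (fun t => phi n t x).
  by apply: measurable_funS GI _ => //; exact: (phib n x).1.1.
have mPhi k : measurable_fun setT (fun t : R => Phi t (xs k)).
  rewrite -(setUv G); apply/measurable_funU => //; first exact: measurableC.
  split; first exact: (measurable_fun_cvg (fun n => phiG n (xs k)) (PhiG k)).
  apply: (eq_measurable_fun (cst (h (xs k)))); last exact: measurable_cst.
  by move=> t; rewrite inE => nGt; have [_ _ _ /(_ nGt) ->] := HPhi t.
have i01 f : bounded_measurable setT f ->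
    \int[leb]_(t in `[0, 1]) f t = \int[leb]_(t in G) f t.
  move=> bf; rewrite -intG; last exact: bounded_measurableS bf _.
  rewrite -Rintegral_itv_bndo_bndc//; apply: bounded_measurable_integrable => //.
  exact: bounded_measurableS bf _.
have limG (f : nat -> R -> R) (g : R -> R) (B : R) (c : nat -> R) (l : R) :
    (forall n, has_integral (f n) 0 1 (c n)) -> (forall n t, `|f n t| <= B) ->
    (forall t, G t -> f ^~ t @ \oo --> g t) -> c @ \oo --> l ->
    \int[leb]_(t in G) g t = l.
  move=> fc fB fg cl.
  have mf n : measurable_fun G (f n).
    by apply: measurable_funS GI _ => //; exact: (fc n).1.1.
  have [_ cv] := @bounded_convergence _ _ R leb G f g B mG Gfin mf (fun n t _ => fB n t) fg.
  have ce : c = fun n => \int[leb]_(t in G) f n t.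
    by apply/funext => n; have [bf <-] := fc n; exact: intG.
  rewrite ce in cl; by apply: cvg_unique cv cl; exact: Rhausdorff.
have sqE k (u : T -> R) : u o = 1 -> sq k u = u (xs k) ^+ 2.
  by move=> u1; rewrite /square_test u1 divr1.
have sqM k (u : T -> R) : 0 <= u (xs k) <= M (xs k) -> `|u (xs k) ^+ 2| <= M (xs k) ^+ 2.
  move=> /andP[u0 uM]; rewrite ger0_norm ?sqr_ge0//.
  by rewrite ler_sqr ?nnegrE.
exists Phi; split=> // k.
  rewrite i01; last by split; [exact: mPhi|exists (M (xs k)) => t _; exact: PhiM].
  apply: (limG _ _ (M (xs k)) _ _ (fun n => phib n (xs k))) => [n t|t Gt|].
  - by have /andP[p0 p1] := phiM n t (xs k); rewrite ger0_norm.
  - exact: PhiG.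
  - exact: cvg_cst.
under eq_Rintegral => t _ do rewrite (sqE k _ (Phi1 t)).
rewrite i01; last first.
  split; first by apply: measurable_funX; exact: mPhi.
  exists (M (xs k) ^+ 2) => t _; apply: sqM; rewrite (bc_ge0 bC)//=.
  by apply: le_trans (PhiM t (xs k)); exact: ler_norm.
have sqint n : has_integral (fun t => phi n t (xs k) ^+ 2) 0 1 (\sum_(v <- P n) sq k v).
  apply: eq_has_integral (piece_integral_test bC Ch h1 decP n (tsq k)) => t _.
  exact: (sqE k (phi n t) (phi1 n t)).
apply: (limG _ _ (M (xs k) ^+ 2) _ _ sqint) => [n t|t Gt|].
- exact: sqM.
- by under eq_fun do rewrite expr2; rewrite expr2; apply: cvgM; exact: PhiG.
rewrite -(cvg_shiftn k.+1).
have lo : (fun n => hat C (sq k) h - harmonic n) @ \oo --> hat C (sq k) h.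
  rewrite -[X in _ --> X]subr0; apply: cvgB; first exact: cvg_cst.
  exact: cvg_harmonic.
apply: (squeeze_cvgr _ lo (cvg_cst _)); apply: nearW => n.
rewrite /= addnS le_opt andbT; apply: le_trans (opt k (n + k)%N (leq_addl _ _)).
rewrite lerD2l lerN2; apply: le_trans (eps_le _) _.
by rewrite lef_pV2 ?posrE ?ltr0n// ler_nat ltnS leq_addr.
Qed.

End existence.

(** * Choquet simplices *)

Section choquet.
Context {R : realType} {T : topologicalType}.
Variables (C : set (T -> R)) (o : T) (S : set {family compact, T -> R}).
Hypothesis bC : based_cone C o.
Variable xs : nat -> T.
Hypothesis xs_sep : forall u v, C u -> C v ->
  (forall k, u (xs k) = v (xs k)) -> u = v.
Hypothesis SE : forall u : T -> R, S u <-> C u /\ u o = 1.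
Hypothesis cS : compact S.

Let fn (g : S) : T -> R := set_val g.

Let fnC g : C (fn g).
Proof. by have /SE[] : S (fn g) by exact: set_valP. Qed.

Let fn_o g : fn g o = 1.
Proof. by have /SE[] : S (fn g) by exact: set_valP. Qed.

Let fn_eq (f g : S) : (forall k, fn f (xs k) = fn g (xs k)) -> f = g.
Proof.
move=> fg; apply: val_inj; rewrite -set_valE.
by apply: xs_sep fg; exact: fnC.
Qed.

Let mkS (u : T -> R) : C u -> u o = 1 -> exists g : S, fn g = u.
Proof.
move=> Cu u1; have /mem_set Su : S u by apply/SE; split.
by exists (exist _ u Su).
Qed.

Let ultra_cvgS (U : set_system S) : UltraFilter U -> exists g : S, U --> g.
Proof.
move=> UU; have PU : ProperFilter U := @ultra_proper _ _ UU.
have US : U (set_val @^-1` S) by apply: filterE => g; exact: set_valP.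
have := cS; rewrite compact_ultra => /(_ _ (ultra_fmap set_val UU) US)[u [Su Uu]].
have /mem_set Su' := Su; exists (exist _ u Su') => A [_ [/= [W oW <-]] Wu WA].
apply: filterS WA _; apply: Uu; exact: open_nbhs_nbhs.
Qed.

Let fn_cvg (U : set_system S) (g : S) x : Filter U -> U --> g ->
  (fun f => fn f x) @ U --> fn g x.
Proof.
move=> FU Ug.
have : (set_val @ U) --> (set_val g : {family compact, T -> R}).
  apply: cvg_trans (@initial_continuous _ _ set_val g).
  exact: cvg_app.
move=> /fam_cvgP/(_ [set x] (@compact_set1 _ x)).
by rewrite uniform_set1.
Qed.

Let fn_continuous x : continuous (fun g : S => fn g x).
Proof. by move=> g; refine (@fn_cvg (nbhs g) g x _ _). Qed.

Let half (c : nat * bool * rat) : T * R * R :=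
  (xs c.1.1, if c.1.2 then 1 else -1, ratr c.2).

Let cylinder (cs : seq (nat * bool * rat)) : set S :=
  halfspaces o fn [seq half c | c <- cs].

Let cylinderP cs g : cylinder cs g <->
  forall c, c \in cs -> 0 < affine_value o (half c) (fn g).
Proof.
split=> [Hg c ccs|Hg l /mapP[c ccs ->]]; last exact: Hg.
by apply: Hg; apply/mapP; exists c.
Qed.

Let cylinderI cs ds : cylinder (cs ++ ds) = cylinder cs `&` cylinder ds.
Proof.
apply/seteqP; split=> g.
  by move=> /cylinderP Hg; split; apply/cylinderP => c ccs; apply: Hg;
    rewrite mem_cat ccs ?orbT.
move=> [/cylinderP H1 /cylinderP H2]; apply/cylinderP => c.
by rewrite mem_cat => /orP[/H1|/H2].
Qed.

(** An ultrafilter finer than the traces on the complement of O of the cylinders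
    around g would converge, by compactness, to an element that has the values
    of g at all the points xs k and is not in O. *)
Let cylinder_base (O : set S) g : open O -> O g ->
  exists cs, cylinder cs g /\ cylinder cs `<=` O.
Proof.
move=> oO Og; apply: contrapT => bad.
pose B := [set cs | cylinder cs g].
pose F := filter_from B (fun cs => cylinder cs `\` O).
have PF : ProperFilter F.
  apply: filter_from_proper; last first.
    move=> cs gcs; apply: contrapT => ne; apply: bad; exists cs; split=> // f fcs.
    by apply: contrapT => nO; apply: ne; exists f.
  apply: filter_from_filter; first by exists [::]; apply/cylinderP.
  move=> cs ds gcs gds; exists (cs ++ ds); first by rewrite /B /= cylinderI.
  by rewrite cylinderI => f [[]].
have [U [UU FU]] := ultraFilterLemma PF.
have PU : ProperFilter U := @ultra_proper _ _ UU.
have [f Uf] := ultra_cvgS UU.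
have Ucs cs : cylinder cs g -> U (cylinder cs).
  by move=> gcs; apply: FU; exists cs => // ? [].
suff fg : f = g.
  have UO : U O by apply: Uf; apply: open_nbhs_nbhs; rewrite fg.
  have UnO : U (~` O) by apply: FU; exists [::].
  have : U (O `&` ~` O) by apply: filterI.
  by rewrite setICr => /filter_not_empty.
apply: fn_eq => k; have fk : (fun e => fn e (xs k)) @ U --> fn f (xs k) by apply: fn_cvg.
apply/eqP; rewrite eq_le; apply/andP; split.
  rewrite leNgt; apply/negP => gf.
  have [q] := rat_in_itvoo gf; rewrite in_itv/= => /andP[gq qf].
  have gc : cylinder [:: (k, false, q)] g.
    by apply/cylinderP => c; rewrite inE => /eqP->; rewrite /affine_value/= fn_o; lra.
  suff : fn f (xs k) <= ratr q by lra.
  apply: (cvgr_to_le fk); apply: filterS (Ucs _ gc) => e /cylinderP/(_ _ (mem_head _ _)).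
  by rewrite /affine_value/= fn_o; lra.
rewrite leNgt; apply/negP => gf.
have [q] := rat_in_itvoo gf; rewrite in_itv/= => /andP[fq qg].
have gc : cylinder [:: (k, true, - q)] g.
  apply/cylinderP => c; rewrite inE => /eqP->.
  by rewrite /affine_value/= fn_o rmorphN/=; lra.
suff : ratr q <= fn f (xs k) by lra.
apply: (cvgr_to_ge fk); apply: filterS (Ucs _ gc) => e /cylinderP/(_ _ (mem_head _ _)).
by rewrite /affine_value/= fn_o rmorphN/=; lra.
Qed.

Let extreme_extremal (g : S) : extreme_points g <-> extremal C o (fn g).
Proof.
split=> H f1 f2 t.
  move=> Cf1 Cf2 f11 f21 t01 gE.
  have [e1 e1E] := mkS Cf1 f11; have [e2 e2E] := mkS Cf2 f21.
  rewrite -e1E -e2E in gE *.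
  have [x|-> ->//] := H e1 e2 t t01.
  exact: (congr1 (fun u : T -> R => u x) gE).
move=> t01 gE; have [] := H (fn f1) (fn f2) t (fnC _) (fnC _) (fn_o _) (fn_o _) t01.
  by apply/funext => x; exact: gE.
by move=> /val_inj-> /val_inj->.
Qed.

Section at_point.
Variable h : S.

Let X (g : borel h) : T -> R := fn g.

Let XC g : C (X g). Proof. exact: fnC. Qed.
Let Xo g : X g o = 1. Proof. exact: fn_o. Qed.

Let mX x : measurable_fun setT (X ^~ x).
Proof.
move=> mT; apply: (measurability _ (RGenOInfty.measurableE R)) => //.
move=> _ [_ [r ->] <-]; rewrite setTI; apply: sub_sigma_algebra.
have /continuousP/(_ `]r, +oo[%classic) := @fn_continuous x.
by apply; exact: interval_open.
Qed.

(** There are countably many cylinders, so open sets are countable unions of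
    cylinders. *)
Let borelE : @measurable _ (borel h) = <<s [set cylinder cs | cs in setT] >>.
Proof.
apply/seteqP; split; apply: smallest_sub.
- exact: smallest_sigma_algebra.
- move=> O oO; pose GT := g_sigma_algebraType [set (cylinder cs : set (pointed_at h)) | cs in setT].
  have OE : O = \bigcup_cs (if `[< cylinder cs `<=` O >] then cylinder cs else set0).
    apply/seteqP; split=> [g Og|g [cs _]].
      by have [cs [gcs csO]] := cylinder_base oO Og; exists cs => //; rewrite asboolT.
    by case: asboolP => // csO; exact: csO.
  rewrite OE; apply: (@countable_bigcupT_measurable _ GT).
    exact: countableP.
  move=> cs; case: asboolP => _; last exact: (@measurable0 _ GT).
  by apply: sub_sigma_algebra; exists cs.
- exact: sigma_algebra_measurable.
- move=> _ [cs _ <-]; apply: (@measurable_halfspaces R T _ (borel h) o X) => [|l _];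
  exact: mX.
Qed.

(** In particular the set of extreme points is a Borel set. *)
Let extremeE : @extreme_points R T S = \bigcap_k
  [set g : borel h | hat C (square_test o (xs k)) (X g) <= square_test o (xs k) (X g)].
Proof.
apply/seteqP; split=> [g /extreme_extremal eg k _|g Hg].
  by rewrite /= (hat_extremal bC (square_testP bC _) (XC g) (Xo g) eg).
by apply/extreme_extremal/(square_extremal bC xs_sep (XC g) (Xo g)) => k; exact: Hg.
Qed.

Let mhat k : measurable_fun setT (hat C (square_test o (xs k)) \o X).
Proof. by have [] := hat_random_bounded bC xs_sep XC Xo mX (square_testP bC (xs k)). Qed.

Let msq k : measurable_fun setT (square_test o (xs k) \o X).
Proof.
have -> : square_test o (xs k) \o X = fun g => X g (xs k) ^+ 2.
  by apply/funext => g; rewrite /= /square_test Xo divr1.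
by apply: measurable_funX; exact: mX.
Qed.

Let mgap k : measurable [set g : borel h |
  hat C (square_test o (xs k)) (X g) <= square_test o (xs k) (X g)].
Proof.
have -> : [set g : borel h | hat C (square_test o (xs k)) (X g) <=
    square_test o (xs k) (X g)] = ((hat C (square_test o (xs k)) \o X) \-
    (square_test o (xs k) \o X)) @^-1` `]-oo, 0]%classic.
  by apply/seteqP; split=> g; rewrite /= in_itv/= subr_le0.
by rewrite -[X in measurable X]setTI; apply: measurable_funB.
Qed.

Let measurable_extreme : measurable (@extreme_points R T S : set (borel h)).
Proof. by rewrite extremeE; apply: bigcapT_measurable. Qed.

Lemma represents_barycenter (nu : {measure set (borel h) -> \bar R}) :
  represents nu -> nu setT = 1%E /\ barycenter X nu setT = X h.
Proof.
move=> [mE N0 E1 hE].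
have nuT : nu setT = 1%E.
  pose E : set (borel h) := @extreme_points R T S.
  have -> : nu setT = (nu E + nu (~` E))%E.
    by rewrite -measureU ?setUv ?setICr//; exact: measurableC.
  by rewrite [nu E]E1 [nu (~` E)]N0 adde0.
have nu_fin : (nu setT < +oo)%E by rewrite nuT ltry.
split=> //; apply/funext => x; rewrite /barycenter -[RHS]/(fine (X h x)%:E) hE.
congr fine; rewrite (@negligible_integral _ _ R nu setT (~` @extreme_points R T S)) ?setTD ?setCK//.
  exact: measurableC.
apply: bounded_measurable_integrable => //.
exact: (random_bounded bC XC Xo mX).
Qed.

Lemma represents_unique (nu mu : {measure set (borel h) -> \bar R}) :
  represents nu -> represents mu -> forall A : set (borel h), measurable A ->
  nu A = mu A.
Proof.
move=> rnu rmu; have [nuT nuh] := represents_barycenter rnu.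
have [muT muh] := represents_barycenter rmu.
have int_eq (la : {measure set (borel h) -> \bar R}) ls : represents la ->
    \int[la]_g maxlin o ls (X g) = hat C (maxlin o ls) (X h).
  move=> rla; have [laT <-] := represents_barycenter rla.
  have [mE N0 _ _] := rla.
  apply: (integral_test_extremal bC xs_sep XC Xo mX (N := ~` @extreme_points R T S)) => //.
  - by rewrite laT ltry.
  - exact: measurableC.
  - by move=> g /contrapT/extreme_extremal.
  - exact: maxlinP.
  - exact: maxlin_random_measurable.
apply: (@measure_unique _ R (borel h) (range cylinder) (fun=> cylinder [::])
  borelE _ _ _ nu mu).
- by move=> _ _ [cs _ <-] [ds _ <-]; exists (cs ++ ds).
- by move=> _; exists [::].
- apply/seteqP; split=> // g _; exists 0%N => //; exact/cylinderP.
- move=> _ [cs _ <-]; apply: (measure_halfspaces_eq bC XC Xo mX).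
  + by rewrite nuT ltry.
  + by rewrite nuT muT.
  + by move=> ms; rewrite !int_eq.
- move=> _; have -> : cylinder [::] = setT by apply/seteqP; split=> // g _; exact/cylinderP.
  by rewrite nuT ltry.
Qed.

(** The law of the limit of [near_optimal_limit] for the uniform distribution on
    [0, 1]. *)
Lemma represents_exists : exists mu : {measure set (borel h) -> \bar R},
  represents mu.
Proof.
have [Phi [PhiC mPhi PhiI PhiS]] := near_optimal_limit bC xs (XC h) (Xo h).
have /choice[psi psiE] t : exists g : S, fn g = Phi t.
  by have [Ct ot] := PhiC t; exact: mkS.
pose psi' : measurableTypeR R -> borel h := psi.
have mpsi : measurable_fun setT psi'.
  apply: (measurability _ borelE) => _ [_ [cs _ <-] <-]; rewrite setTI.
  have -> : psi' @^-1` cylinder cs = halfspaces o Phi [seq half c | c <- cs].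
    by apply/seteqP; split=> t; rewrite /cylinder /halfspaces /= psiE.
  apply: (@measurable_halfspaces R T _ (measurableTypeR R)) => [|l /mapP[c _ ->]];
    last exact: mPhi.
  by under eq_fun do rewrite (PhiC _).2; exact: measurable_cst.
have U01 : (0 : R) < 1 by exact: ltr01.
pose mu : {measure set (borel h) -> \bar R} :=
  measure_function_pushforward__canonical__measure_function_Measure (uniform_prob U01) mpsi.
have muT : mu setT = 1%E.
  exact: (@probability_setT _ _ _ (uniform_prob U01)).
have mu_fin : (mu setT < +oo)%E by rewrite muT ltry.
have intE (f : borel h -> R) : measurable_fun setT f -> (forall g, 0 <= f g) ->
    \int[mu]_g f g = \int[lebesgue_measure]_(t in `[0, 1]) f (psi' t).
  move=> mf f0; congr fine.
  rewrite -[LHS]/(\int[pushforward (uniform_prob U01) psi']_g (f g)%:E)%E.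
  rewrite (ge0_integral_pushforward mpsi)//; last 2 first.
  - exact/measurable_EFinP.
  - by move=> g _; rewrite lee_fin.
  rewrite preimage_setT integral_uniform.
  - by rewrite subr0 invr1 mul1e.
  - by apply/measurable_EFinP; exact: measurableT_comp.
  - by move=> t; rewrite lee_fin.
have Xpsi t : X (psi' t) = Phi t := psiE t.
have bh : barycenter X mu setT = X h.
  apply: xs_sep => //; first exact: (barycenter_cone bC XC Xo mX).
  move=> k; rewrite /barycenter intE//; last by move=> g; exact: (bc_ge0 bC (XC g)).
  by rewrite -PhiI; apply: eq_Rintegral => t _; rewrite Xpsi.
have bm f := @bounded_measurable_integrable _ _ R mu setT f measurableT mu_fin.
have hatb k := hat_random_bounded bC xs_sep XC Xo mX (square_testP bC (xs k)).
have sqb k : bounded_measurable setT (square_test o (xs k) \o X).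
  split; first exact: msq; have [M _ HM] := test_bound bC (square_testP bC (xs k)).
  exists M => g _; rewrite /= ger0_norm ?(test_ge0 (square_testP bC (xs k)))//.
  by have := HM _ (XC g); rewrite Xo mulr1.
have gap0 k : mu.-negligible (~` [set g : borel h |
    hat C (square_test o (xs k)) (X g) <= square_test o (xs k) (X g)]).
  pose f g := hat C (square_test o (xs k)) (X g) - square_test o (xs k) (X g).
  have f0 g : 0 <= f g.
    by rewrite subr_ge0; exact: (test_le_hat bC (square_testP bC (xs k)) (XC g)).
  have fb : bounded_measurable setT f.
    exact: bounded_measurableB (hatb k) (sqb k).
  have If : \int[mu]_g f g = 0.
    rewrite RintegralB//; [|exact: bm (hatb k)|exact: bm (sqb k)].
    rewrite -(hat_barycenter bC xs_sep XC Xo mX (square_testP bC (xs k)) mu_fin) bh.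
    have sq0 g : 0 <= square_test o (xs k) (X g).
      exact: (test_ge0 (square_testP bC (xs k)) (XC g)).
    rewrite -PhiS (intE (square_test o (xs k) \o X) (msq k) sq0).
    by apply/eqP; rewrite subr_eq0; apply/eqP/eq_Rintegral => t _; rewrite /= Xpsi.
  have If0 : (\int[mu]_g `|(f g)%:E| = 0)%E.
    under eq_integral do rewrite gee0_abs ?lee_fin//.
    by rewrite -[LHS]fineK ?[fine _]If//; apply: integrable_fin_num => //; exact: bm fb.
  have [N [mN N0 fN]] := (ae_eq_integral_abs mu measurableT
    (proj2 (measurable_EFinP _ _) fb.1)).1 If0.
  exists N; split=> // g ng; apply: fN => /(_ Logic.I) [fg].
  by apply: ng; rewrite /= -subr_le0 -/(f g) fg.
have E0 : mu (~` @extreme_points R T S) = 0.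
  apply/negligibleP; first exact: measurableC.
  by rewrite extremeE setC_bigcap; exact: negligible_bigcup.
have E1 : mu (@extreme_points R T S) = 1%E.
  have -> : mu (@extreme_points R T S) =
      (mu (@extreme_points R T S) + mu (~` @extreme_points R T S))%E.
    by rewrite E0 adde0.
  by rewrite -measureU ?setUv ?setICr//; exact: measurableC.
exists mu; split=> // x.
have Xb : bounded_measurable setT (X ^~ x) by exact: (random_bounded bC XC Xo mX).
rewrite -[set_val h x]/(X h x) -bh /barycenter.
rewrite /Rintegral fineK; last by apply: integrable_fin_num => //; exact: bm Xb.
rewrite (@negligible_integral _ _ R mu setT (~` @extreme_points R T S)) ?setTD ?setCK//.
  exact: measurableC.
exact: bm Xb.
Qed.

End at_point.

Theorem choquet_simplex_of_based_cone : choquet_simplex S.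
Proof.
split=> // h; have [mu rmu] := represents_exists h.
by exists mu; split=> // nu rnu A mA; exact: (represents_unique rnu rmu).
Qed.

End choquet.

(** * Means over boundaries and harmonic functions *)

Section harmonic.
Context {R : realType} {X : metricType R} {x0 : X}.
Variable om : set X -> X -> probability (borel x0) R.
Implicit Types (U V W : set X) (f g w : X -> R).

Local Notation bdm A f := (@bounded_measurable _ (borel x0) R A f).

Lemma open_borel (A : set (borel x0)) : @open X A -> measurable A.
Proof. by move=> oA; apply: sub_sigma_algebra. Qed.

Lemma closed_borel (A : set (borel x0)) : @closed X A -> measurable A.
Proof.
move=> cA; rewrite -(setCK A); apply: measurableC; apply: open_borel.
exact: closed_openC.
Qed.

Lemma closed_bd U : closed (bd U).
Proof.
rewrite /bd setDE; apply: closedI; first exact: closed_closure.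
by apply: open_closedC; exact: open_interior.
Qed.

Lemma measurable_bd U : measurable (bd U : set (borel x0)).
Proof. by apply: closed_borel; exact: closed_bd. Qed.
Hint Resolve measurable_bd : core.

Lemma bd_closure U : bd U `<=` closure U. Proof. by move=> x []. Qed.

Lemma bd_rel_compact V W : rel_compact V W -> bd V `<=` W.
Proof. by move=> [_ VW] x /bd_closure /VW. Qed.

Lemma compact_bd V W : rel_compact V W -> compact (bd V).
Proof.
move=> [cV _]; apply: (subclosed_compact _ cV); first exact: closed_bd.
exact: bd_closure.
Qed.

Lemma within_measurable (A : set (borel x0)) f : measurable A ->
  {within A, continuous f} -> measurable_fun A (f : borel x0 -> R).
Proof.
move=> mA /continuousP fc mA'.
apply: (measurability _ (RGenOInfty.measurableE R)) => // _ [_ [r ->] <-].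
have oI : open (`]r, +oo[%classic : set R) by exact: interval_open.
have [V oV VE] := (@open_subspaceP X A _).1 (fc _ oI).
rewrite setIC -VE; apply: measurableI => //; exact: open_borel.
Qed.

Lemma within_bounded W (A : set X) f : compact A -> A `<=` W ->
  {within W, continuous f} -> exists M : R, forall x, A x -> `|f x| <= M.
Proof.
move=> cA AW /(continuous_subspaceW AW) fc.
have [M [_ HM]] := compact_bounded (continuous_compact fc cA).
exists (M + 1) => x Ax; apply: (HM (M + 1)); first by rewrite ltrDl.
by exists x.
Qed.

Lemma within_bd_bounded W V f : rel_compact V W ->
  {within W, continuous f} -> bdm (bd V) f.
Proof.
move=> VW fc; split.
  apply: within_measurable => //.
  exact: continuous_subspaceW (bd_rel_compact VW) fc.
exact: within_bounded (compact_bd VW) (bd_rel_compact VW) fc.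
Qed.

Section mean.
Variables (V : set X) (x : X).
Hypothesis V1 : om V x (bd V) = 1%E.

Let Vfin : (om V x (bd V) < +oo)%E. Proof. by rewrite V1 ltry. Qed.
Let int f := bounded_measurable_integrable (mu := om V x) (measurable_bd V) Vfin (f := f).

Lemma eq_mean f g : (forall y, bd V y -> f y = g y) -> mean om V f x = mean om V g x.
Proof. by move=> fg; apply: eq_Rintegral => y /set_mem; exact: fg. Qed.

Lemma meanD f g : bdm (bd V) f -> bdm (bd V) g ->
  mean om V (fun y => f y + g y) x = mean om V f x + mean om V g x.
Proof. by move=> fb gb; rewrite /mean RintegralD//; exact: int. Qed.

Lemma meanB f g : bdm (bd V) f -> bdm (bd V) g ->
  mean om V (fun y => f y - g y) x = mean om V f x - mean om V g x.
Proof. by move=> fb gb; rewrite /mean RintegralB//; exact: int. Qed.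

Lemma meanZ (c : R) f : bdm (bd V) f ->
  mean om V (fun y => c * f y) x = c * mean om V f x.
Proof. by move=> fb; rewrite /mean RintegralZl//; exact: int. Qed.

Lemma mean_le f g : bdm (bd V) f -> bdm (bd V) g ->
  (forall y, bd V y -> f y <= g y) -> mean om V f x <= mean om V g x.
Proof. by move=> fb gb fg; apply: le_Rintegral => //; exact: int. Qed.

Lemma mean_cst (c : R) : mean om V (cst c) x = c.
Proof.
have -> : mean om V (cst c) x = c * fine (om V x (bd V)) by exact: Rintegral_cst.
by rewrite V1 mulr1.
Qed.

Lemma mean_dist f g (e : R) : bdm (bd V) f -> bdm (bd V) g ->
  (forall y, bd V y -> `|f y - g y| <= e) ->
  `|mean om V f x - mean om V g x| <= e.
Proof.
move=> fb gb fg; have eb c := bounded_measurable_cst (bd V : set (borel x0)) c.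
have db := bounded_measurableB fb gb.
rewrite -meanB// ler_norml -{1}(mean_cst (- e)) -{2}(mean_cst e).
apply/andP; split; apply: mean_le => // y /fg.
  by rewrite ler_norml => /andP[].
by rewrite ler_norml => /andP[].
Qed.

Lemma mean_cvg (f_ : nat -> X -> R) f (M : R) :
  (forall n, bdm (bd V) (f_ n)) -> (forall n y, bd V y -> `|f_ n y| <= M) ->
  (forall y, bd V y -> f_ ^~ y @ \oo --> f y) ->
  bdm (bd V) f /\ (fun n => mean om V (f_ n) x) @ \oo --> mean om V f x.
Proof.
move=> fb fM ff; apply: (bounded_convergence (M := M)) => //.
by move=> n; exact: (fb n).1.
Qed.

End mean.

Variable Dom : set (set X).
Hypothesis hf : harmonic_framework om Dom.

Lemma om_bd V x : Dom V -> V x -> om V x (bd V) = 1%E.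
Proof. by move=> DV Vx; have [+ _] := hf_measure hf DV; exact. Qed.

Lemma om_lty V x : Dom V -> V x -> (om V x (bd V) < +oo)%E.
Proof. by move=> DV Vx; rewrite om_bd// ltry. Qed.

(** Bounded Borel functions are integrable for all the harmonic measures, so the
    continuity of the harmonic measure applies to them. *)
Lemma continuous_mean V f : Dom V -> bdm (bd V) f ->
  {within V, continuous (mean om V f)}.
Proof.
move=> DV [mf [M fM]]; apply: (hf_continuous hf DV) => x Vx; split.
  move=> Y mY; exists (bd V `&` f @^-1` Y), (bd V `&` f @^-1` Y).
  by split=> //; rewrite ?setDv ?measure0//; exact: mf.
have fi := bounded_measurable_integrable (measurable_bd V) (om_lty DV Vx) (conj mf (ex_intro _ M fM)).
by have /integrableP[_] := fi.
Qed.

Variables (D : set X) (Dn : nat -> set X).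
Hypothesis oD : open D.
Hypothesis Dn_reg : forall n, Dom (Dn n) /\ regular om (Dn n).
Hypothesis Dn0 : Dn 0%N x0.
Hypothesis DnS : forall n, rel_compact (Dn n) (Dn n.+1).
Hypothesis DE : D = \bigcup_n Dn n.

Lemma Dn_open n : open (Dn n).
Proof. by have [] := hf_domain hf (Dn_reg n).1. Qed.

Lemma Dn_closure n : closure (Dn n) `<=` Dn n.+1.
Proof. by have [] := DnS n. Qed.

Lemma Dn_mono m n : (m <= n)%N -> Dn m `<=` Dn n.
Proof.
move=> mn; rewrite -(subnKC mn); elim: (n - m)%N => [|k IH]; first by rewrite addn0.
by rewrite addnS => x /IH /subset_closure /Dn_closure.
Qed.

Lemma DnD n : Dn n `<=` D. Proof. by rewrite DE => x Dx; exists n. Qed.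

Lemma Dn_rel n : rel_compact (Dn n) D.
Proof. by have [cD DD] := DnS n; split=> // x /DD /DnD. Qed.

Lemma Dn_x0 n : Dn n x0. Proof. exact: (Dn_mono (leq0n n)). Qed.

Lemma compact_sub_Dn (K : set X) : compact K -> K `<=` D ->
  exists n, K `<=` Dn n.
Proof.
move=> /compact_near_coveringP cK KD.
have [] := cK nat \oo (fun n x => Dn n x) _ _; first last.
  by move=> N _ HN; exists N; exact: (HN N (leqnn N)).
move=> x /KD; rewrite DE => -[N _ Nx].
exists (Dn N, [set n | (N <= n)%N]) => /=.
  by split; [apply: open_nbhs_nbhs; split=> //; exact: Dn_open|exists N].
by move=> [y n] /= [Ny Nn]; exact: (Dn_mono Nn).
Qed.

(** Harmonic functions on D as functions on X with arbitrary values outside D: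
    this avoids restricting functions to the sets D_n. *)
Definition harm w := {within D, continuous w} /\
  forall V, Dom V -> regular om V -> rel_compact V D ->
  forall x, V x -> w x = mean om V w x.

Lemma harmonic_harm (u : D -> R) : is_harmonic om Dom u <-> harm ('valL_0 u).
Proof.
have uE (x : D) : 'valL_0 u (set_val x) = u x.
  exact: (congr1 (fun f : D -> R => f x) (valLK 0 u)).
split=> -[uc um]; split.
- exact/subspace_valL_continuousP'.
- move=> V DV rV VD x Vx; have /mem_set Dx : D x by have [_] := VD; apply; exact: subset_closure.
  by have := um V DV rV VD (exist _ x Dx) Vx; rewrite -uE.
- exact/subspace_valL_continuousP'.
- by move=> V DV rV VD x Vx; rewrite -uE; exact: um.
Qed.

Lemma harm_eq w v : (forall x, D x -> w x = v x) -> harm w -> harm v.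
Proof.
move=> wv [wc wm]; split.
  by apply: subspace_eq_continuous wc => x; rewrite inE => Dx; rewrite /from_subspace wv.
move=> V DV rV VD x Vx; rewrite -wv; last by have [_] := VD; apply; exact: subset_closure.
rewrite (wm V DV rV VD x Vx); apply: eq_mean => y /(bd_rel_compact VD).
exact: wv.
Qed.

Lemma harm_bounded w V : harm w -> rel_compact V D -> bdm (bd V) w.
Proof. by move=> [wc _] VD; exact: within_bd_bounded wc. Qed.

Lemma harm_Dn w n x : harm w -> Dn n x -> w x = mean om (Dn n) w x.
Proof.
by move=> [_ wm] nx; have [Domn regn] := Dn_reg n; apply: wm => //; exact: Dn_rel.
Qed.

(** On D_n the function is its own mean, and means are continuous. *)
Lemma harm_of_mean w : (forall n, bdm (bd (Dn n)) w) ->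
  (forall V, Dom V -> regular om V -> rel_compact V D ->
    forall x, V x -> w x = mean om V w x) -> harm w.
Proof.
move=> wb wm; split=> //; rewrite continuous_open_subspace// => x.
rewrite inE {1}DE => -[n _ nx]; have [Domn regn] := Dn_reg n.
have := continuous_mean Domn (wb n).
rewrite (continuous_open_subspace _ (Dn_open n)) => /(_ x).
rewrite inE => /(_ nx) mc.
rewrite /continuous_at (wm _ Domn regn (Dn_rel n) x nx).
apply: cvg_trans mc; apply: near_eq_cvg.
have : nbhs x (Dn n) by apply: open_nbhs_nbhs; split=> //; exact: Dn_open.
by apply: filterS => y ny; rewrite (wm _ Domn regn (Dn_rel n) y ny).
Qed.

Lemma harmD v w : harm v -> harm w -> harm (fun x => v x + w x).
Proof.
move=> hv hw; apply: harm_of_mean => [n|V DV rV VD x Vx].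
  by apply: bounded_measurableD; apply: harm_bounded => //; exact: Dn_rel.
rewrite meanD ?om_bd//; try exact: harm_bounded.
by congr (_ + _); [apply: hv.2|apply: hw.2].
Qed.

Lemma harmZ (c : R) w : harm w -> harm (fun x => c * w x).
Proof.
move=> hw; apply: harm_of_mean => [n|V DV rV VD x Vx].
  by apply: bounded_measurableZ; apply: harm_bounded => //; exact: Dn_rel.
rewrite meanZ ?om_bd//; last exact: harm_bounded.
by congr (_ * _); apply: hw.2.
Qed.

Lemma harm0 : harm (cst 0).
Proof.
apply: harm_of_mean => [n|V DV rV VD x Vx]; first exact: bounded_measurable_cst.
by rewrite mean_cst// om_bd.
Qed.

(** Both x and y lie in some D_k, and the harmonic measures of D_k have the same
    null sets. *)
Lemma harm_eq0 w x : harm w -> (forall y, D y -> 0 <= w y) -> D x -> w x = 0 ->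
  forall y, D y -> w y = 0.
Proof.
move=> hw w0 Dx wx0 y Dy; move: (Dx) (Dy); rewrite DE => -[m _ mx] [n _ ny].
have {}mx := Dn_mono (leq_maxl m n) mx; have {}ny := Dn_mono (leq_maxr m n) ny.
set k := maxn m n in mx ny; have [Domk regk] := Dn_reg k.
have [_ /(_ y x ny mx) dom] := hf_measure hf Domk.
have wb := harm_bounded hw (Dn_rel k).
have wk0 z : bd (Dn k) z -> 0 <= w z by move=> /(bd_rel_compact (Dn_rel k)); exact: w0.
have mEw : measurable_fun (bd (Dn k) : set (borel x0)) (EFin \o w).
  by apply/measurable_EFinP; exact: wb.1.
have wi z : Dn k z -> (om (Dn k) z).-integrable (bd (Dn k)) (EFin \o w).
  move=> kz; apply: bounded_measurable_integrable => //; exact: (om_lty Domk kz).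
have Ix : (\int[om (Dn k) x]_(z in bd (Dn k)) `|(w z)%:E| = 0)%E.
  rewrite -[LHS]fineK.
    have -> : fine (\int[om (Dn k) x]_(z in bd (Dn k)) `|(w z)%:E|)%E = mean om (Dn k) w x.
      by congr fine; apply: eq_integral => z /set_mem /wk0 wz; rewrite gee0_abs.
    by rewrite -(harm_Dn hw mx) wx0.
  by apply: integrable_fin_num => //; apply: integrable_abse; exact: wi.
have /(ae_eq_integral_abs _ (measurable_bd (Dn k)) mEw) [N [mN N0 wN]] := Ix.
have N0y : om (Dn k) y N = 0.
  by have /null_content_dominatesP := dom; apply.
rewrite (harm_Dn hw ny) /mean /Rintegral (ae_eq_integral (cst 0%E))//.
  by rewrite integral0.
by exists N; split.
Qed.

End harmonic.

(** * The lattice of harmonic functions *)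

Section harmonic_lattice.
Context {R : realType} {X : metricType R} {x0 : X}.
Variable om : set X -> X -> probability (borel x0) R.
Variable Dom : set (set X).
Hypothesis hf : harmonic_framework om Dom.
Variables (D : set X) (Dn : nat -> set X).
Hypothesis oD : open D.
Hypothesis Dn_reg : forall n, Dom (Dn n) /\ regular om (Dn n).
Hypothesis DnS : forall n, rel_compact (Dn n) (Dn n.+1).
Hypothesis DE : D = \bigcup_n Dn n.
Local Notation harm := (harm om Dom D).
Local Notation bdm A f := (@bounded_measurable _ (borel x0) R A f).

Lemma harmB v w : harm v -> harm w -> harm (fun x => v x - w x).
Proof.
move=> hv hw; have := harmD hf oD Dn_reg DnS DE hv (harmZ hf oD Dn_reg DnS DE (-1) hw).
by under eq_fun do rewrite mulN1r.
Qed.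

(** The least harmonic majorant is the increasing limit of the means of
    max(u, v) over the boundaries of the D_n.  For V relatively compact in D,
    consistency of the harmonic measures gives these means the mean value
    property on V for all large n, and b bounds them. *)
Lemma harm_lub u v b : harm u -> harm v -> harm b ->
  (forall x, D x -> u x <= b x) -> (forall x, D x -> v x <= b x) ->
  exists s, [/\ harm s, forall x, D x -> u x <= s x, forall x, D x -> v x <= s x &
    forall w, harm w -> (forall x, D x -> u x <= w x) ->
    (forall x, D x -> v x <= w x) -> forall x, D x -> s x <= w x].
Proof.
move=> hu hv hb ub vb.
pose m x := Num.max (u x) (v x); pose s_ n := mean om (Dn n) m.
have Drel n : rel_compact (Dn n) D := Dn_rel DnS DE n.
have mb V : rel_compact V D -> bdm (bd V) m.
  move=> VD; have [mu [Mu HMu]] := harm_bounded hu VD.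
  have [mv [Mv HMv]] := harm_bounded hv VD.
  split; first exact: measurable_maxr.
  exists (Mu + Mv) => x Vx; rewrite /m; have := HMu x Vx; have := HMv x Vx.
  rewrite !ler_norml => /andP[v1 v2] /andP[u1 u2].
  by rewrite /Num.max; case: ifP => _; apply/andP; split; lra.
have um V x : Dom V -> regular om V -> rel_compact V D -> V x ->
    forall w, harm w -> (forall y, D y -> w y <= m y) -> w x <= mean om V m x.
  move=> DV rV VD Vx w hw wm; rewrite (hw.2 V DV rV VD x Vx).
  apply: mean_le; [exact: (om_bd hf DV Vx)|exact: harm_bounded hw VD|exact: mb|].
  by move=> y /(bd_rel_compact VD); exact: wm.
have us n x : Dn n x -> u x <= s_ n x.
  move=> nx; have [Domn regn] := Dn_reg n.
  by apply: um => // y _; rewrite le_max lexx.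
have vs n x : Dn n x -> v x <= s_ n x.
  move=> nx; have [Domn regn] := Dn_reg n.
  by apply: um => // y _; rewrite le_max lexx orbT.
have sw n x w : Dn n x -> harm w -> (forall x, D x -> u x <= w x) ->
    (forall x, D x -> v x <= w x) -> s_ n x <= w x.
  move=> nx hw uw vw; have [Domn regn] := Dn_reg n.
  rewrite (hw.2 _ Domn regn (Drel n) x nx).
  apply: mean_le; [exact: (om_bd hf Domn nx)|exact: mb|exact: harm_bounded hw _|].
  by move=> y /(bd_rel_compact (Drel n)) Dy; rewrite ge_max uw// vw.
have sb n V : rel_compact V (Dn n) -> bdm (bd V) (s_ n).
  move=> Vn; have [Domn regn] := Dn_reg n.
  apply: (within_bd_bounded Vn).
  exact: (continuous_mean hf Domn (mb _ (Drel n))).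
have smean n V x : Dom V -> regular om V -> rel_compact V (Dn n) -> V x ->
    s_ n x = mean om V (s_ n) x.
  move=> DV rV Vn Vx; have [Domn regn] := Dn_reg n.
  exact: (hf_consistent hf Domn DV Vn rV (mb _ (Drel n)) Vx).
have smono n x : Dn n x -> s_ n x <= s_ n.+1 x.
  move=> nx; have [Domn regn] := Dn_reg n.
  rewrite (smean n.+1 _ x Domn regn (DnS n) nx).
  apply: mean_le; [exact: (om_bd hf Domn nx)|exact: mb|exact: sb|].
  by move=> y /(bd_rel_compact (DnS n)) ny; rewrite ge_max us// vs.
pose s x := limn (fun n => s_ n x).
have slim x : D x -> (fun n => s_ n x) @ \oo --> s x.
  rewrite {1}DE => -[N _ Nx]; suff : cvgn (fun n => s_ n x) by [].
  have Dnx n : Dn (n + N)%N x by apply: (Dn_mono DnS (leq_addl n N)) Nx.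
  have : cvgn (fun n => s_ (n + N)%N x).
    apply: nondecreasing_is_cvgn.
      by apply/nondecreasing_seqP => n; rewrite addSn; exact: smono.
    exists (b x) => _ [n _ <-]; exact: sw.
  by move=> /cvg_ex[l sl]; apply/cvg_ex; exists l; rewrite -(cvg_shiftn N).
have sV V : Dom V -> regular om V -> rel_compact V D -> forall x, V x ->
    bdm (bd V) s /\ s x = mean om V s x.
  move=> DV rV VD x Vx; have [cV VD'] := VD.
  have [N VN] := compact_sub_Dn hf Dn_reg DnS DE cV VD'.
  have Vn n : rel_compact V (Dn (n + N)%N).
    by split=> // y /VN; exact: (Dn_mono DnS (leq_addl n N)).
  have [_ [Mu HMu]] := harm_bounded hu VD; have [_ [Mb HMb]] := harm_bounded hb VD.
  have sM n y : bd V y -> `|s_ (n + N)%N y| <= Mu + Mb.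
    move=> Vy; have := HMu y Vy; have := HMb y Vy; rewrite !ler_norml.
    have ny := bd_rel_compact (Vn n) Vy.
    have := us _ _ ny; have := sw _ _ b ny hb ub vb => s1 s2.
    by move=> /andP[b1 b2] /andP[u1 u2]; apply/andP; split; lra.
  have cvs y : D y -> (fun n => s_ (n + N)%N y) @ \oo --> s y.
    by move=> Dy; rewrite (cvg_shiftn N (fun n => s_ n y)); exact: slim.
  have [sbd smc] := mean_cvg (om_bd hf DV Vx) (fun n => sb _ _ (Vn n)) sM
    (fun y Vy => cvs y (bd_rel_compact VD Vy)).
  split=> //; have Dx : D x by apply: VD'; exact: subset_closure.
  have := cvs x Dx.
  have -> : (fun n => s_ (n + N)%N x) = fun n => mean om V (s_ (n + N)%N) x.
    by apply/funext => n; exact: smean.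
  by move=> /cvg_unique; apply=> //; exact: Rhausdorff.
exists s; split.
- apply: (harm_of_mean hf oD Dn_reg DnS DE) => [n|V DV rV VD x Vx].
    have [Domn regn] := Dn_reg n.
    have [[y ny] _ _] := hf_domain hf Domn.
    by have [] := sV _ Domn regn (Drel n) y ny.
  by have [] := sV V DV rV VD x Vx.
- move=> x Dx; apply: (cvgr_to_ge (slim x Dx)); move: Dx; rewrite {1}DE => -[N _ Nx].
  by exists N => // n Nn; apply: us; exact: (Dn_mono DnS Nn).
- move=> x Dx; apply: (cvgr_to_ge (slim x Dx)); move: Dx; rewrite {1}DE => -[N _ Nx].
  by exists N => // n Nn; apply: vs; exact: (Dn_mono DnS Nn).
- move=> w hw uw vw x Dx; apply: (cvgr_to_le (slim x Dx)).
  move: Dx; rewrite {1}DE => -[N _ Nx].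
  by exists N => // n Nn; apply: sw => //; exact: (Dn_mono DnS Nn).
Qed.

Local Notation C := (harmonic_nonneg om Dom (D := D)).

Lemma harmonic_nonnegP (u : D -> R) : C u <-> harm ('valL_0 u) /\ forall x, 0 <= u x.
Proof. by split=> -[hu u0]; split=> //; apply/harmonic_harm. Qed.

Lemma valL_val (u : D -> R) (x : D) : 'valL_0 u (set_val x) = u x.
Proof. exact: (congr1 (fun f : D -> R => f x) (valLK 0 u)). Qed.

Lemma harm_fun (u : D -> R) w : harm w -> (forall x : D, u x = w (set_val x)) ->
  harm ('valL_0 u).
Proof.
move=> hw uw; apply: harm_eq hw => x Dx.
have [y yx] : exists y : D, set_val y = x by exists (exist _ x (mem_set Dx)).
by rewrite -yx valL_val uw.
Qed.

Lemma harmonic_nonneg_convex_cone : convex_cone C.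
Proof.
split.
- apply/harmonic_nonnegP; split=> //.
  by apply: harm_fun (harm0 hf oD Dn_reg DnS DE) _.
- move=> u v /harmonic_nonnegP[hu u0] /harmonic_nonnegP[hv v0].
  apply/harmonic_nonnegP; split=> [|x]; last exact: addr_ge0.
  by apply: harm_fun (harmD hf oD Dn_reg DnS DE hu hv) _ => x; rewrite !valL_val.
- move=> a u a0 /harmonic_nonnegP[hu u0].
  apply/harmonic_nonnegP; split=> [|x]; last exact: mulr_ge0.
  by apply: harm_fun (harmZ hf oD Dn_reg DnS DE a hu) _ => x; rewrite !valL_val.
Qed.

Lemma harmonic_lattice : vector_lattice C.
Proof.
have [C0 CD CZ] := harmonic_nonneg_convex_cone.
have Wharm w : cone_space C w -> harm ('valL_0 w).
  move=> [u [v [/harmonic_nonnegP[hu _] /harmonic_nonnegP[hv _] ->]]].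
  by apply: harm_fun (harmB hu hv) _ => x; rewrite !valL_val.
have cleP u v : harm ('valL_0 u) -> harm ('valL_0 v) ->
    cone_le C u v <-> forall x, u x <= v x.
  move=> hu hv; split=> [/harmonic_nonnegP[_ uv] x|uv].
    by rewrite -subr_ge0; exact: uv.
  apply/harmonic_nonnegP; split=> [|x]; last by rewrite /= subr_ge0.
  by apply: harm_fun (harmB hv hu) _ => x; rewrite !valL_val.
have lub u v : cone_space C u -> cone_space C v -> exists s,
    [/\ harm ('valL_0 s), cone_space C s, forall x, u x <= s x, forall x, v x <= s x &
    forall w, harm ('valL_0 w) -> (forall x, u x <= w x) -> (forall x, v x <= w x) ->
    forall x, s x <= w x].
  move=> Wu Wv; have hu := Wharm _ Wu; have hv := Wharm _ Wv.
  case: (Wu) => u1 [u2 [Cu1 Cu2 uE]]; case: (Wv) => v1 [v2 [Cv1 Cv2 vE]].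
  have [hu1 u10] := (harmonic_nonnegP _).1 Cu1; have [hu2 u20] := (harmonic_nonnegP _).1 Cu2.
  have [hv1 v10] := (harmonic_nonnegP _).1 Cv1; have [hv2 v20] := (harmonic_nonnegP _).1 Cv2.
  have onD (P : X -> Prop) : (forall x : D, P (set_val x)) -> forall x, D x -> P x.
    by move=> HP x Dx; exact: (HP (exist _ x (mem_set Dx))).
  have [||s [hs us vs smin]] := harm_lub hu hv (harmD hf oD Dn_reg DnS DE hu1 hv1).
  - apply: onD => x; rewrite !valL_val uE /=.
    by have := u20 x; have := v10 x; lra.
  - apply: onD => x; rewrite !valL_val vE /=.
    by have := v20 x; have := u10 x; lra.
  pose t (x : D) := s (set_val x).
  have ht : harm ('valL_0 t) by exact: harm_fun hs _.
  have tu x : u x <= t x by rewrite -(valL_val u x); apply: us; exact: set_valP.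
  have tv x : v x <= t x by rewrite -(valL_val v x); apply: vs; exact: set_valP.
  exists t; split=> //.
    exists ((t \- u) \+ u1), u2; split=> //.
      by apply: CD => //; exact/(cleP u t hu ht).
    by apply/funext => x; rewrite uE /=; lra.
  move=> w hw uw vw x; rewrite -(valL_val w x); apply: smin => //; last exact: set_valP.
    by apply: onD => y; rewrite !valL_val.
  by apply: onD => y; rewrite !valL_val.
have WL (a : R) u v : cone_space C u -> cone_space C v ->
    cone_space C (fun x => a * u x + v x).
  move=> [u1 [u2 [Cu1 Cu2 ->]]] [v1 [v2 [Cv1 Cv2 ->]]].
  have [a0|a0] := leP 0 a.
    exists ((fun x => a * u1 x) \+ v1), ((fun x => a * u2 x) \+ v2); split.
    - by apply: CD => //; exact: CZ.
    - by apply: CD => //; exact: CZ.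
    - by apply/funext => x /=; lra.
  have na0 : 0 <= - a by rewrite oppr_ge0 ltW.
  exists ((fun x => - a * u2 x) \+ v1), ((fun x => - a * u1 x) \+ v2); split.
  - by apply: CD => //; exact: CZ.
  - by apply: CD => //; exact: CZ.
  - by apply/funext => x /=; lra.
split=> //.
- split=> //; exists (cst 0), (cst 0); split=> //.
  by apply/funext => x; rewrite /= subrr.
- move=> u v Wu Wv /(cleP _ _ (Wharm _ Wu) (Wharm _ Wv)) uv.
  move=> /(cleP _ _ (Wharm _ Wv) (Wharm _ Wu)) vu.
  by apply/funext => x; apply/le_anti; rewrite uv vu.
- move=> u v Wu Wv; have [s [hs Ws us vs smin]] := lub u v Wu Wv.
  have hu := Wharm _ Wu; have hv := Wharm _ Wv.
  exists s; split=> //; [exact/cleP|exact/cleP|].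
  move=> w Ww; have hw := Wharm _ Ww.
  move=> /(cleP _ _ hu hw) uw /(cleP _ _ hv hw) vw; apply/cleP => //; exact: smin.
- move=> u v Wu Wv; have [s [hs Ws us vs smin]] := lub u v Wu Wv.
  have hu := Wharm _ Wu; have hv := Wharm _ Wv.
  pose g x := -1 * s x + (1 * u x + v x).
  have Wg : cone_space C g by apply: (WL (-1)) => //; exact: (WL 1).
  have hg := Wharm _ Wg.
  exists g; split=> //.
  + by apply/cleP => // x; have := vs x; rewrite /g; lra.
  + by apply/cleP => // x; have := us x; rewrite /g; lra.
  + move=> w Ww; have hw := Wharm _ Ww.
    move=> /(cleP _ _ hw hu) wu /(cleP _ _ hw hv) wv.
    apply/cleP => // x; suff : s x <= -1 * w x + (1 * u x + v x) by rewrite /g; lra.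
    apply: (smin (fun x => -1 * w x + (1 * u x + v x))).
    * by apply: Wharm; apply: (WL (-1)) => //; exact: (WL 1).
    * by move=> y; have := wv y; lra.
    * by move=> y; have := wu y; lra.
Qed.

End harmonic_lattice.

(** * Kernels: Harnack inequality and equicontinuity *)

Section kernels.
Context {R : realType} {X : metricType R} {x0 : X}.
Variable om : set X -> X -> probability (borel x0) R.
Variable Dom : set (set X).
Hypothesis hf : harmonic_framework om Dom.
Variables (D : set X) (Dn : nat -> set X).
Hypothesis oD : open D.
Hypothesis Dn_reg : forall n, Dom (Dn n) /\ regular om (Dn n).
Hypothesis Dn0 : Dn 0%N x0.
Hypothesis DnS : forall n, rel_compact (Dn n) (Dn n.+1).
Hypothesis DE : D = \bigcup_n Dn n.
Hypothesis Dn_kernel : forall n, continuous_kernel om (Dn n).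
Local Notation harm := (harm om Dom D).
Local Notation bdm A f := (@bounded_measurable _ (borel x0) R A f).

Lemma kernel_section U k x : {within U `*` bd U, continuous k} -> U x ->
  {within bd U, continuous (fun y : X => k (x, y) : R)}.
Proof.
move=> /subspace_continuousP kc Ux; apply/subspace_continuousP => y by_.
have := kc (x, y) (conj Ux by_); apply: cvg_trans.
move=> A [[P Q] [/= Px Qy] PQA].
apply: filterS Qy => z Qz bz; apply: (PQA (x, z)) => //.
by split=> //=; exact: nbhs_singleton.
Qed.

Lemma kernel_bounded U k x : compact (bd U) -> {within U `*` bd U, continuous k} ->
  U x -> bdm (bd U) (fun y : X => k (x, y) : R).
Proof.
move=> cU kc Ux; have kx := kernel_section kc Ux; split.
  apply: within_measurable => //; exact: measurable_bd.
exact: (within_bounded cU (@subset_refl _ _) kx).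
Qed.

(** The change of variables from the harmonic measure at x to the one at x0. *)
Lemma kernel_mean n k x w : {within Dn n `*` bd (Dn n), continuous k} ->
  (forall x, Dn n x -> {ae om (Dn n) x0, forall y, bd (Dn n) y ->
    relative_kernel om (Dn n) x y = (k (x, y))%:E}) ->
  Dn n x -> bdm (bd (Dn n)) w ->
  mean om (Dn n) w x = mean om (Dn n) (fun y => w y * k (x, y)) x0.
Proof.
move=> kc kE nx wb; have [Domn regn] := Dn_reg n.
have n0 := Dn_x0 Dn0 DnS n.
have [_ /(_ x x0 nx n0) dom] := hf_measure hf Domn.
have mbd := measurable_bd (x0 := x0) (Dn n).
have wi : (om (Dn n) x).-integrable (bd (Dn n)) (EFin \o w).
  exact: bounded_measurable_integrable (om_lty hf Domn nx) wb.
have kb := kernel_bounded (compact_bd (DnS n)) kc nx.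
have RNm : measurable_fun setT (relative_kernel om (Dn n) x : borel x0 -> _).
  by apply: measurable_int; exact: Radon_Nikodym_integrable.
congr fine; rewrite -(Radon_Nikodym_change_of_variables dom mbd wi).
apply: ae_eq_integral => //.
- apply: emeasurable_funM; last exact: measurable_funTS.
  by apply/measurable_EFinP; exact: wb.1.
- by apply/measurable_EFinP; exact: (bounded_measurableM wb kb).1.
- have [N [mN N0 kN]] := kE x nx; exists N; split=> // y ny; apply: kN => /= H.
  by apply: ny => bdy; rewrite /= EFinM -H.
Qed.

Lemma harm_harnack x : D x -> exists M : R, forall w, harm w ->
  (forall y, D y -> 0 <= w y) -> w x <= M * w x0.
Proof.
rewrite {1}DE => -[n _ nx]; have [k [kc kE]] := Dn_kernel n.
have kb := kernel_bounded (compact_bd (DnS n)) kc nx; have [_ [M HM]] := kb.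
exists M => w hw w0; have n0 := Dn_x0 Dn0 DnS n.
have [Domn regn] := Dn_reg n; have Drel := Dn_rel DnS DE n.
have wb := harm_bounded hw Drel.
rewrite (harm_Dn Dn_reg DnS DE hw nx) (kernel_mean kc kE nx wb).
rewrite (harm_Dn Dn_reg DnS DE hw n0) -meanZ ?(om_bd hf Domn n0)//.
apply: mean_le; [exact: (om_bd hf Domn n0)|exact: bounded_measurableM|
  exact: bounded_measurableZ|].
move=> y bdy; rewrite [leRHS]mulrC ler_wpM2l//.
  by apply: w0; exact: bd_rel_compact Drel _ bdy.
by apply: le_trans (HM y bdy); exact: ler_norm.
Qed.

(** The boundary of D_n being compact, k(x', .) is uniformly close to k(x, .)
    for x' near x; integrate this against w and the harmonic measure at x0. *)
Lemma harm_equicontinuous x (e : R) : D x -> 0 < e ->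
  \forall x' \near x, forall w, harm w -> (forall y, D y -> 0 <= w y) ->
  `|w x' - w x| <= e * w x0.
Proof.
rewrite {1}DE => -[n _ nx] e0; have [k [kc kE]] := Dn_kernel n.
have n0 := Dn_x0 Dn0 DnS n.
have [Domn regn] := Dn_reg n; have Drel := Dn_rel DnS DE n.
have nbx : nbhs x (Dn n).
  by apply: open_nbhs_nbhs; split=> //; exact: (Dn_open hf Dn_reg).
have /compact_near_coveringP/near_covering_withinP cov := compact_bd (DnS n).
have := cov X (nbhs x) (fun x' y => Dn n x' -> `|k (x', y) - k (x, y)| <= e) _ _.
move=> /(_ (nbhs_filter x)) near_k.
have {}near_k : \forall x' \near x, bd (Dn n) `<=`
    (fun y => Dn n x' -> `|k (x', y) - k (x, y)| <= e).
  apply: near_k => y bdy.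
  move/subspace_continuousP : kc => /(_ (x, y) (conj nx bdy)) /cvgrPdist_le.
  have e2 : 0 < e / 2 by rewrite divr_gt0.
  move=> /(_ _ e2) [[P Q] [/= Px Qy] PQ].
  exists (Q, P) => //= -[y' x'] /= [Qy' Px'] bdy' nx'.
  have H1 := PQ (x', y') (conj Px' Qy') (conj nx' bdy').
  have H2 := PQ (x, y') (conj (nbhs_singleton Px) Qy') (conj nx bdy').
  move: H1 H2; rewrite /from_subspace /= !ler_norml => /andP[a1 a2] /andP[b1 b2].
  by apply/andP; split; lra.
apply: filterS2 near_k nbx => x' kx' nx' w hw w0.
have wb := harm_bounded hw Drel.
rewrite (harm_Dn Dn_reg DnS DE hw nx') (kernel_mean kc kE nx' wb).
rewrite (harm_Dn Dn_reg DnS DE hw nx) (kernel_mean kc kE nx wb).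
have kb z : Dn n z -> bdm (bd (Dn n)) (fun y : X => k (z, y)).
  by move=> nz; exact: kernel_bounded (compact_bd (DnS n)) kc nz.
have kw z nz := bounded_measurableM wb (kb z nz).
have eb := bounded_measurableZ e wb.
have o1 := om_bd hf Domn n0.
rewrite (harm_Dn Dn_reg DnS DE hw n0) -meanB ?o1//; try exact: kw.
have db := bounded_measurableB (kw x' nx') (kw x nx).
rewrite ler_norml; apply/andP; split.
  rewrite -mulNr -meanZ//; apply: mean_le => //; first exact: bounded_measurableZ.
  move=> y bdy; have := kx' y bdy nx'; rewrite ler_norml => /andP[H _].
  have wy : 0 <= w y by apply: w0; exact: bd_rel_compact Drel _ bdy.
  by have := ler_wpM2l wy H; rewrite /=; lra.
rewrite -meanZ//; apply: mean_le => // y bdy.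
have := kx' y bdy nx'; rewrite ler_norml => /andP[_ H].
have wy : 0 <= w y by apply: w0; exact: bd_rel_compact Drel _ bdy.
by have := ler_wpM2l wy H; lra.
Qed.

End kernels.

(** * The compact base of the positive harmonic functions *)

Section martin_base.
Context {R : realType} {X : metricType R} {x0 : X}.
Variable om : set X -> X -> probability (borel x0) R.
Variable Dom : set (set X).
Hypothesis hf : harmonic_framework om Dom.
Variables (D : set X) (Dn : nat -> set X).
Hypothesis oD : open D.
Hypothesis Dn_reg : forall n, Dom (Dn n) /\ regular om (Dn n).
Hypothesis Dn0 : Dn 0%N x0.
Hypothesis DnS : forall n, rel_compact (Dn n) (Dn n.+1).
Hypothesis DE : D = \bigcup_n Dn n.
Hypothesis Dn_kernel : forall n, continuous_kernel om (Dn n).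
Variable o : D.
Hypothesis o0 : set_val o = x0.
Local Notation harm := (harm om Dom D).
Local Notation C := (harmonic_nonneg om Dom (D := D)).
Local Notation ext := (@valL_ X R 0 D).

Lemma nonneg_ext u : C u -> harm (ext u) /\ forall y, D y -> 0 <= ext u y.
Proof.
move=> /harmonic_nonnegP[hu u0]; split=> // y Dy.
by have := u0 (exist _ y (mem_set Dy)); rewrite -(valL_val u).
Qed.

Lemma ext_o (u : D -> R) : ext u x0 = u o.
Proof. by rewrite -o0 valL_val. Qed.

Definition in_D y (Dy : D y) : D := exist _ y (mem_set Dy).

Lemma extE (u : D -> R) y (Dy : D y) : ext u y = u (in_D Dy).
Proof. by rewrite -(valL_val u). Qed.

Lemma nonneg_harnack (x : D) : exists M : R, forall u, C u -> u x <= M * u o.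
Proof.
have [M HM] := harm_harnack hf Dn_reg Dn0 DnS DE Dn_kernel (set_valP x).
exists M => u /nonneg_ext[hu u0].
by rewrite -(valL_val u x) -ext_o; exact: HM.
Qed.

Lemma nonneg_equicontinuous x (e : R) : D x -> 0 < e ->
  \forall x' \near x, forall u, C u -> `|ext u x' - ext u x| <= e * u o.
Proof.
move=> Dx e0.
have := harm_equicontinuous hf Dn_reg Dn0 DnS DE Dn_kernel Dx e0.
by apply: filterS => x' Hx' u /nonneg_ext[hu u0]; rewrite -ext_o; exact: Hx'.
Qed.

(** For a filter of positive harmonic functions bounded at o and converging
    pointwise, equicontinuity upgrades the convergence to a uniform one on
    compact sets, and the mean value property passes to the limit. *)
Section limits.
Variables (F : set_system (D -> R)) (w : D -> R) (B : R).
Hypothesis PF : ProperFilter F.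
Hypothesis FC : F [set u | C u /\ u o <= B].
Hypothesis Fw : forall x, (fun u => u x) @ F --> w x.

Lemma limit_equicontinuous x (e : R) : D x -> 0 < e ->
  \forall x' \near x, D x' -> (forall u, C u -> u o <= B ->
    `|ext u x' - ext u x| <= e) /\ `|ext w x' - ext w x| <= e.
Proof.
move=> Dx e0; pose B' := `|B| + 1.
have B0 : 0 < B' by rewrite ltr_wpDl.
have eB : 0 < e / B' by rewrite divr_gt0.
have := nonneg_equicontinuous Dx eB; apply: filterS => x' Hx' Dx'.
have Hu u : C u -> u o <= B -> `|ext u x' - ext u x| <= e.
  move=> Cu uB; apply: le_trans (Hx' u Cu) _.
  rewrite mulrAC ler_pdivrMr// ler_wpM2l ?(ltW e0)//.
  by apply: le_trans uB _; apply: le_trans (ler_norm _) _; rewrite lerDl.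
split=> //; rewrite !extE.
apply: (cvgr_to_le (cvg_norm (cvgB (@Fw (in_D Dx')) (@Fw (in_D Dx))))); apply: filterS FC => u [Cu uB].
by have := Hu u Cu uB; rewrite !extE.
Qed.

Lemma limit_uniform (K : set X) (e : R) : compact K -> K `<=` D -> 0 < e ->
  F [set u | forall x, K x -> `|ext u x - ext w x| <= e].
Proof.
move=> /compact_near_coveringP/near_covering_withinP cK KD e0.
have := cK (D -> R) F (fun u x => `|ext u x - ext w x| <= e) _.
apply=> x Kx; have Dx := KD x Kx.
have e3 : 0 < e / 3 by rewrite divr_gt0.
have near_x := limit_equicontinuous Dx e3.
have Fx : F [set u | C u /\ u o <= B /\ `|ext u x - ext w x| <= e / 3].
  have /cvgrPdist_le/(_ _ e3) := @Fw (in_D Dx).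
  apply: filterS2 FC => u [Cu uB] /=; rewrite distrC -!extE => H.
  by split=> //; split=> //; rewrite !extE -!extE.
exists ([set x' | D x' -> (forall u, C u -> u o <= B ->
    `|ext u x' - ext u x| <= e / 3) /\ `|ext w x' - ext w x| <= e / 3],
  [set u | C u /\ u o <= B /\ `|ext u x - ext w x| <= e / 3]) => //=.
move=> [x' u] /= [Hx' [Cu [uB ux]]] Kx'.
have [/(_ u Cu uB) ux' wx'] := Hx' (KD x' Kx').
move: ux ux' wx'; rewrite !ler_norml => /andP[a1 a2] /andP[b1 b2] /andP[c1 c2].
by apply/andP; split; lra.
Qed.

Lemma limit_harmonic : C w.
Proof.
have [u1 [Cu1 _]] := filter_ex FC.
have wc : {within D, continuous (ext w)}.
  rewrite continuous_open_subspace// => x; rewrite inE => Dx.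
  apply/cvgrPdist_le => e e0.
  have nD : nbhs x D by exact: open_nbhs_nbhs.
  apply: filterS2 (limit_equicontinuous Dx e0) nD => x' Hx' Dx'.
  by have [_] := Hx' Dx'; rewrite distrC.
apply/harmonic_nonnegP; split; last first.
  move=> x; apply: (cvgr_to_ge (@Fw x)); apply: filterS FC => u [[_ u0] _]; exact: u0.
split=> // V DV rV VD x Vx; have [cV VD'] := VD.
have Dx : D x by apply: VD'; exact: subset_closure.
apply/eqP; rewrite -subr_eq0 -normr_le0; apply/ler_addgt0Pr => e e0; rewrite add0r.
have e2 : 0 < e / 2 by rewrite divr_gt0.
have [u [[Cu _] Hu]] := filter_ex (filterI FC (limit_uniform cV VD' e2)).
have [hu u0] := nonneg_ext Cu.
have ux := Hu x (subset_closure Vx).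
have mux : `|mean om V (ext u) x - mean om V (ext w) x| <= e / 2.
  apply: mean_dist; [exact: (om_bd hf DV Vx)|exact: harm_bounded hu VD|
    exact: within_bd_bounded VD wc|].
  by move=> y /bd_closure; exact: Hu.
rewrite -(hu.2 V DV rV VD x Vx) in mux.
move: ux mux; rewrite !ler_norml => /andP[a1 a2] /andP[b1 b2].
by apply/andP; split; lra.
Qed.

End limits.

Lemma nonneg_closed : pointwise_closed C.
Proof.
move=> w Cw; have [F [UF FC Fw]] := pointwise_adherent_filter Cw.
have PF : ProperFilter F := @ultra_proper _ _ UF.
apply: (limit_harmonic (F := F) (B := w o + 1)) => //.
have /cvgrPdist_le/(_ 1 ltr01) := Fw o; apply: filterS2 FC => u Cu /=.
by rewrite distrC ler_norml => /andP[_]; rewrite lerBlDl => H; split.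
Qed.

Lemma nonneg_based_cone : based_cone C o.
Proof.
have lat := harmonic_lattice hf oD Dn_reg DnS DE.
have C0 u : C u -> forall x, 0 <= u x by case.
split=> //.
- exact: (harmonic_nonneg_convex_cone hf oD Dn_reg DnS DE).
- exact: nonneg_harnack.
- exact: nonneg_closed.
- exact: lattice_riesz.
Qed.

Lemma nonneg_positive (u : D -> R) : C u -> u <> cst 0 -> forall x, 0 < u x.
Proof.
move=> Cu un0 x; have [hu u0] := nonneg_ext Cu.
rewrite lt_neqAle (proj2 Cu) andbT; apply/negP => /eqP ux; apply: un0.
apply/funext => y; rewrite -(valL_val u y).
apply: (harm_eq0 hf Dn_reg DnS DE hu u0 (set_valP x)); last exact: set_valP.
by rewrite valL_val.
Qed.

Local Notation S := (harmonic_one om Dom (D := D)).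

Lemma harmonic_oneP (u : D -> R) : S u <-> C u /\ u o = 1.
Proof.
split=> [[hu up u1]|[Cu u1]].
  by split; [split=> // x; exact: ltW|rewrite -ext_o].
split; [exact: Cu.1| |by rewrite ext_o].
apply: nonneg_positive => // u0; move: u1; rewrite u0 /= => /esym/eqP.
by rewrite oner_eq0.
Qed.

Lemma compact_harmonic_one : compact S.
Proof.
rewrite compact_ultra => U UU US; have PU : ProperFilter U := @ultra_proper _ _ UU.
have UC : U [set u : D -> R | C u /\ u o <= 1].
  by apply: filterS US => u /harmonic_oneP[Cu u1]; split=> //; rewrite u1.
have [w Cw Uw] : exists2 w : D -> R, C w & forall x, (fun u => u x) @ U --> w x.
  exact: (ultra_cone_cvg nonneg_based_cone (f := fun u : D -> R => u) (B := 1)).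
exists w; split.
  apply/harmonic_oneP; split=> //.
  have U1 : (fun u : D -> R => u o) @ U --> (1 : R).
    apply: cvg_near_cst; apply: filterS US => u /harmonic_oneP[_]; exact.
  by apply: cvg_unique (Uw o) U1; exact: Rhausdorff.
apply/fam_cvgP => K cK A /uniform_nbhs[E [entE EA]].
have [e /= e0 He] : exists2 e : R, 0 < e & forall a b : R, `|a - b| < e -> E (a, b).
  move: entE; rewrite -entourage_ballE => -[e /= e0 He]; exists e => // a b ab.
  exact: He.
have cK' : compact (set_val @` K).
  apply: continuous_compact cK; apply: continuous_subspaceT.
  exact: initial_continuous.
have KD : set_val @` K `<=` D by move=> _ [x _ <-]; exact: set_valP.
have e2 : 0 < e / 2 by rewrite divr_gt0.
have := limit_uniform PU UC Uw cK' KD e2; apply: filterS => u Hu.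
apply: EA => x Kx; apply: He; rewrite distrC.
have := Hu (set_val x) (imageP _ Kx); rewrite !valL_val => /le_lt_trans; apply.
by rewrite ltr_pdivrMr// ltr_pMr// ltr1n.
Qed.

(** Finite sets of points, directed by inclusion, eventually come e-close to
    every point of a compact set. *)
Lemma finite_net (K : set X) (e : R) : compact K -> K `<=` D -> 0 < e ->
  exists s : seq D, forall x, K x -> exists2 z, z \in s & ball (set_val z) e x.
Proof.
move=> /compact_near_coveringP cK KD e0.
pose F := filter_from [set: seq D] (fun s0 : seq D => [set s : seq D | {subset s0 <= s}]).
have PF : ProperFilter F.
  apply: filter_from_proper; last by move=> s _; exists s.
  apply: filter_from_filter; first by exists [::].
  move=> s t _ _; exists (s ++ t) => // r st.
  by split=> z zs; apply: st; rewrite mem_cat zs ?orbT.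
have := cK (seq D) F (fun s x => exists2 z, z \in s & ball (set_val z) e x) _.
case=> [x Kx|s0 _ Hs]; last by exists s0; exact: (Hs s0).
pose z : D := exist _ x (mem_set (KD x Kx)).
exists (ball x e, [set s : seq D | z \in s]) => /=.
  split; first exact: nbhsx_ballx.
  by exists [:: z] => // s; apply; rewrite mem_head.
by move=> [y s] /= [xy zs]; exists z.
Qed.

(** A countable dense subset separates continuous functions; it is the union of
    finite nets of the compact closures of the D_n. *)
Lemma nonneg_separating : exists xs : nat -> D, forall u v, C u -> C v ->
  (forall k, u (xs k) = v (xs k)) -> u = v.
Proof.
have e0 m : 0 < m.+1%:R^-1 :> R by rewrite invr_gt0.
have /choice[net Hnet] (nm : nat * nat) : exists s : seq D,
    forall x, Dn nm.1 x -> exists2 z, z \in s & ball (set_val z) nm.2.+1%:R^-1 x.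
  have [cD DD] := Dn_rel DnS DE nm.1.
  have [s Hs] := finite_net cD DD (e0 nm.2).
  by exists s => x nx; apply: Hs; exact: subset_closure.
pose xs k := if unpickle k is Some (nm, i) then nth o (net nm) i else o.
exists xs => u v Cu Cv uv; apply/funext => x.
have [[uc _] _] := nonneg_ext Cu; have [[vc _] _] := nonneg_ext Cv.
pose f y := ext u y - ext v y.
have Dx : D (set_val x) := set_valP x.
apply/eqP; rewrite -subr_eq0 -(valL_val u) -(valL_val v) -/(f _).
apply/negP => /negP fx.
have fc : f @ set_val x --> f (set_val x).
  rewrite (continuous_open_subspace _ oD) in uc.
  rewrite (continuous_open_subspace _ oD) in vc.
  by apply: cvgB; [apply: uc|apply: vc]; rewrite inE.
have f0 : 0 < `|f (set_val x)| by rewrite normr_gt0.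
have /cvgrPdist_lt/(_ _ f0)/nbhs_ballP[r /= r0 Hr] := fc.
have [m mr] := ltr_add_invr r0; rewrite add0r in mr.
move: (Dx); rewrite {1}DE => -[n _ nx].
have [z zs zx] := Hnet (n, m) (set_val x) nx.
have fz : f (set_val z) = 0.
  rewrite /f !valL_val -(nth_index o zs).
  have := uv (pickle ((n, m), index z (net (n, m)))).
  by rewrite /xs pickleK => ->; rewrite subrr.
have /Hr : ball (set_val x) r (set_val z).
  by apply: (le_ball (ltW mr)); exact: ball_sym.
by rewrite /= fz subr0 ltxx.
Qed.

End martin_base.

Theorem lemma4p12 (R : realType) (X : metricType R) (x0 : X)
    (Dom : set (set X)) (om : set X -> X -> probability (borel x0) R)
    (D : set X) (Dn : nat -> set X) :
  harmonic_framework om Dom ->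
  is_domain D -> D x0 ->
  (forall n, Dom (Dn n) /\ regular om (Dn n)) ->
  Dn 0%N x0 ->
  (forall n, rel_compact (Dn n) (Dn n.+1)) ->
  D = \bigcup_n Dn n ->
  (forall n, continuous_kernel om (Dn n)) ->
  [/\ forall u : D -> R, harmonic_nonneg om Dom u -> u <> cst 0 ->
        forall x : D, 0 < u x,
      vector_lattice (harmonic_nonneg om Dom (D := D)) &
      choquet_simplex (harmonic_one om Dom (D := D))].
Proof.
move=> hf [_ _ oD] Dx0 Dn_reg Dn0 DnS DE Dn_kernel.
pose o : D := exist _ x0 (mem_set Dx0).
have o0 : set_val o = x0 by [].
split.
- exact: (nonneg_positive hf Dn_reg DnS DE).
- exact: (harmonic_lattice hf oD Dn_reg DnS DE).
have bC := nonneg_based_cone hf oD Dn_reg Dn0 DnS DE Dn_kernel o0.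
have [xs xs_sep] := nonneg_separating om Dom oD DnS DE o.
apply: (choquet_simplex_of_based_cone bC xs_sep).
- exact: (harmonic_oneP hf Dn_reg DnS DE o0).
- exact: (compact_harmonic_one hf oD Dn_reg Dn0 DnS DE Dn_kernel o0).
Qed.
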